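(* Assume that $F$ is convex and $L(\nabla F)$-smooth, that $P$ is $\mu$-restricted strongly convex with $\mu>0$, i.e. $P(x)\ge P(x_\star)+\frac{\mu}{2}\|x-x_\star\|^2$ for all $x\in\mathbb R^d$, and that there exists $\sigma_f$ such that $\mathbb E[\|\nabla f(x,\xi)-\nabla F(x)\|^2]\le\sigma_f^2$ for all $x$. Let $\omega>1$, $0<\alpha_0\le\frac{3}{4L(\nabla F)}$, let $m_0\ge 2$ be an integer with $m_0\ge\frac{\omega}{\mu\alpha_0}$, and for $s\in\mathbb N$ set $m_s=\lfloor m_0\omega^s\rfloor$, $\alpha_s=\alpha_0\omega^{-s}$, $\beta_s=4\alpha_s\|A\|_{2,\infty}^2$, $M_s=\sum_{l=0}^sm_l$. Let $\bar x^s$ be the averaged iterates produced by the algorithm SASC (described in the context) with these parameters and with the restart rule $x_0^{s+1}=\bar x^s$. Then, for all $s\in\mathbb N$, $$\mathbb E[P(\bar x^s)-P(x_\star)]\le\frac1{M_s}\left[D_1+\frac{\log(M_s/m_0)}{\log\omega}D_2\right],$$ $$\mathbb E[P(\bar x^s)-P(x_\star)]\ge-\frac{2D_3}{M_s}\|y_\star\|^2-\frac1{M_s}\left[D_1+\frac{\log(M_s/m_0)}{\log\omega}D_2\right],$$ $$\sqrt{\mathbb E\left[\operatorname{dist}(A(\xi)\bar x^s,b(\xi))^2\right]}\le\frac1{M_s}\left[2D_3\|y_\star\|+2\sqrt{D_3}\sqrt{D_1+\frac{\log(M_s/m_0)}{\log\omega}D_2}\right],$$ where $$D_1=\frac{\omega}{\omega-1}\,\frac{m_0}{\alpha_0(m_0-1)}\,\frac12\|x_0^0-x_\star\|^2+2\alpha_0m_0\frac{\omega}{\omega-1}\sigma_f^2,$$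 $$D_2=\frac{2m_0^2\alpha_0\omega}{(m_0-1)(\omega-1)}\left(\|A\|_{2,\infty}^2\|y_\star\|^2+\sigma_f^2\right),\qquad D_3=4\alpha_0m_0\|A\|_{2,\infty}^2\frac{\omega}{\omega-1}.$$
   Context: Problem. Let $\xi$ be a random variable with law $\mu(d\xi)$ (not to be confused with the constant $\mu>0$). Consider minimizing $P(x):=F(x)+h(x)$ over $x\in\mathbb R^d$ subject to $A(\xi)x\in b(\xi)$ almost surely. Here $F(x)=\mathbb E[f(x,\xi)]$, where each $f(\cdot,\xi):\mathbb R^d\to\mathbb R$ is convex and differentiable with $\mathbb E[\nabla f(x,\xi)]=\nabla F(x)$; $h:\mathbb R^d\to\mathbb R\cup\{+\infty\}$ is a proper, lower semicontinuous convex function (whose proximal operator $\mathrm{prox}_{\phi}(z)=\arg\min_x \phi(x)+\frac12\|x-z\|^2$ is used below); $A(\xi)$ is a random $m\times d$ matrix with $\|A\|_{2,\infty}:=\sup_\xi\|A(\xi)\|<+\infty$ (operator norm; $\|A\|_{2,\infty}>0$); $b(\xi)\subseteq\mathbb R^m$ is a random nonempty closed convex set. A function $F$ is $L$-smooth ($L>0$) if $\nabla F$ is $L$-Lipschitz for the Euclidean norm; $L(\nabla F)$ denotes the smoothness constant of $F$. Duality. $\mathcal Y$ is the Hilbert space of $\mathbb R^m$-valued random variables $y=(y(\xi))_\xi$ with $\|y\|:=\sqrt{\mathbb E[\|y(\xi)\|^2]}<+\infty$. With the support function $\operatorname{supp}_{K}(u)=\sup_{v\in K}\langle u,v\rangle$,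 the Lagrangian on $\mathbb R^d\times\mathcal Y$ is $\mathcal L(x,y)=P(x)+\int \big(\langle A(\xi)x,y(\xi)\rangle-\operatorname{supp}_{b(\xi)}(y(\xi))\big)\mu(d\xi)$. It is assumed that a saddle point $(x_\star,y_\star)\in\mathbb R^d\times\mathcal Y$ of $\min_{x\in\mathbb R^d}\max_{y\in\mathcal Y}\mathcal L(x,y)$ exists, and $(x_\star,y_\star)$ denotes such a saddle point. $\operatorname{dist}(x,K)=\inf_{z\in K}\|x-z\|$. Smoothing. For $\beta>0$, $g_\beta(z,\xi)=\frac1{2\beta}\operatorname{dist}(z,b(\xi))^2$, whose gradient in $z$ is $\nabla_z g_\beta(z,\xi)=\frac1\beta(z-\Pi_{b(\xi)}(z))$, with $\Pi$ the Euclidean projection. Algorithm SASC. Start from a deterministic $x_0^0\in\mathbb R^d$. For $s=0,1,2,\dots$: for $k=0,\dots,m_s-1$, draw $\xi=\xi_{k+1}^s$ (all draws i.i.d. with the law $\mu(d\xi)$), set $D(x_k^s,\xi)=\nabla f(x_k^s,\xi)+A(\xi)^\top\nabla_z g_{\beta_s}(A(\xi)x_k^s,\xi)$ and $x_{k+1}^s=\mathrm{prox}_{\alpha_s h}(x_k^s-\alpha_sD(x_k^s,\xi))$; then set $\bar x^s=\frac1{m_s}\sum_{k=1}^{m_s}x_k^s$ and restart from $x_0^{s+1}$ given by the restart rule in the claim. In $\mathbb E[\operatorname{dist}(A(\xi)\bar x^s,b(\xi))^2]$ the variable $\xi$ is an independent copy, and the expectation is over both $\xi$ and the draws of the algorithm.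 *)

(* Defs.v *)
From HB Require Import structures.
From mathcomp Require Import all_boot all_order all_algebra finmap.
From mathcomp Require Import all_classical all_reals all_analysis.

Set Implicit Arguments.
Unset Strict Implicit.
Unset Printing Implicit Defensive.

Import Order.TTheory GRing.Theory Num.Theory.
Import numFieldNormedType.Exports.

Local Open Scope classical_set_scope.
Local Open Scope ring_scope.

(* The norm that the library puts on matrices is the sup norm; [enorm] is the
   Euclidean one.  Both induce the same topology, so that [differentiable],
   [closed], [open] and [lower_semicontinuous] can be used as they are. *)
Section Euclidean.
Context {R : realType}.

Definition dot n (u v : 'cV[R]_n) : R := \sum_i u i 0 * v i 0.

Definition enorm n (u : 'cV[R]_n) : R := Num.sqrt (dot u u).

Definition opnorm n p (M : 'M[R]_(n, p)) : R :=
  sup [set enorm (M *m x) | x in [set x | enorm x <= 1]].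

Definition set_dist n (x : 'cV[R]_n) (K : set 'cV[R]_n) : R :=
  inf [set enorm (x - z) | z in K].

Definition grad n (f : 'cV[R]_n -> R) (x : 'cV[R]_n) : 'cV[R]_n :=
  \col_i 'd f x (delta_mx i 0).

Definition smooth n (L : R) (f : 'cV[R]_n -> R) : Prop :=
  (forall x, differentiable f x) /\
  (forall x y, enorm (grad f x - grad f y) <= L * enorm (x - y)).

Definition support_fun n (K : set 'cV[R]_n) (u : 'cV[R]_n) : \bar R :=
  ereal_sup [set (dot u v)%:E | v in K].

Definition proper_fun n (h : 'cV[R]_n -> \bar R) : Prop :=
  (forall x, h x != -oo%E) /\ (exists x, (h x < +oo)%E).

Definition econvex n (h : 'cV[R]_n -> \bar R) : Prop :=
  forall (t : R) (x y : 'cV[R]_n), 0 < t < 1 ->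
    (h (t *: x + (1 - t) *: y)%R <= t%:E * h x + (1 - t)%:E * h y)%E.

(* For phi proper, convex and lower semicontinuous the minimizer exists and is
   unique; [xget] selects it. *)
Definition prox n (phi : 'cV[R]_n -> \bar R) (z : 'cV[R]_n) : 'cV[R]_n :=
  xget 0 [set x | forall y,
    (phi x + (2^-1 * enorm (x - z) ^+ 2)%:E
     <= phi y + (2^-1 * enorm (y - z) ^+ 2)%:E)%E].

Definition smoothed_dist n (beta : R) (K : set 'cV[R]_n) (z : 'cV[R]_n) : R :=
  (2 * beta)^-1 * set_dist z K ^+ 2.

End Euclidean.

Section Probability.
Context {R : realType}.

Definition random_vector d (T : measurableType d) n (X : T -> 'cV[R]_n) : Prop :=
  forall i, measurable_fun setT (fun t => X t i 0).

Definition random_matrix d (T : measurableType d) n p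
    (X : T -> 'M[R]_(n, p)) : Prop :=
  forall i j, measurable_fun setT (fun t => X t i j).

(* Effros measurability, the usual meaning of "random closed set". *)
Definition random_closed_set d (T : measurableType d) n
    (K : T -> set 'cV[R]_n) : Prop :=
  (forall t, closed (K t)) /\
  (forall U, open U -> measurable [set t | K t `&` U !=set0]).

(* Independence of the subfamily of X indexed by D. *)
Definition independent_on d d' (T : measurableType d) (T' : measurableType d')
    (P : probability T R) (I : choiceType) (D : set I) (X : I -> T -> T') : Prop :=
  forall (J : {fset I}) (B : I -> set T'),
    [set` J] `<=` D -> (forall i, measurable (B i)) ->
    P (\bigcap_(i in [set` J]) X i @^-1` B i)
    = (\prod_(i <- J) P (X i @^-1` B i))%E.

(* Square-integrable random vectors and their norm. *)
Definition in_L2 d (T : measurableType d) (P : probability T R) n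
    (y : T -> 'cV[R]_n) : Prop :=
  random_vector y /\ (\int[P]_t (enorm (y t) ^+ 2)%:E < +oo)%E.

Definition L2norm d (T : measurableType d) (P : probability T R) n
    (y : T -> 'cV[R]_n) : R :=
  Num.sqrt (\int[P]_t (enorm (y t) ^+ 2)).

End Probability.

Section Problem.
Context {R : realType} {dX : measure_display} {Xi : measurableType dX}.
Context (law : probability Xi R) {d m : nat}.
Context (f : 'cV[R]_d -> Xi -> R) (h : 'cV[R]_d -> \bar R).
Context (A : Xi -> 'M[R]_(m, d)) (b : Xi -> set 'cV[R]_m).

Definition mean_fun (x : 'cV[R]_d) : R := \int[law]_xi f x xi.

Definition objective (x : 'cV[R]_d) : \bar R := ((mean_fun x)%:E + h x)%E.

Definition normA : R := sup (range (fun xi => opnorm (A xi))).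

(* The Lebesgue integral of a function whose positive and negative parts both
   have infinite integral is -oo here, and +oo + -oo = -oo. *)
Definition lagrangian (x : 'cV[R]_d) (y : Xi -> 'cV[R]_m) : \bar R :=
  (objective x +
   \int[law]_xi ((dot (A xi *m x) (y xi))%:E - support_fun (b xi) (y xi)))%E.

(* Finiteness of the value excludes the degenerate case of a y_star such that
   [lagrangian x y_star] is infinite for every x. *)
Definition saddle_point (xstar : 'cV[R]_d) (ystar : Xi -> 'cV[R]_m) : Prop :=
  [/\ in_L2 law ystar,
      lagrangian xstar ystar \is a fin_num,
      forall y, in_L2 law y ->
        (lagrangian xstar y <= lagrangian xstar ystar)%E
    & forall x, (lagrangian xstar ystar <= lagrangian x ystar)%E].

Definition direction (beta : R) (x : 'cV[R]_d) (xi : Xi) : 'cV[R]_d :=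
  grad (f ^~ xi) x
  + (A xi)^T *m grad (smoothed_dist beta (b xi)) (A xi *m x).

(* u k.+1 is the sample drawn at the k-th inner step. *)
Fixpoint inner_iterate (alpha beta : R) (u : nat -> Xi) (x0 : 'cV[R]_d)
    (k : nat) : 'cV[R]_d :=
  if k is k'.+1 then
    let x := inner_iterate alpha beta u x0 k' in
    prox (fun z => alpha%:E * h z)%E (x - alpha *: direction beta x (u k))
  else x0.

Definition epoch_average (alpha beta : R) (len : nat) (u : nat -> Xi)
    (x0 : 'cV[R]_d) : 'cV[R]_d :=
  len%:R^-1 *: \sum_(1 <= k < len.+1) inner_iterate alpha beta u x0 k.

(* First point of each epoch, for the restart from the previous average. *)
Fixpoint epoch_start (alpha beta : nat -> R) (len : nat -> nat)
    (u : nat -> nat -> Xi) (x00 : 'cV[R]_d) (s : nat) : 'cV[R]_d :=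
  if s is s'.+1 then
    epoch_average (alpha s') (beta s') (len s') (u s')
      (epoch_start alpha beta len u x00 s')
  else x00.

Definition sasc_average (alpha beta : nat -> R) (len : nat -> nat)
    (u : nat -> nat -> Xi) (x00 : 'cV[R]_d) (s : nat) : 'cV[R]_d :=
  epoch_average (alpha s) (beta s) (len s) (u s)
    (epoch_start alpha beta len u x00 s).

End Problem.

(* Main.v *)
(** The growth condition makes [P - P xstar], and a fortiori the gap
    [smoothed_gap] of the smoothed objective (which adds the mean penalty),
    nonnegative.  Hence the lower bound is immediate, and the feasibility bound
    follows from the fact that the expected squared distance is [2 * beta] times
    the mean penalty, which is at most [2 * beta] times the gap; it remains to
    bound the expected gap.

    For one step from a fixed [x], combine the variational inequality of the
    proximal operator at [xstar] with the smoothness of the objective and of the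
    penalty (their curvatures add up to at most [1 / alpha]).  The covariance of
    the direction with the new iterate is controlled by comparing with the step
    along the mean direction.  The penalty contributes its own variance, at most
    [mean_penalty x / (2 * alpha)], and this is absorbed because [xstar] is
    almost surely feasible: at a feasible point the squared distance to the
    convex set exceeds its tangent at [x] by at least its value at [x].  Summing
    over an epoch gives [gap <= e / (alpha * len) + 2 * alpha * sigma ^ 2],
    where [e] is half the mean squared distance of the starting point to
    [xstar], and growth turns this into a recursion on [e].

    The recursion loses a factor [x / floor x] at each epoch, with
    [x = m0 * omega ^ l].  The product of these factors is at most
    [m0 / (m0 - 1)] when [2 < omega]; it is unbounded as [omega] tends to [1],
    and for [omega <= 2] the loss is compensated by the geometric decay of the
    distance inside the epoch, which growth also provides. *)

Require Import Defs.
From HB Require Import structures.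
From mathcomp Require Import all_boot all_order all_algebra finmap.
From mathcomp Require Import all_classical all_reals all_analysis.
From mathcomp Require Import measurable_realfun.
From mathcomp Require Import ring lra.

Set Implicit Arguments.
Unset Strict Implicit.
Unset Printing Implicit Defensive.

Import Order.TTheory GRing.Theory Num.Theory.
Import numFieldNormedType.Exports.

Local Open Scope classical_set_scope.
Local Open Scope ring_scope.

(** * Euclidean geometry *)

(** The choice [beta = 4 * alpha * a ^ 2] balances one step. The penalty then has curvature
    [1 / (4 * alpha)], which fits beside [L <= 3 / (4 * alpha)]. Separating the two sources of noise
    costs a factor 2, so the variance of the penalty is charged at
    [2 * alpha * G x / (2 * alpha) = G x], with [G] the mean penalty. Convexity alone would bound
    [G x] plus its slope towards [xstar] by 0; feasibility improves this to [- G x], the two cancel,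
    and only [2 * alpha * sigma ^ 2] is left. The condition on [m0] makes
    [alpha_s * mu * m0 * omega ^ s] at least [omega], so growth divides the mean squared distance by
    [omega] in each epoch, up to rounding and noise. After rescaling by [omega ^ s], each epoch adds
    the same amount of noise: this is the source of the logarithm. Since [h] may be infinite,
    expectations are extended integrals of nonnegative functions, and conditioning on the past is
    Tonelli's theorem on the product of the past sigma-algebra with the law of one draw. *)

Ltac vector_ring := apply/matrixP => ? ?; rewrite !mxE; ring.

Section euclidean_space.
Context {R : realType}.

Lemma dotC n (u v : 'cV[R]_n) : dot u v = dot v u.
Proof. by apply: eq_bigr => i _; rewrite mulrC. Qed.

Lemma dotDl n (u v w : 'cV[R]_n) : dot (u + v) w = dot u w + dot v w.
Proof. by rewrite -big_split; apply: eq_bigr => i _; rewrite mxE mulrDl. Qed.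

Lemma dotNl n (u w : 'cV[R]_n) : dot (- u) w = - dot u w.
Proof. by rewrite -sumrN; apply: eq_bigr => i _; rewrite mxE mulNr. Qed.

Lemma dotZl n a (u w : 'cV[R]_n) : dot (a *: u) w = a * dot u w.
Proof. by rewrite mulr_sumr; apply: eq_bigr => i _; rewrite mxE mulrA. Qed.

Lemma dotDr n (u v w : 'cV[R]_n) : dot w (u + v) = dot w u + dot w v.
Proof. by rewrite dotC dotDl !(dotC w). Qed.

Lemma dotNr n (u w : 'cV[R]_n) : dot w (- u) = - dot w u.
Proof. by rewrite dotC dotNl dotC. Qed.

Lemma dotZr n a (u w : 'cV[R]_n) : dot w (a *: u) = a * dot w u.
Proof. by rewrite dotC dotZl dotC. Qed.

Lemma dot0l n (u : 'cV[R]_n) : dot 0 u = 0.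
Proof. by rewrite -(scale0r u) dotZl mul0r. Qed.

Lemma dot0r n (u : 'cV[R]_n) : dot u 0 = 0.
Proof. by rewrite dotC dot0l. Qed.

Lemma dot_sumr n (I : Type) (r : seq I) (P : pred I) (F : I -> 'cV[R]_n) w :
  dot w (\sum_(i <- r | P i) F i) = \sum_(i <- r | P i) dot w (F i).
Proof. by apply: big_morph; [move=> u v; rewrite dotDr|rewrite dot0r]. Qed.

Lemma dot_delta n (u : 'cV[R]_n) i : dot u (delta_mx i 0) = u i 0.
Proof.
rewrite /dot (bigD1 i)//= big1 ?addr0 => [|j ji]; rewrite mxE.
  by rewrite !eqxx mulr1.
by rewrite (negbTE ji) mulr0.
Qed.

Lemma dot_trmx n p (M : 'M[R]_(n, p)) u v : dot (M^T *m u) v = dot u (M *m v).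
Proof.
have dotE q (x y : 'cV[R]_q) : dot x y = (x^T *m y) 0 0.
  by rewrite mxE; apply: eq_bigr => i _; rewrite mxE.
by rewrite !dotE trmx_mul trmxK mulmxA.
Qed.

Definition dotE := (dotDl, dotDr, dotNl, dotNr, dotZl, dotZr).

Lemma dot_ge0 n (u : 'cV[R]_n) : 0 <= dot u u.
Proof. by apply: sumr_ge0 => i _; rewrite -expr2 sqr_ge0. Qed.

Lemma enorm_ge0 n (u : 'cV[R]_n) : 0 <= enorm u.
Proof. exact: sqrtr_ge0. Qed.

Lemma enorm_sq n (u : 'cV[R]_n) : enorm u ^+ 2 = dot u u.
Proof. by rewrite sqr_sqrtr// dot_ge0. Qed.

Lemma enorm_coord n (u : 'cV[R]_n) i : `|u i 0| <= enorm u.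
Proof.
rewrite -(@ler_pXn2r _ 2)// ?nnegrE ?enorm_ge0// enorm_sq.
rewrite /dot (bigD1 i)//= real_normK ?num_real// -expr2 lerDl.
by apply: sumr_ge0 => j _; rewrite -expr2 sqr_ge0.
Qed.

Lemma enorm_eq0 n (u : 'cV[R]_n) : enorm u = 0 -> u = 0.
Proof.
move=> u0; apply/matrixP => i j; rewrite (ord1 j) mxE.
by apply/eqP; rewrite -normr_le0 -u0 enorm_coord.
Qed.

Lemma enorm0 n : enorm (0 : 'cV[R]_n) = 0.
Proof. by rewrite /enorm dot0l sqrtr0. Qed.

Lemma enormZ n a (u : 'cV[R]_n) : enorm (a *: u) = `|a| * enorm u.
Proof. by rewrite /enorm !dotE mulrA -expr2 sqrtrM ?sqr_ge0// sqrtr_sqr. Qed.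

Lemma enormN n (u : 'cV[R]_n) : enorm (- u) = enorm u.
Proof. by rewrite /enorm !dotE opprK. Qed.

Lemma enormBC n (u v : 'cV[R]_n) : enorm (u - v) = enorm (v - u).
Proof. by rewrite -enormN opprB. Qed.

Lemma dot_le_enorm n (u v : 'cV[R]_n) : dot u v <= enorm u * enorm v.
Proof.
have [u0|u0] := eqVneq (enorm u) 0.
  by rewrite (enorm_eq0 u0) dot0l enorm0 mul0r.
have [v0|v0] := eqVneq (enorm v) 0.
  by rewrite (enorm_eq0 v0) dot0r enorm0 mulr0.
have up : 0 < enorm u by rewrite lt_def u0 enorm_ge0.
have vp : 0 < enorm v by rewrite lt_def v0 enorm_ge0.
have := dot_ge0 (enorm v *: u - enorm u *: v).
rewrite !dotE -!enorm_sq (dotC v u) => H.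
rewrite -(ler_pM2l (mulr_gt0 up vp)); nra.
Qed.

Lemma enormD n (u v : 'cV[R]_n) : enorm (u + v) <= enorm u + enorm v.
Proof.
rewrite -(@ler_pXn2r _ 2)// ?nnegrE ?addr_ge0 ?enorm_ge0//.
by rewrite enorm_sq !dotE -!enorm_sq (dotC v u); have := dot_le_enorm u v; nra.
Qed.

Lemma enorm_sqD_le n (u v : 'cV[R]_n) :
  enorm (u + v) ^+ 2 <= 2 * enorm u ^+ 2 + 2 * enorm v ^+ 2.
Proof.
by rewrite !enorm_sq; have := dot_ge0 (u - v); rewrite !dotE (dotC v u); lra.
Qed.

Lemma norm_le_enorm n (u : 'cV[R]_n) : `|u| <= enorm u.
Proof.
rewrite [leLHS]mx_normrE; apply/bigmax_leP; split; first exact: enorm_ge0.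
by case=> i j _ /=; rewrite (ord1 j) enorm_coord.
Qed.

Lemma coord_le_norm n (u : 'cV[R]_n) i : `|u i 0| <= `|u|.
Proof.
rewrite [leRHS]mx_normrE.
exact: (le_bigmax _ (fun ij : 'I_n * 'I_1 => `|u ij.1 ij.2|) (i, 0)).
Qed.

Lemma enorm_sq_le_norm n (u : 'cV[R]_n) : enorm u ^+ 2 <= n%:R * `|u| ^+ 2.
Proof.
rewrite enorm_sq mulr_natl.
have -> : `|u| ^+ 2 *+ n = \sum_(i < n) `|u| ^+ 2.
  by rewrite sumr_const card_ord.
apply: ler_sum => i _; rewrite -expr2 -real_normK ?num_real//.
by rewrite ler_pXn2r ?nnegrE// coord_le_norm.
Qed.

(** The constant [n.+1] avoids a square root and stays positive in dimension 0, so that it can be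
    divided by. *)
Lemma enorm_le_norm n (u : 'cV[R]_n) : enorm u <= n.+1%:R * `|u|.
Proof.
rewrite -(@ler_pXn2r _ 2)// ?nnegrE ?enorm_ge0 ?mulr_ge0//.
apply: (le_trans (enorm_sq_le_norm u)); rewrite exprMn ler_wpM2r ?sqr_ge0//.
by rewrite expr2 -natrM ler_nat (leq_trans (leqnSn n)) ?leq_pmulr.
Qed.

Lemma cvg_enorm n (u_ : nat -> 'cV[R]_n) (u : 'cV[R]_n) :
  (forall e, 0 < e -> \forall k \near \oo, enorm (u - u_ k) < e) ->
  u_ @ \oo --> u.
Proof.
move=> H; apply/cvgrPdist_lt => e /H; apply: filterS => k.
exact/le_lt_trans/norm_le_enorm.
Qed.

Lemma nbhs_enorm n (x : 'cV[R]_n) e :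
  0 < e -> nbhs x [set y | enorm (x - y) < e].
Proof.
move=> e0; have p : 0 < e / n.+1%:R by rewrite divr_gt0// ltr0n.
apply/(@nbhs_normP R 'cV[R]_n); exists (e / n.+1%:R) => //= y xy /=.
by apply: (le_lt_trans (enorm_le_norm _)); rewrite mulrC -ltr_pdivlMr ?ltr0n.
Qed.

Lemma nbhs_enormP n (x : 'cV[R]_n) (V : set 'cV[R]_n) :
  nbhs x V -> exists2 e, 0 < e & forall y, enorm (x - y) < e -> V y.
Proof.
move=> /(@nbhs_normP R 'cV[R]_n)[e /= e0 H].
exists e => // y xy; apply: H => /=.
exact: le_lt_trans (norm_le_enorm _) xy.
Qed.

Lemma continuous_enormP n (V : normedModType R) (f : 'cV[R]_n -> V) x :
  (forall e, 0 < e -> exists2 dl, 0 < dl &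
    forall y, enorm (x - y) < dl -> `|f x - f y| < e) ->
  {for x, continuous f}.
Proof.
move=> H; have FF : Filter (nbhs x) := nbhs_filter x.
apply/cvgrPdist_lt => e /H [dl dl0 Hdl].
exact: filterS (nbhs_enorm x dl0).
Qed.

End euclidean_space.

(** * Gradients, tangent inequalities and smoothness *)

Section gradient.
Context {R : realType} {n : nat}.
Implicit Types (f : 'cV[R]_n -> R) (x y v g : 'cV[R]_n).

Lemma colE x : x = \sum_i x i 0 *: delta_mx i 0.
Proof.
apply/matrixP => i j; rewrite (ord1 j) summxE (bigD1 i)//= big1 => [|k ki].
  by rewrite !mxE !eqxx mulr1 addr0.
by rewrite !mxE eq_sym (negbTE ki) mulr0.
Qed.

Lemma diff_grad f x v : differentiable f x -> 'd f x v = dot (grad f x) v.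
Proof.
move=> df; rewrite {1}(colE v) linear_sum; apply: eq_bigr => i _.
by rewrite linearZ mxE mulrC.
Qed.

(** A quadratic remainder is negligible at first order. The squared distance to a convex set and the
    mean penalty are enclosed between a tangent and a tangent plus a quadratic, so this gives their
    differentiability without differentiating a projection or an integral. *)
Lemma is_diff_quadratic f x g C :
  (forall y, `|f y - f x - dot g (y - x)| <= C * enorm (y - x) ^+ 2) ->
  differentiable f x /\ grad f x = g.
Proof.
move=> H.
have dl : linear (dot g : 'cV[R]_n -> R).
  by move=> a u v; rewrite !dotE.
pose dM := GRing.isLinear.Build _ _ _ _ _ dl.
pose dL : {linear _ -> _} := HB.pack (dot g : 'cV[R]_n -> R) dM.
have cd : continuous (dL : 'cV[R]_n -> R).
  move=> y; apply: continuous_enormP => e e0.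
  have p : 0 < enorm g + 1 by rewrite ltr_wpDl// enorm_ge0.
  exists (e / (enorm g + 1)); first by rewrite divr_gt0.
  move=> z; rewrite ltr_pdivlMr// => yz.
  rewrite -linearB /= /dot/= -/(dot g (y - z)).
  have := dot_le_enorm g (y - z); have := dot_le_enorm (- g) (y - z).
  rewrite enormN !dotE => h1 h2.
  apply: le_lt_trans yz; rewrite ler_norml; apply/andP; split;
    have := enorm_ge0 (y - z); nra.
have o : f \o shift x = cst (f x) + dL +o_ (0 : 'cV[R]_n) id.
  apply/eqaddoP => e e0; near=> v.
  have -> : (f \o shift x - (cst (f x) + dL)) v = f (v + x) - (f x + dot g v)
    by [].
  have := H (v + x); rewrite addrK opprD addrA => /le_trans; apply.
  have En := enorm_sq_le_norm v.
  have h1 : C * enorm v ^+ 2 <= `|C| * (n%:R * `|v| ^+ 2).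
    apply: (@le_trans _ _ (`|C| * enorm v ^+ 2)).
      by rewrite ler_wpM2r ?sqr_ge0// ler_norm.
    by rewrite ler_wpM2l.
  apply: (le_trans h1); rewrite mulrA expr2 mulrA ler_wpM2r//=.
  apply: (@le_trans _ _ ((`|C| * n%:R + 1) * `|v|)).
    by rewrite ler_wpM2r// lerDl.
  rewrite mulrC -ler_pdivlMr ?ltr_wpDl ?mulr_ge0//.
  near: v; apply/(@nbhs_normP R 'cV[R]_n).
  exists (e / (`|C| * n%:R + 1)) => /=.
    by rewrite divr_gt0// ltr_wpDl ?mulr_ge0.
  by move=> v /=; rewrite sub0r normrN => /ltW.
have dE := diff_unique cd o.
have df : differentiable f x by apply/diff_locallyP; rewrite dE.
split=> //; apply/matrixP => i j; rewrite (ord1 j) mxE.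
by rewrite dE /= dot_delta.
Unshelve. all: by end_near. Qed.

Lemma is_derive_line f x v t : differentiable f (x + t *: v) ->
  is_derive t 1 (fun s : R => f (x + s *: v)) (dot (grad f (x + t *: v)) v).
Proof.
move=> df.
have dl : is_diff t (fun s : R => x + s *: v) ( *:%R ^~ v).
  have := @is_diffD R R 'cV[R]_n (cst x) ( *:%R ^~ v) _ _ t (is_diff_cst x t)
    (is_diff_scalel t v).
  by rewrite add0r.
have dlt : differentiable (fun s : R => x + s *: v) t by exact: ex_diff.
have dc : differentiable (f \o (fun s : R => x + s *: v)) t.
  exact: differentiable_comp.
apply: DeriveDef; first exact/derivable1_diffP.
rewrite deriveE// -diff_grad//.
have -> := @diff_comp _ _ _ _ (fun s : R => x + s *: v) f t dlt df.
by rewrite /= diff_val scale1r.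
Qed.

Lemma diff_enorm_bound f x e : differentiable f x -> 0 < e ->
  exists2 dl, 0 < dl & forall y, enorm (x - y) < dl ->
    `|f y - f x - dot (grad f x) (y - x)| <= e * enorm (y - x).
Proof.
move=> df e0; have /diff_locallyP[_ /eqaddoP H] := df.
have /nbhs_enormP[dl dl0 Hdl] := H e e0.
exists dl => // y xy; have := Hdl (y - x).
have -> : enorm (0 - (y - x)) < dl by rewrite sub0r enormN enormBC.
move=> /(_ isT) /=.
rewrite -[X in `|X|]/(f (y - x + x) - (f x + 'd f x (y - x))) subrK.
rewrite diff_grad// opprD addrA => /le_trans; apply.
by rewrite ler_wpM2l ?(ltW e0)// norm_le_enorm.
Qed.

Lemma convex_grad_le f x y : differentiable f x ->
  (forall t, 0 < t < 1 -> f (x + t *: (y - x)) <= f x + t * (f y - f x)) ->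
  f x + dot (grad f x) (y - x) <= f y.
Proof.
move=> df H; rewrite -lerBrDl; set v := y - x.
have v0 : 0 < enorm v + 1 by rewrite ltr_wpDl// enorm_ge0.
apply/ler_addgt0Pr => e e0.
have [dl dl0 Hdl] := diff_enorm_bound df (divr_gt0 e0 v0).
(* Small enough for [x + t *: v] to be within [dl] of [x]; adding 1 to the norm covers [v = 0]. *)
pose t := Num.min (2^-1) (dl / 2 / (enorm v + 1)).
have t0 : 0 < t by rewrite lt_min invr_gt0 ltr0n/= divr_gt0// divr_gt0.
have t1 : t < 1 by rewrite gt_min; apply/orP; left; lra.
have tv : t * (enorm v + 1) <= dl / 2.
  by rewrite -ler_pdivlMr// ge_min lexx orbT.
have := H t; rewrite t0 t1 => /(_ isT) h.
have := Hdl (x + t *: v).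
rewrite opprD addrA subrr sub0r enormN [x + _]addrC addrK enormZ (gtr0_norm t0).
have -> : t * enorm v < dl by have := enorm_ge0 v; nra.
move=> /(_ isT); rewrite ler_norml => /andP[+ _]; rewrite dotE [t *: v +
  x]addrC => h2.
have h3 : e / (enorm v + 1) * (t * enorm v) <= t * e.
  rewrite mulrCA ler_wpM2l// ?(ltW t0)//.
  rewrite mulrAC ler_pdivrMr//; have := enorm_ge0 v; nra.
rewrite -(ler_pM2l t0); lra.
Qed.

Lemma cvg_diff_quotient f x i : differentiable f x ->
  (fun k => k.+1%:R * (f (x + k.+1%:R^-1 *: delta_mx i 0) - f x)) @ \oo -->
  grad f x i 0.
Proof.
move=> df; apply/cvgrPdist_le => e e0.
have [dl dl0 Hdl] := diff_enorm_bound df e0.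
near=> k; have k0 : 0 < k.+1%:R :> R by [].
have e1 : enorm (delta_mx i 0 : 'cV[R]_n) = 1.
  by rewrite /enorm dot_delta mxE !eqxx sqrtr1.
have := Hdl (x + k.+1%:R^-1 *: delta_mx i 0).
rewrite opprD addrA subrr sub0r enormN [x + _]addrC addrK enormZ e1 mulr1.
rewrite gtr0_norm ?invr_gt0//.
have -> : k.+1%:R^-1 < dl.
  near: k; exact: near_infty_natSinv_lt (PosNum dl0).
move=> /(_ isT); rewrite dotE dot_delta -(ler_pM2l k0) -{1}(gtr0_norm k0)
  -normrM.
rewrite mulrBr mulVKf ?gt_eqF// mulrCA divff ?gt_eqF// mulr1.
by rewrite distrC.
Unshelve. all: by end_near. Qed.

(** The mean value theorem is applied to [f] on the segment minus its quadratic model [q]: the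
    Lipschitz bound makes the derivative of the difference nonpositive, so that no gradient has to
    be integrated. *)
Lemma smooth_upper (L : R) f x y : smooth L f ->
  f y <= f x + dot (grad f x) (y - x) + L / 2 * enorm (y - x) ^+ 2.
Proof.
case=> df lip; pose v := y - x.
pose p (t : R) := f (x + t *: v).
pose q (t : R) := t * dot (grad f x) v + t ^+ 2 * (L / 2 * enorm v ^+ 2).
have dp (t : R) : is_derive t (1 : R) p (dot (grad f (x + t *: v)) v).
  exact: is_derive_line.
have dq (t : R) : is_derive t (1 : R) q (dot (grad f x) v + t * (L * enorm v ^+
  2)).
  rewrite /q; apply: is_derive_eq.
  rewrite /GRing.scale/=.

  lra.
have dpq (t : R) : is_derive t (1 : R) (p - q) (dot (grad f (x + t *: v)) v -
   (dot (grad f x) v + t * (L * enorm v ^+ 2))).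
  exact: is_deriveB.
have [|c] := @MVT R (p - q) _ 0 1 ltr01 (fun t _ => dpq t).
  apply: derivable_within_continuous => t _; exact: ex_derive.
rewrite in_itv/= => /andP[c0 c1]; rewrite subr0 mulr1 !fctE /p /q => E.
have h := lip (x + c *: v) x.
have xv : x + 1 *: v = y by rewrite scale1r [x + v]addrC subrK.
have xcv : x + c *: v - x = c *: v by vector_ring.
rewrite xcv enormZ (gtr0_norm c0) in h.
rewrite xv scale0r addr0 in E.
rewrite -/v; clear dp dq dpq lip xv xcv; clearbody p q v.
move: (grad f (x + c *: v)) (grad f x) E h => g1 g0 E h.
have := ler_wpM2r (enorm_ge0 v) h; have := dot_le_enorm (g1 - g0) v.
by rewrite dotDl dotNl; move: E; lra.
Qed.

End gradient.
(** * Proximal operator and projection *)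

Section proximal.
Context {R : realType} {n : nat}.
Implicit Types (phi psi : 'cV[R]_n -> \bar R) (x y z p : 'cV[R]_n).

(* Midpoint strong convexity makes every minimizing sequence Cauchy, so that
   completeness replaces compactness. *)
Lemma midpoint_convex_min phi (c : R) :
  lower_semicontinuous phi -> (forall x, (c%:E <= phi x)%E) ->
  (exists x, (phi x < +oo)%E) ->
  (forall x y a b, phi x = a%:E -> phi y = b%:E ->
    (phi (2^-1 *: (x + y)) <=
      (2^-1 * (a + b) - 8^-1 * enorm (x - y) ^+ 2)%:E)%E) ->
  exists p, forall y, (phi p <= phi y)%E.
Proof.
move=> lsc lb [x0 x0oo] mid.
have fin x : (phi x < +oo)%E -> exists2 a, phi x = a%:E & c <= a.
  by have := lb x; case: (phi x) => // a; rewrite lee_fin; exists a.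
pose S := [set a | exists x, phi x = a%:E].
have [a0 x0a ca0] := fin _ x0oo.
have lbS : lbound S c by move=> a [x xa]; rewrite -lee_fin -xa.
have infS : has_inf S by split; [exists a0, x0|exists c].
set i := inf S.
have ilb x a : phi x = a%:E -> i <= a.
  by move=> xa; apply: ge_inf; [exists c|exists x].
have /choice[u Hu] (k : nat) : exists x, exists2 a, phi x = a%:E & a < i +
  k.+1%:R^-1.
  have [|a [x xa] ai] := @inf_adherent _ S k.+1%:R^-1 _ infS.
    by rewrite invr_gt0.
  by exists x, a.
have dist j k (e : R) : j.+1%:R^-1 < e -> k.+1%:R^-1 < e ->
    enorm (u j - u k) ^+ 2 <= 8 * e.
  move=> je ke; have [a ua ai] := Hu j; have [b ub bi] := Hu k.
  have le := mid _ _ _ _ ua ub; have [|m mm cm] := fin (2^-1 *: (u j + u k)).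
    by rewrite (le_lt_trans le)// ltry.
  have ai' : a < i + e by rewrite (lt_trans ai)// ltrD2l.
  have bi' : b < i + e by rewrite (lt_trans bi)// ltrD2l.
  by move: le; rewrite mm lee_fin; have := ilb _ _ mm; lra.
have : cvg (u @ \oo).
  apply: cauchy_cvg; apply: cauchy_exP => e e0.
  have p : 0 < e ^+ 2 / 16 by rewrite divr_gt0 ?exprn_gt0.
  have [N _ HN] := near_infty_natSinv_lt (PosNum p).
  exists (u N); exists N => // k Nk /=.
  have := dist N k _ (HN N (leqnn _)) (HN k Nk) => /= d.
  rewrite -ball_normE /=; apply: le_lt_trans (norm_le_enorm _) _.
  rewrite -(@ltr_pXn2r _ 2)// ?nnegrE ?enorm_ge0 ?ltW//.
  by apply: le_lt_trans d _; have := exprn_gt0 2 e0; lra.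
move=> /cvg_ex[p up]; exists p => y.
have [q|] := ltP (phi y) +oo%E; last by apply: le_trans; rewrite leey.
have [b yb _] := fin _ q; rewrite yb.
apply: (@le_trans _ _ i%:E); last by rewrite lee_fin (ilb _ _ yb).
rewrite leNgt; apply/negP => ip.
have [a ia ap] : exists2 a, i < a & (a%:E < phi p)%E.
  move: ip; case: (phi p) => [r|_|]//.
    rewrite lte_fin => ir; exists ((i + r) / 2); rewrite ?lte_fin; lra.
  by exists (i + 1); rewrite ?ltry//; lra.
have [V Vp HV] := lsc p a ap.
have ai0 : 0 < a - i by rewrite subr_gt0.
have [N1 _ HN1] := up _ Vp.
have [N2 _ HN2] := near_infty_natSinv_lt (PosNum ai0).
have [a' ua' a'i] := Hu (N1 + N2)%N.
have := HV _ (HN1 (N1 + N2)%N (leq_addr _ _)); rewrite ua' lte_fin.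
move: a'i (HN2 (N1 + N2)%N (leq_addl _ _)) => /=.
by move: (_.+1%:R^-1) => w; lra.
Qed.

(** Boundedness below of the proximal objective, under which its minimum is attained. It is stated
    separately because for [h] it comes from the growth condition, while for an indicator it is
    immediate. *)
Definition prox_bounded psi := forall z, exists c : R, forall x,
  (c%:E <= psi x + (2^-1 * enorm (x - z) ^+ 2)%:E)%E.

Lemma lsc_addr psi (q : 'cV[R]_n -> R) : lower_semicontinuous psi ->
  continuous q -> lower_semicontinuous (fun x => psi x + (q x)%:E)%E.
Proof.
move=> lsc cq x a apq.
have [a' qa' a'p] : exists2 a', a - q x < a' & (a'%:E < psi x)%E.
  move: apq; case: (psi x) => [r|_|]//.
    rewrite -EFinD lte_fin => ir; exists ((a - q x + r) / 2);
      rewrite ?lte_fin; lra.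
  by exists (a - q x + 1); rewrite ?ltry//; lra.
have [V Vx HV] := lsc x a' a'p.
have p : 0 < a' - (a - q x) by rewrite subr_gt0.
have FF : Filter (nbhs x) := nbhs_filter x.
have W : nbhs x [set y | `|q x - q y| < a' - (a - q x)].
  by have /cvgrPdist_lt := cq x; apply.
exists (V `&` [set y | `|q x - q y| < a' - (a - q x)]).
  exact: filterI.
move=> y [/HV Vy]; rewrite /= ltr_norml => /andP[qy1 qy2].
move: Vy; case: (psi y) => [r|_|]//; last by rewrite addye// ltry.
by rewrite -EFinD !lte_fin; lra.
Qed.

Lemma continuous_sqdist z : continuous (fun x => 2^-1 * enorm (x - z) ^+ 2).
Proof.
move=> x; apply: continuous_enormP => e e0.
have x0 := enorm_ge0 (x - z).
exists (Num.min 1 (e / (enorm (x - z) + 1))).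
  by rewrite lt_min ltr01 divr_gt0// ltr_wpDl.
move=> y; rewrite lt_min => /andP[y1]; rewrite ltr_pdivlMr ?ltr_wpDl// => ye.
have -> : y - z = (x - z) - (x - y) by vector_ring.
move: (x - z) (x - y) x0 y1 ye => u w u0 w1 we.
have := dot_le_enorm u w; have := dot_le_enorm (- u) w.
rewrite !enorm_sq !dotE enormN (dotC w) -!enorm_sq => h1 h2.
have w0 := enorm_ge0 w.
by rewrite ltr_norml; apply/andP; split; nra.
Qed.

Lemma prox_exists psi z : proper_fun psi -> lower_semicontinuous psi ->
  econvex psi -> prox_bounded psi ->
  forall y, (psi (prox psi z) + (2^-1 * enorm (prox psi z - z) ^+ 2)%:E
     <= psi y + (2^-1 * enorm (y - z) ^+ 2)%:E)%E.
Proof.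
move=> [pN [x0 x0oo]] lsc cvx bd; rewrite /prox.
(* The second case, in which [xget] falls back on 0, assumes that no minimizer exists. *)
case: xgetP => [x _ //|noneP].
exfalso; have [c Hc] := bd z.
have [| | |x y a b xa yb|p Hp] := @midpoint_convex_min
    (fun x => psi x + (2^-1 * enorm (x - z) ^+ 2)%:E)%E c.
- exact: (lsc_addr lsc (@continuous_sqdist z)).
- exact: Hc.
- by exists x0; rewrite lte_add_pinfty// ltry.
- have xfin w r : (psi w + (2^-1 * enorm (w - z) ^+ 2)%:E)%E = r%:E ->
      psi w = (r - 2^-1 * enorm (w - z) ^+ 2)%:E.
    by case: (psi w) => [s||]// [] <-; rewrite addrK.
  have := cvx 2^-1 x y; rewrite (xfin _ _ xa) (xfin _ _ yb).
  have -> : 1 - 2^-1 = 2^-1 :> R by lra.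
  rewrite -scalerDr => /(_ ltac:(by apply/andP; split; lra)).
  rewrite -!EFinM -EFinD => /(leeD2r (2^-1 * enorm (2^-1 *: (x + y) - z) ^+
    2)%:E).
  move/le_trans; apply; rewrite -EFinD lee_fin.
  (* The parallelogram identity for [x - z] and [y - z] produces the term
     [8^-1 * enorm (x - y) ^+ 2]. *)
  have -> : 2^-1 *: (x + y) - z = 2^-1 *: ((x - z) + (y - z)).
    by apply/matrixP => ? ?; rewrite !mxE; field.
  have -> : x - y = (x - z) - (y - z) by vector_ring.
  by rewrite enormZ exprMn gtr0_norm ?invr_gt0// !enorm_sq !dotE; lra.
- exact: (noneP p).
Qed.

(** Minimality is tested at [t *: y + (1 - t) *: p]; convexity and division by [t] give the
    inequality up to [t / 2] times the squared norm of [y - p], and [t] is taken small. The witness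
    [a] records that [psi] is finite at its proximal point. *)
Lemma prox_var_ineq psi z : proper_fun psi -> lower_semicontinuous psi ->
  econvex psi -> prox_bounded psi -> exists2 a, psi (prox psi z) = a%:E &
  forall y b, psi y = b%:E -> a <= b + dot (y - prox psi z) (prox psi z - z).
Proof.
move=> pr lsc cvx bd; have H := prox_exists z pr lsc cvx bd.
move: (prox psi z) H => p H; have [pN [x0 x0oo]] := pr.
have [a pa] : exists a, psi p = a%:E.
  have := H x0; have := pN p; move: x0oo.
  case: (psi p) => [a||]//; first by exists a.
  by case: (psi x0).
exists a => // y b yb; apply/ler_addgt0Pr => e e0.
have d0 : 0 < enorm (y - p) ^+ 2 + 1 by rewrite ltr_wpDl// sqr_ge0.
pose t := Num.min 2^-1 (e / (enorm (y - p) ^+ 2 + 1)).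
have t0 : 0 < t by rewrite lt_min invr_gt0 ltr0n/= divr_gt0.
have t1 : t <= 2^-1 by rewrite ge_min lexx.
have te : t * (enorm (y - p) ^+ 2 + 1) <= e.
  by rewrite -ler_pdivlMr// ge_min lexx orbT.
have t1' : t < 1 by lra.
have := cvx t y p; rewrite t0 t1' yb pa => /(_ isT).
rewrite -!EFinM -EFinD; move=> h1; have := H (t *: y + (1 - t) *: p); rewrite
  pa.
move: h1; case: (psi _) => [r||]//; rewrite -!EFinD !lee_fin.
have -> : t *: y + (1 - t) *: p - z = (p - z) + t *: (y - p) by vector_ring.
rewrite !enorm_sq !dotE (dotC p y) (dotC z p) (dotC z y) in te d0 *.
nra.
Qed.


End proximal.

Section proximal_map.
Context {R : realType} {n : nat}.
Implicit Types (psi : 'cV[R]_n -> \bar R) (x y z p : 'cV[R]_n).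

(** Adding the two variational inequalities, each tested at the other proximal point, gives firm
    nonexpansiveness; Cauchy-Schwarz finishes. *)
Lemma prox_nonexpansive psi z z' : proper_fun psi ->
  lower_semicontinuous psi -> econvex psi -> prox_bounded psi ->
  enorm (prox psi z - prox psi z') <= enorm (z - z').
Proof.
move=> pr lsc cvx bd.
have [a pa Ha] := prox_var_ineq z pr lsc cvx bd.
have [b pb Hb] := prox_var_ineq z' pr lsc cvx bd.
have := Ha _ _ pb; have := Hb _ _ pa.
move: (prox psi z) (prox psi z') => {pa pb Ha Hb} p p' h1 h2.
have h : enorm (p - p') ^+ 2 <= dot (p - p') (z - z').
  rewrite enorm_sq; rewrite !dotE in h1 h2 *.
  by rewrite (dotC p' p) in h1 h2 *; lra.
have := dot_le_enorm (p - p') (z - z').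
have := enorm_ge0 (p - p'); have := enorm_ge0 (z - z').
move: (enorm (p - p')) (enorm (z - z')) h => u w h w0 u0 uw.
have [->//|u1] := eqVneq u 0.
have u2 : 0 < u by rewrite lt_def u1.
by rewrite -(ler_pM2l u2); nra.
Qed.

Lemma set_dist_le (K : set 'cV[R]_n) z v :
  K v -> set_dist z K <= enorm (z - v).
Proof.
move=> Kv; apply: ge_inf; last by exists v.
by exists 0 => _ [w _ <-]; exact: enorm_ge0.
Qed.

Lemma set_dist_lip (K : set 'cV[R]_n) z y : K !=set0 ->
  set_dist z K <= set_dist y K + enorm (z - y).
Proof.
move=> [v0 Kv0]; rewrite -lerBlDr; apply: lb_le_inf.
  by exists (enorm (y - v0)), v0.
move=> _ [v Kv <-]; rewrite lerBlDr; apply: (le_trans (set_dist_le z Kv)).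
have -> : z - v = (y - v) + (z - y) by vector_ring.
exact: enormD.
Qed.

Lemma set_dist_continuous (K : set 'cV[R]_n) : K !=set0 ->
  continuous (fun z => set_dist z K).
Proof.
move=> K0 x; apply: continuous_enormP => e e0; exists e => // y xy.
have h1 := set_dist_lip x y K0; have h2 := set_dist_lip y x K0.
by rewrite enormBC in h2; rewrite ltr_norml; apply/andP; split; lra.
Qed.

Definition indicator (K : set 'cV[R]_n) x : \bar R :=
  if `[< K x >] then 0%E else +oo%E.

(** Defined through [prox] so that existence and the variational inequality are inherited;
    [set_distE] links it to the infimum in [set_dist]. *)
Definition proj (K : set 'cV[R]_n) z := prox (indicator K) z.

Context (K : set 'cV[R]_n).
Hypotheses (clK : closed K) (cvxK : convex_set K) (K0 : K !=set0).

Lemma indicatorT x : K x -> indicator K x = 0%E.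
Proof. by move=> Kx; rewrite /indicator; case: asboolP. Qed.

Lemma indicator_fin x a : indicator K x = a%:E -> K x /\ a = 0.
Proof. by rewrite /indicator; case: asboolP => // Kx [<-]. Qed.

Let pr : proper_fun (indicator K).
Proof.
split=> [x|]; first by rewrite /indicator; case: asboolP.
by have [x Kx] := K0; exists x; rewrite indicatorT.
Qed.

Let lsc : lower_semicontinuous (indicator K).
Proof.
move=> x a; have [Kx|nKx] := pselect (K x).
  rewrite indicatorT// lte_fin => a0; exists setT => [|y _].
    exact: filterT.
  by rewrite /indicator; case: asboolP => // _; rewrite ltry.
move=> _; exists (~` K) => [|y nKy].
  by apply: open_nbhs_nbhs; split => //; exact: closed_openC.
by rewrite /indicator; case: asboolP => // _; rewrite ltry.
Qed.

Let cvx : econvex (indicator K).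
Proof.
move=> t x y /andP[t0 t1].
have [Kx|nKx] := pselect (K x); last first.
  rewrite [indicator K x]/indicator; case: asboolP => // _.
  rewrite gt0_muley// addye ?leey//.
  by rewrite /indicator; case: asboolP; rewrite ?mule0// gt0_muley// lte_fin
    subr_gt0.
have [Ky|nKy] := pselect (K y); last first.
  rewrite [indicator K y]/indicator; case: asboolP => // _.
  by rewrite gt0_muley ?lte_fin ?subr_gt0// addey ?leey// indicatorT// mule0.
rewrite (indicatorT Kx) (indicatorT Ky) !mule0 adde0.
have := @cvxK x y (Itv01 (ltW t0) (ltW t1)) (mem_set Kx) (mem_set Ky).
by move=> /set_mem /indicatorT ->.
Qed.

Let bd : prox_bounded (indicator K).
Proof.
move=> z; exists 0 => x; rewrite adde_ge0//.
  by rewrite /indicator; case: asboolP.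
by rewrite lee_fin mulr_ge0// sqr_ge0.
Qed.

Lemma proj_in z : K (proj K z).
Proof.
by have [a /indicator_fin[]] := prox_var_ineq z pr lsc cvx bd.
Qed.

Lemma proj_var_ineq z v : K v -> 0 <= dot (v - proj K z) (proj K z - z).
Proof.
move=> Kv; have [a /indicator_fin[_ ->]] := prox_var_ineq z pr lsc cvx bd.
by move=> /(_ v 0); rewrite add0r; apply; rewrite indicatorT.
Qed.

Lemma enorm_proj_le z v : K v -> enorm (z - proj K z) <= enorm (z - v).
Proof.
move=> Kv; rewrite -(@ler_pXn2r _ 2)// ?nnegrE ?enorm_ge0// !enorm_sq.
have := proj_var_ineq z Kv; move: (proj K z) => p.
have -> : z - v = (z - p) - (v - p) by vector_ring.
have -> : p - z = - (z - p) by vector_ring.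
by move: (z - p) (v - p) => u w; have := dot_ge0 w; rewrite !dotE (dotC w u);
  lra.
Qed.

Lemma set_distE z : set_dist z K = enorm (z - proj K z).
Proof.
apply/eqP; rewrite eq_le; apply/andP; split.
  apply: ge_inf; last by exists (proj K z) => //; exact: proj_in.
  by exists 0 => _ [v _ <-]; exact: enorm_ge0.
apply: lb_le_inf; first by have [v Kv] := K0; exists (enorm (z - v)), v.
by move=> _ [v Kv <-]; exact: enorm_proj_le.
Qed.

(** The projection of [z] is a competitor for the distance from [y]. *)
Lemma sqdist_upper z y : set_dist y K ^+ 2 <=
  set_dist z K ^+ 2 + 2 * dot (z - proj K z) (y - z) + enorm (y - z) ^+ 2.
Proof.
rewrite !set_distE; have := enorm_proj_le y (proj_in z).
rewrite -(@ler_pXn2r _ 2)// ?nnegrE ?enorm_ge0// => /le_trans; apply.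
have -> : y - proj K z = (z - proj K z) + (y - z) by vector_ring.
move: (z - proj K z) (y - z) => u w.
by rewrite !enorm_sq !dotE (dotC w u); lra.
Qed.

(** The variational inequality at the projection of [z] is tested at the projection of [y]; the
    square of the difference of the two residuals absorbs the cross term. *)
Lemma sqdist_lower z y : set_dist z K ^+ 2 + 2 * dot (z - proj K z) (y - z) <=
  set_dist y K ^+ 2.
Proof.
rewrite !set_distE; have := proj_var_ineq z (proj_in y).
move: (proj K z) (proj K y) => p q.
have -> : q - p = (y - z) + (z - p) - (y - q) by vector_ring.
have -> : p - z = - (z - p) by vector_ring.
move: (z - p) (y - z) (y - q) => u w r; have := dot_ge0 (r - u).
by rewrite !enorm_sq !dotE (dotC w u) (dotC r u); lra.
Qed.

(** Twice what [sqdist_lower] gives at a point of [K]; the additional half pays for the variance of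
    the penalty. *)
Lemma sqdist_in z v : K v ->
  dot (z - proj K z) (v - z) <= - set_dist z K ^+ 2.
Proof.
move=> Kv; rewrite set_distE; have := proj_var_ineq z Kv.
move: (proj K z) => p.
have -> : v - p = (v - z) + (z - p) by vector_ring.
have -> : p - z = - (z - p) by vector_ring.
by move: (v - z) (z - p) => u w; rewrite !enorm_sq !dotE (dotC w u); lra.
Qed.

Lemma set_dist_ge0 z : 0 <= set_dist z K.
Proof. by rewrite set_distE enorm_ge0. Qed.

Lemma set_dist_eq0 z : set_dist z K = 0 -> K z.
Proof.
rewrite set_distE => /enorm_eq0/eqP; rewrite subr_eq0 => /eqP ->.
exact: proj_in.
Qed.

Lemma grad_smoothed_dist (beta : R) z : 0 < beta ->
  differentiable (smoothed_dist beta K) z /\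
  grad (smoothed_dist beta K) z = beta^-1 *: (z - proj K z).
Proof.
move=> b0; apply: (@is_diff_quadratic _ _ _ _ _ (2 * beta)^-1) => y.
have := sqdist_upper z y; have := sqdist_lower z y.
rewrite /smoothed_dist dotZl.
have -> : beta^-1 = (2 * beta)^-1 * 2.
  by rewrite invfM mulrC mulrA mulfV ?mul1r// pnatr_eq0.
have : 0 < (2 * beta)^-1 by rewrite invr_gt0 mulr_gt0.
move: (2 * beta)^-1 (dot _ _) (set_dist z K) (set_dist y K) (enorm _).
move=> B u s t e B0 h1 h2.
by rewrite ler_norml; apply/andP; split; nra.
Qed.

End proximal_map.

(** * Operator norm and the penalty of a single sample *)

Section operator_norm.
Context {R : realType} {n p : nat}.
Implicit Types (M : 'M[R]_(n, p)).

Lemma enorm_mulmx M (x : 'cV[R]_p) : enorm (M *m x) <= opnorm M * enorm x.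
Proof.
(* The squared Frobenius norm bounds the set whose supremum is [opnorm M]; on an unbounded set [sup]
   would return its default value. *)
have [C C0 HC] : exists2 C, 0 <= C & forall y : 'cV[R]_p,
    enorm (M *m y) ^+ 2 <= C * enorm y ^+ 2.
  exists (\sum_i enorm (row i M)^T ^+ 2) => [|y].
    by apply: sumr_ge0 => i _; rewrite sqr_ge0.
  rewrite enorm_sq mulr_suml; apply: ler_sum => i _.
  have -> : (M *m y) i 0 = dot (row i M)^T y.
    by rewrite mxE; apply: eq_bigr => j _; rewrite !mxE.
  rewrite -expr2 -exprMn -real_normK ?num_real//.
  rewrite ler_pXn2r ?nnegrE ?mulr_ge0 ?enorm_ge0//.
  rewrite ler_norml dot_le_enorm andbT lerNl -dotNl.
  by rewrite (le_trans (dot_le_enorm _ _))// enormN.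
have [x0|x0] := eqVneq (enorm x) 0.
  by rewrite (enorm_eq0 x0) mulmx0 !enorm0 mulr0.
have xp : 0 < enorm x by rewrite lt_def x0 enorm_ge0.
rewrite -ler_pdivrMr//.
have -> : enorm (M *m x) / enorm x = enorm (M *m ((enorm x)^-1 *: x)).
  by rewrite -scalemxAr enormZ gtr0_norm ?invr_gt0// mulrC.
apply: ub_le_sup; last first.
  exists ((enorm x)^-1 *: x) => //=.
  by rewrite enormZ gtr0_norm ?invr_gt0// mulVf.
exists (1 + C) => _ [y /= y1 <-].
have := HC y; have := enorm_ge0 y; have := enorm_ge0 (M *m y).
move: (enorm y) (enorm (M *m y)) y1 => s t s1 t0 s0 h.
have s2 : s ^+ 2 <= 1 by rewrite expr_le1.
by nra.
Qed.

Lemma enorm_trmx M a (y : 'cV[R]_n) : 0 <= a ->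
  (forall x : 'cV[R]_p, enorm (M *m x) <= a * enorm x) ->
  enorm (M^T *m y) <= a * enorm y.
Proof.
move=> a0 H; have := dot_le_enorm y (M *m (M^T *m y)); have := H (M^T *m y).
rewrite -dot_trmx -enorm_sq.
have := enorm_ge0 (M^T *m y); have := enorm_ge0 y.
move: (enorm (M^T *m y)) (enorm y) (enorm (M *m _)) => u v w v0 u0 h1 h2.
have [->|u1] := eqVneq u 0; first by rewrite mulr_ge0.
have u2 : 0 < u by rewrite lt_def u1.
by rewrite -(ler_pM2l u2); nra.
Qed.

End operator_norm.

Section penalty.
Context {R : realType} {n p : nat}.
Context (M : 'M[R]_(n, p)) (K : set 'cV[R]_n) (a al : R).
Hypotheses (clK : closed K) (cvxK : convex_set K) (K0 : K !=set0).
Hypotheses (a0 : 0 < a) (al0 : 0 < al).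
Hypothesis Ma : forall x : 'cV[R]_p, enorm (M *m x) <= a * enorm x.

Let beta := 4 * al * a ^+ 2.
Let G x := smoothed_dist beta K (M *m x).
Let dG x := M^T *m grad (smoothed_dist beta K) (M *m x).

Let beta0 : 0 < beta. Proof. by rewrite !mulr_gt0// exprn_gt0. Qed.

Let B := (2 * beta)^-1.
Let B0 : 0 < B. Proof. by rewrite invr_gt0 mulr_gt0. Qed.
Let BE : beta^-1 = 2 * B.
Proof. by rewrite /B; field; rewrite gt_eqF. Qed.
(** The quantitative content of the choice of [beta]: the curvature [a ^ 2 / beta] of the penalty is
    [1 / (4 * al)]. *)
Let aB : a ^+ 2 * B = (8 * al)^-1.
Proof. by rewrite /B /beta; field; rewrite !gt_eqF. Qed.

Let GE x : G x = B * set_dist (M *m x) K ^+ 2. Proof. by []. Qed.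
Let dotdG x v : dot (dG x) v = 2 * B * dot (M *m x - proj K (M *m x)) (M *m v).
Proof.
rewrite /dG dot_trmx.
by have [_ ->] := grad_smoothed_dist clK cvxK K0 (M *m x) beta0; rewrite dotZl
  BE.
Qed.

Lemma penalty_ge0 x : 0 <= smoothed_dist beta K (M *m x).
Proof. by rewrite -/(G x) GE mulr_ge0 ?sqr_ge0// ltW. Qed.

Lemma penalty_upper x y : smoothed_dist beta K (M *m y) <=
  smoothed_dist beta K (M *m x)
  + dot (M^T *m grad (smoothed_dist beta K) (M *m x)) (y - x)
  + (8 * al)^-1 * enorm (y - x) ^+ 2.
Proof.
rewrite -/(G y) -/(G x) -/(dG x) dotdG !GE -aB mulmxBr.
have := sqdist_upper clK cvxK K0 (M *m x) (M *m y).
have := Ma (y - x); rewrite mulmxBr -(@ler_pXn2r _ 2)// ?nnegrE ?mulr_ge0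
  ?enorm_ge0 ?(ltW a0)//.
rewrite exprMn.
move: (dot _ _) (set_dist _ _ ^+ 2) (set_dist _ _ ^+ 2) (enorm _ ^+ 2) (enorm _
  ^+ 2).
move: (a ^+ 2) => a2 u s t e e' h1 /(ler_wpM2l (ltW B0)) h2.
have := ler_wpM2l (ltW B0) h1; lra.
Qed.

Lemma penalty_lower x y : smoothed_dist beta K (M *m x)
  + dot (M^T *m grad (smoothed_dist beta K) (M *m x)) (y - x)
  <= smoothed_dist beta K (M *m y).
Proof.
rewrite -/(G y) -/(G x) -/(dG x) dotdG !GE mulmxBr.
have := ler_wpM2l (ltW B0) (sqdist_lower clK cvxK K0 (M *m x) (M *m y)).
by move: (dot _ _) (set_dist _ _ ^+ 2) (set_dist _ _ ^+ 2) => u s t; lra.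
Qed.

Lemma penalty_feasible x v : K (M *m v) ->
  dot (M^T *m grad (smoothed_dist beta K) (M *m x)) (v - x)
  <= - (2 * smoothed_dist beta K (M *m x)).
Proof.
move=> Kv; rewrite -/(G x) -/(dG x) dotdG !GE mulmxBr.
have := ler_wpM2l (ltW B0) (sqdist_in clK cvxK K0 (M *m x) Kv).
by move: (dot _ _) (set_dist _ _ ^+ 2) => u s; lra.
Qed.

(** Self-bounding property of a nonnegative function of curvature [1 / (4 * al)]: its squared
    gradient is at most twice the curvature times its value. Hence the noise of the penalty fades
    where the penalty is small. *)
Lemma penalty_grad_sq x :
  enorm (M^T *m grad (smoothed_dist beta K) (M *m x)) ^+ 2
  <= (2 * al)^-1 * smoothed_dist beta K (M *m x).
Proof.
rewrite -/(G x) GE.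
have [_ ->] := grad_smoothed_dist clK cvxK K0 (M *m x) beta0.
rewrite set_distE// -scalemxAr enormZ exprMn gtr0_norm ?invr_gt0// BE.
have -> : (2 * al)^-1 = a ^+ 2 * B * 4 by rewrite aB; field; rewrite gt_eqF.
have := enorm_trmx (M *m x - proj K (M *m x)) (ltW a0) Ma.
rewrite -(@ler_pXn2r _ 2)// ?nnegrE ?mulr_ge0 ?enorm_ge0 ?(ltW a0)// exprMn.
move/(ler_wpM2l (sqr_ge0 (2 * B))) => /le_trans; apply.
by rewrite le_eqVlt; apply/orP; left; apply/eqP; ring.
Qed.

(** The bound does not depend on the sample once [v] is fixed, which makes the penalty
    integrable. *)
Lemma penalty_le_feasible x v : K (M *m v) ->
  smoothed_dist beta K (M *m x) <= (8 * al)^-1 * enorm (x - v) ^+ 2.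
Proof.
move=> Kv; rewrite -/(G x) GE -aB [a ^+ 2 * B]mulrC -mulrA.
rewrite ler_wpM2l ?(ltW B0)// -exprMn ler_pXn2r ?nnegrE ?mulr_ge0 ?enorm_ge0
  ?(ltW a0)//.
  by apply: le_trans (Ma (x - v)); rewrite mulmxBr set_distE// enorm_proj_le.
by rewrite set_dist_ge0.
Qed.

End penalty.

(** * Measurability *)

Section random_vectors.
Context {R : realType} {dT : measure_display} {T : measurableType dT}.
Context {dU : measure_display} {U : measurableType dU} {n : nat}.
Implicit Types (X Y : T -> 'cV[R]_n).

(* [X] is rounded to the grid of mesh [1 / (k + 1)], which is countable. *)
Lemma measurable_caratheodory (g : 'cV[R]_n -> U -> R) X (u : T -> U) :
  (forall y, continuous (g ^~ y)) ->
  (forall x, measurable_fun setT (g x)) ->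
  random_vector X -> measurable_fun setT u ->
  measurable_fun setT (fun t => g (X t) (u t)).
Proof.
move=> cg mg mX mu.
pose fl (k : nat) (x : 'cV[R]_n) : 'cV[int]_n :=
  \col_i Num.floor (k.+1%:R * x i 0).
pose q k (c : 'cV[int]_n) : 'cV[R]_n := k.+1%:R^-1 *: map_mx intr c.
have flE k (x : 'cV[R]_n) (c : 'cV[int]_n) : (forall i,
    (k.+1%:R^-1 * (c i 0)%:~R <= x i 0 < k.+1%:R^-1 * (c i 0 + 1)%:~R)) <->
    c = fl k x.
  have k0 : 0 < k.+1%:R :> R by [].
  split=> [H|-> i]; last first.
    rewrite mxE ler_pdivrMl// ltr_pdivlMl//.
    by rewrite real_floor_le ?num_real// real_floorD1_gt ?num_real.
  apply/matrixP => i j; rewrite (ord1 j) mxE; apply/esym/floor_def.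
  by have := H i; rewrite ler_pdivrMl// ltr_pdivlMl.
apply: (@measurable_fun_cvg _ _ _ setT
  (fun k t => g (q k (fl k (X t))) (u t)) (fun t => g (X t) (u t))).
  move=> k _ B mB; rewrite setTI.
  (* On the grid cell of index [c] the rounded function is [g (q k c)] evaluated at the sample, and
     there are countably many cells. *)
  rewrite (_ : _ @^-1` B = \bigcup_(c in [set: 'cV[int]_n])
      ((\bigcap_(i in [set: 'I_n]) ((fun t => X t i 0) @^-1`
         [set` Interval (BLeft (k.+1%:R^-1 * (c i 0)%:~R))
                        (BLeft (k.+1%:R^-1 * (c i 0 + 1)%:~R))])) `&`
       (u @^-1` (g (q k c) @^-1` B)))); last first.
    apply/seteqP; split=> t /=.
      move=> Bt; exists (fl k (X t)) => //; split=> // i _ /=.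
      by rewrite in_itv/=; exact: (flE _ _ _).2.
    move=> [c _ [Hc Bt]]; rewrite -(_ : c = fl k (X t))//.
    by apply/flE => i; have := Hc i I; rewrite /= in_itv.
  apply: countable_bigcupT_measurable => // c; apply: measurableI.
    apply: fin_bigcap_measurable => [|i _]; first exact: finite_finset.
    by rewrite -[X in measurable X]setTI; exact: mX.
  rewrite -[X in measurable X]setTI; apply: mu => //.
  by rewrite -[X in measurable X]setTI; exact: mg.
move=> t _; apply: (@cvg_comp _ _ _ (fun k => q k (fl k (X t))) (g ^~ (u t))
  _ (nbhs (X t))); last exact: cg.
apply: cvg_enorm => e e0; have p : 0 < e / n.+1%:R by rewrite divr_gt0.
near=> k; apply: (le_lt_trans (enorm_le_norm _)).
rewrite mulrC -ltr_pdivlMr//; apply: (@le_lt_trans _ _ k.+1%:R^-1).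
  rewrite [leLHS]mx_normrE; apply/bigmax_leP; split=> [|[i j] _ /=].
    by rewrite invr_ge0.
  rewrite (ord1 j) !mxE -/(fl _ _).
  have := (flE k (X t) _).2 erefl i; rewrite mxE intrD mulrDr mulr1 => /andP[h1
    h2].
  by rewrite ger0_norm ?subr_ge0// lerBlDl ltW.
by near: k; exact: near_infty_natSinv_lt (PosNum p).
Unshelve. all: by end_near. Qed.

End random_vectors.

Section random_vector_theory.
Context {R : realType} {dT : measure_display} {T : measurableType dT}.

Lemma random_vectorD n (X Y : T -> 'cV[R]_n) : random_vector X ->
  random_vector Y -> random_vector (fun t => X t + Y t).
Proof.
move=> mX mY i; apply: eq_measurable_fun (measurable_funD (mX i) (mY i)).
by move=> t _; rewrite mxE.
Qed.

Lemma random_vectorZ n (a : T -> R) (X : T -> 'cV[R]_n) :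
  measurable_fun setT a -> random_vector X ->
  random_vector (fun t => a t *: X t).
Proof.
move=> ma mX i; apply: eq_measurable_fun (measurable_funM ma (mX i)).
by move=> t _; rewrite mxE.
Qed.

Lemma random_vector_cst n (x : 'cV[R]_n) : random_vector (fun _ : T => x).
Proof. by move=> i; exact: measurable_cst. Qed.

Lemma random_vectorB n (X Y : T -> 'cV[R]_n) : random_vector X ->
  random_vector Y -> random_vector (fun t => X t - Y t).
Proof.
move=> mX mY; have := random_vectorD mX (random_vectorZ (a := fun=> -1)
  (measurable_cst _) mY).
by congr random_vector; apply/funext => t; rewrite scaleN1r.
Qed.

Lemma random_vector_sum n (I : Type) (s : seq I) (X : I -> T -> 'cV[R]_n) :
  (forall i, random_vector (X i)) ->
  random_vector (fun t => \sum_(i <- s) X i t).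
Proof.
move=> mX i; apply: eq_measurable_fun (@measurable_sum _ _ _ setT _ s (fun k t
  => X k t i 0) (fun k => mX k i)).
by move=> t _; rewrite summxE.
Qed.

Lemma random_vector_mulmx n p (M : T -> 'M[R]_(n, p)) (X : T -> 'cV[R]_p) :
  random_matrix M -> random_vector X -> random_vector (fun t => M t *m X t).
Proof.
move=> mM mX i; apply: eq_measurable_fun (@measurable_sum _ _ _ setT _ _
  (fun j t => M t i j * X t j 0) (fun j => measurable_funM (mM i j) (mX j))).
by move=> t _; rewrite mxE.
Qed.

Lemma random_matrix_tr n p (M : T -> 'M[R]_(n, p)) :
  random_matrix M -> random_matrix (fun t => (M t)^T).
Proof.
move=> mM i j; apply: eq_measurable_fun (mM j i) => t _.
by rewrite mxE.
Qed.

Lemma random_matrix_comp dU (U : measurableType dU) n p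
    (M : T -> 'M[R]_(n, p)) (u : U -> T) : measurable_fun setT u ->
  random_matrix M -> random_matrix (fun t => M (u t)).
Proof. by move=> mu mM i j; exact: (measurableT_comp (mM i j) mu). Qed.

Lemma random_vector_comp dU (U : measurableType dU) n
    (X : T -> 'cV[R]_n) (u : U -> T) : measurable_fun setT u ->
  random_vector X -> random_vector (fun t => X (u t)).
Proof. by move=> mu mX i; exact: (measurableT_comp (mX i) mu). Qed.

Lemma measurable_dot n (X Y : T -> 'cV[R]_n) : random_vector X ->
  random_vector Y -> measurable_fun setT (fun t => dot (X t) (Y t)).
Proof.
move=> mX mY; exact: (@measurable_sum _ _ _ setT _ _
  (fun i t => X t i 0 * Y t i 0) (fun i => measurable_funM (mX i) (mY i))).
Qed.

Lemma measurable_enorm_sq n (X : T -> 'cV[R]_n) : random_vector X ->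
  measurable_fun setT (fun t => enorm (X t) ^+ 2).
Proof.
move=> mX; apply: eq_measurable_fun (measurable_dot mX mX) => t _.
by rewrite enorm_sq.
Qed.

Lemma measurable_continuous_comp n (g : 'cV[R]_n -> R) (X : T -> 'cV[R]_n) :
  continuous g -> random_vector X -> measurable_fun setT (fun t => g (X t)).
Proof.
move=> cg mX; apply: (@measurable_caratheodory _ _ _ _ T _ (fun x _ => g x) X
  id) => //.
Qed.

Lemma measurable_lsc_comp n (h : 'cV[R]_n -> \bar R) (X : T -> 'cV[R]_n) :
  lower_semicontinuous h -> random_vector X ->
  measurable_fun setT (fun t => h (X t)).
Proof.
move=> lsc mX.
have opm (V : set 'cV[R]_n) : open V -> measurable (X @^-1` V).
  (* [V] is the set of points at positive distance from its complement. An empty complement is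
     treated apart, since the distance to the empty set is 0 by default. *)
  move=> oV; have [V0|] := pselect (~` V !=set0); last first.
    move=> /set0P/negP; rewrite negbK => /eqP V0.
    suff -> : X @^-1` V = setT by exact: measurableT.
    by rewrite -(setCK V) V0 setC0 preimage_setT.
  have cl : closed (~` V) by exact: open_closedC.
  have -> : X @^-1` V = (fun t => set_dist (X t) (~` V)) @^-1` `]0, +oo[.
    apply/seteqP; split=> t /=; rewrite in_itv/= andbT.
      move=> Vt; have [e e0 He] := nbhs_enormP (open_nbhs_nbhs (conj oV Vt)).
      apply: (lt_le_trans e0); apply: lb_le_inf.
        by have [v v0] := V0; exists (enorm (X t - v)), v.
      by move=> _ [v nVv <-]; rewrite leNgt; apply/negP => /He.
    apply: contraPP => nVt; apply/negP; rewrite -leNgt.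
    by apply: (le_trans (set_dist_le (X t) nVt)); rewrite subrr enorm0.
  rewrite -[X in measurable X]setTI.
  exact: (measurable_continuous_comp (set_dist_continuous V0) mX).
apply: (measurability _ (ErealGenOInfty.measurableE R)).
move=> /= _ [_ [a ->]] <-; apply: measurableI => //.
rewrite preimage_itvoy; apply: (opm [set x | (a%:E < h x)%E]).
by move/lower_semicontinuousP : lsc; exact.
Qed.

End random_vector_theory.

Section random_gradient.
Context {R : realType} {dT : measure_display} {T : measurableType dT}.
Context {dU : measure_display} {U : measurableType dU}.

(** Each partial derivative is a limit of difference quotients with increments [1 / (k + 1)], and
    these are measurable by [measurable_caratheodory]. *)
Lemma random_vector_grad n (g : 'cV[R]_n -> U -> R) (X : T -> 'cV[R]_n)
    (u : T -> U) :
  (forall y x, differentiable (g ^~ y) x) ->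
  (forall x, measurable_fun setT (g x)) ->
  random_vector X -> measurable_fun setT u ->
  random_vector (fun t => grad (g ^~ (u t)) (X t)).
Proof.
move=> dg mg mX mu i.
have cg y : continuous (g ^~ y) by move=> x; exact: differentiable_continuous.
apply: (@measurable_fun_cvg _ _ _ setT (fun k t => k.+1%:R *
  (g (X t + k.+1%:R^-1 *: delta_mx i 0) (u t) - g (X t) (u t)))
  (fun t => grad (g ^~ (u t)) (X t) i 0)); last first.
  by move=> t _; exact: (@cvg_diff_quotient _ _ (g ^~ (u t))).
move=> k; apply: measurable_funM; first exact: measurable_cst.
apply: measurable_funB; apply: measurable_caratheodory => //.
by apply: random_vectorD => //; exact: random_vector_cst.
Qed.

(** The distance is continuous in the point. For a fixed point, being closer than [r] means that
    [K y] meets an open ball, an event that Effros measurability makes measurable. *)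
Lemma measurable_set_dist n (K : U -> set 'cV[R]_n) (X : T -> 'cV[R]_n)
    (u : T -> U) :
  random_closed_set K -> (forall y, convex_set (K y)) ->
  (forall y, K y !=set0) ->
  random_vector X -> measurable_fun setT u ->
  measurable_fun setT (fun t => set_dist (X t) (K (u t))).
Proof.
move=> [clK mK] cvK K0 mX mu.
apply: (measurable_caratheodory (g := fun x y => set_dist x (K y))) => //.
  by move=> y; exact: set_dist_continuous.
move=> x; apply: (measurability _ (RGenInftyO.measurableE R)) => //.
move=> _ [_ [r ->] <-]; rewrite setTI.
rewrite (_ : _ @^-1` _ = [set y | K y `&` [set z | enorm (x - z) < r] !=set0]).
  apply: mK; rewrite openE => z /= zr; rewrite /interior.
  have r0 : 0 < r - enorm (x - z) by rewrite subr_gt0.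
  apply: filterS (nbhs_enorm z r0) => w /= zw.
  have -> : x - w = (x - z) + (z - w) by vector_ring.
  by apply: (le_lt_trans (enormD _ _)); lra.
apply/seteqP; split=> y /=; rewrite in_itv/=.
  rewrite set_distE// => h; exists (proj (K y) x); split=> //.
  exact: proj_in.
move=> [z [Kz /= xz]]; rewrite set_distE//.
exact: le_lt_trans (enorm_proj_le _ _ _ _ Kz) xz.
Qed.

End random_gradient.

(** * Independence and expectation *)

Section independent_draw.
Context {R : realType} {dO dX : measure_display}.
Context {Omega : measurableType dO} {Xi : measurableType dX}.
Context (Pr : probability Omega R) (law : probability Xi R).
Context {I : choiceType} (D : set I) (draw : I -> Omega -> Xi).
Hypothesis mdraw : forall i, measurable_fun setT (draw i).
Hypothesis indep : independent_on Pr D draw.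

(* A pi-system that generates the sigma-algebra of the draws indexed by [E]. *)
Definition past (E : set I) : set (set Omega) :=
  [set A | exists (J : {fset I}) (B : I -> set Xi),
     [/\ [set` J] `<=` E, forall i, measurable (B i)
       & A = \bigcap_(i in [set` J]) draw i @^-1` B i]].

Lemma measurable_draw_past E i : E i ->
  measurable_fun [set: g_sigma_algebraType (past E)]
    (draw i : g_sigma_algebraType (past E) -> Xi).
Proof.
move=> Ei _ B mB; rewrite setTI; apply: sub_sigma_algebra.
exists [fset i]%fset, (fun=> B); split => //.
  by move=> k /=; rewrite inE => /eqP ->.
by rewrite set_fset1 bigcap_set1.
Qed.

Lemma past_measurable E : past E `<=` measurable.
Proof.
move=> A [J [B [_ mB ->]]]; apply: fin_bigcap_measurable.
  exact: finite_fset.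
by move=> i _; rewrite -[X in measurable X]setTI; exact: mdraw.
Qed.

Lemma past_setI E : setI_closed (past E).
Proof.
move=> A A' [J [B [JE mB ->]]] [J' [B' [J'E mB' ->]]].
exists (J `|` J')%fset, (fun i => (if i \in J then B i else setT) `&`
  (if i \in J' then B' i else setT)); split.
- by move=> i /=; rewrite inE => /orP[/JE|/J'E].
- by move=> i; apply: measurableI; case: ifP.
apply/seteqP; split=> w /=.
  by move=> [H H'] i _; split; case: ifPn => //; [exact: H|exact: H'].
move=> H; split=> i /= iJ; have := H i; rewrite /= inE iJ ?orbT => /(_ isT)[];
  by rewrite ?iJ.
Qed.

(** Uniqueness of measures: as functions of [A], both sides are finite measures on the sigma-algebra
    of the past, namely the restriction of [Pr] to the event of the fresh draw and a multiple of
    [Pr], and they agree on the generating pi-system. *)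
Lemma past_independent (E : set I) (j : I) (A : set Omega) (B : set Xi) :
  E `<=` D -> D j -> ~ E j -> <<s past E >> A -> measurable B ->
  Pr (A `&` draw j @^-1` B) = (Pr A * Pr (draw j @^-1` B))%E.
Proof.
move=> ED Dj nEj sA mB.
have mjB : measurable (draw j @^-1` B).
  by rewrite -[X in measurable X]setTI; exact: mdraw.
have c0 : 0 <= fine (Pr (draw j @^-1` B)) by rewrite fine_ge0.
have fc : Pr (draw j @^-1` B) \is a fin_num by exact: fin_num_measure.
rewrite -(fineK fc) muleC.
rewrite -[RHS]/(mscale (NngNum c0) Pr A) -[LHS]/(mrestr Pr mjB A).
apply: (g_sigma_algebra_measure_unique (past E) _ (fun=> setT)) => //.
- exact: past_measurable.
- move=> _; exists fset0, (fun=> setT); split => //.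
  by rewrite set_fset0 bigcap_set0.
- by rewrite bigcup_const//; exists 0%N.
- exact: past_setI.
- move=> _ [J [C [JE mC ->]]].
  have jJ : j \notin J by apply/negP => /JE.
  pose S := \bigcap_(i in [set` J]) draw i @^-1` C i.
  rewrite -[LHS]/(Pr (S `&` draw j @^-1` B)).
  rewrite -[RHS]/((fine (Pr (draw j @^-1` B)))%:E * Pr S)%E fineK// muleC.
  (* The event of the fresh draw is one more factor: independence is applied to [J] and to [J] with
     [j] adjoined. *)
  pose C' i := if i == j then B else C i.
  have /indep H : [set` (j |` J)%fset] `<=` D.
    by move=> i /=; rewrite !inE => /orP[/eqP ->//|/JE/ED].
  have /indep H' : [set` J] `<=` D by move=> i /= /JE/ED.
  have mC' i : measurable (C' i) by rewrite /C'; case: ifP.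
  have C'J i : i \in J -> C' i = C i.
    by rewrite /C'; case: eqP => // ->; rewrite (negbTE jJ).
  have C'j : C' j = B by rewrite /C' eqxx.
  have := H _ mC'; rewrite big_fsetU1//= C'j.
  have -> : (\prod_(i <- J) Pr (draw i @^-1` C' i))%E =
            (\prod_(i <- J) Pr (draw i @^-1` C i))%E.
    by apply: eq_big_seq => i iJ; rewrite C'J.
  rewrite -(H' _ mC) muleC => <-; congr (Pr _).
  apply/seteqP; split=> w /=.
    move=> [Hw Bw] i /=; rewrite !inE => /orP[/eqP ->|iJ].
      by rewrite C'j.
    by rewrite C'J//; exact: Hw.
  move=> Hw; split.
    move=> i /= iJ; have := Hw i; rewrite /= !inE iJ orbT => /(_ isT).
    by rewrite C'J.
  by have := Hw j; rewrite /= !inE eqxx => /(_ isT); rewrite C'j.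
- move=> k; rewrite -[X in (X < _)%E]/(Pr (setT `&` draw j @^-1` B)) setTI.
  by rewrite ltey_eq fc.
Qed.

(** The joint law of the past and the fresh draw is a product measure. The past is represented by
    the identity map from [Omega] to the same set with the coarser sigma-algebra, for which [phi]
    has to be measurable. *)
Lemma integral_draw (E : set I) (j : I) (phi : Omega * Xi -> \bar R) :
  E `<=` D -> D j -> ~ E j ->
  (forall B, measurable B -> Pr (draw j @^-1` B) = law B) ->
  (forall z, (0 <= phi z)%E) ->
  measurable_fun [set: g_sigma_algebraType (past E) * Xi] phi ->
  (\int[Pr]_w phi (w, draw j w) = \int[Pr]_w \int[law]_x phi (w, x))%E.
Proof.
move=> ED Dj nEj lawj phi0 mphi.
pose O' := g_sigma_algebraType (past E).
have mid : measurable_fun [set: Omega] (id : Omega -> O').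
  move=> _ A sA; rewrite setTI preimage_id.
  exact: (smallest_sub (@sigma_algebra_measurable _ _) (@past_measurable E)).
pose X : {mfun Omega >-> O'} := HB.pack (id : Omega -> O')
  (isMeasurableFun.Build _ _ _ _ (id : Omega -> O') mid).
have mp : measurable_fun [set: Omega] (fun w => (w, draw j w) : O' * Xi).
  exact: measurable_fun_pair.
pose Y : {mfun Omega >-> (O' * Xi)%type} := HB.pack (fun w => (w, draw j w) :
  O' * Xi)
  (isMeasurableFun.Build _ _ _ _ (fun w => (w, draw j w) : O' * Xi) mp).
have E1 : (\int[Pr]_w phi (w, draw j w) =
           \int[distribution Pr Y]_z phi z)%E.
  by rewrite ge0_integral_pushforward//.
have E2 : (\int[Pr]_w \int[law]_x phi (w, x) =
           \int[distribution Pr X]_w \int[law]_x phi (w, x))%E.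
  rewrite ge0_integral_pushforward//.
    exact: measurable_fun_fubini_tonelli_F.
  by move=> w _; exact: integral_ge0.
rewrite E1 E2 -[RHS](fubini_tonelli1 (m1 := distribution Pr X) (m2 := law)
  phi)//.
apply: eq_measure_integral => S mS _; apply/esym.
apply: (product_measure_unique (m' := distribution Pr Y)) => // A B sA mB.
by have := past_independent ED Dj nEj sA mB; rewrite lawj// => <-.
Qed.

End independent_draw.

(** * Integrals over a probability space and mean vectors *)

Section expectation.
Context {R : realType} {dT : measure_display} {T : measurableType dT}.
Context (P : probability T R).

Local Notation integrable_fun g := (P.-integrable setT (EFin \o g)).

Lemma integrable_fun_cst (c : R) : integrable_fun (fun=> c).
Proof. exact: finite_measure_integrable_cst. Qed.

Lemma integrable_funD (f g : T -> R) : integrable_fun f -> integrable_fun g ->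
  integrable_fun (fun t => f t + g t).
Proof.
move=> intf intg; apply: eq_integrable (integrableD _ intf intg) => //.
Qed.

Lemma integrable_funZ c (f : T -> R) : integrable_fun f ->
  integrable_fun (fun t => c * f t).
Proof.
by move=> intf; apply: eq_integrable (integrableZl _ c intf).
Qed.

Lemma Rintegral_prob_cst (c : R) : \int[P]_t c = c.
Proof.
rewrite Rintegral_cst// -[RHS]mulr1; congr (_ * _).
exact: (congr1 fine (probability_setT P)).
Qed.

Lemma integral_prob_cst (c : \bar R) : (\int[P]_t c = c)%E.
Proof.
rewrite integral_cst//.
exact: (etrans (congr1 (mule c) (probability_setT P)) (mule1 c)).
Qed.

Lemma EFin_Rintegral (f : T -> R) : integrable_fun f ->
  (\int[P]_t f t)%:E = (\int[P]_t (f t)%:E)%E.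
Proof. by move=> intf; rewrite fineK// integrable_fin_num. Qed.

Lemma ae_integrable_le (f g : T -> R) : measurable_fun setT f ->
  {ae P, forall t, `|f t| <= g t} -> integrable_fun g -> integrable_fun f.
Proof.
move=> mf fg /[dup] intg /integrableP[mg goo]; apply/integrableP; split.
  exact/measurable_EFinP.
apply: le_lt_trans goo; apply: ae_ge0_le_integral => //.
- by apply: measurableT_comp => //; exact/measurable_EFinP.
- by apply: measurableT_comp => //.
apply: filterS fg => t /= h _; rewrite lee_fin.
exact: le_trans h (ler_norm _).
Qed.

(** Serves where [xstar] is only almost surely feasible. The difference is replaced by its absolute
    value, which is nonnegative everywhere. *)
Lemma ae_le_Rintegral (f g : T -> R) : integrable_fun f -> integrable_fun g ->
  {ae P, forall t, f t <= g t} -> \int[P]_t f t <= \int[P]_t g t.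
Proof.
move=> intf intg fg; rewrite -subr_ge0 -RintegralB//.
have intgf : integrable_fun (fun t => g t - f t).
  have := integrable_funD intg (integrable_funZ (-1) intf).
  by apply: eq_integrable => // t _ /=; rewrite mulN1r.
have mgf : measurable_fun setT (fun t => g t - f t).
  by apply/measurable_EFinP; case/integrableP : intgf.
rewrite -lee_fin EFin_Rintegral// (@ae_eq_integral _ _ _ _ _ (fun t => `|g t -
  f t|%:E))//.
- by apply: integral_ge0 => t _; rewrite lee_fin.
- exact/measurable_EFinP.
- by apply/measurable_EFinP; exact: measurableT_comp.
by apply: filterS fg => t /= h _; rewrite ger0_norm// subr_ge0.
Qed.

Lemma integrable_fun_ge0 (f : T -> R) C : measurable_fun setT f ->
  (forall t, 0 <= f t) -> (\int[P]_t (f t)%:E <= C%:E)%E -> integrable_fun f.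
Proof.
move=> mf f0 fC; apply/integrableP; split; first exact/measurable_EFinP.
apply: (le_lt_trans _ (ltry C)); apply: le_trans fC.
rewrite le_eqVlt; apply/orP; left; apply/eqP.
by apply: eq_integral => t _ /=; rewrite ger0_norm.
Qed.

Definition mean_vector n (X : T -> 'cV[R]_n) : 'cV[R]_n :=
  \col_i \int[P]_t (X t i 0).

Lemma integrable_dot n (X : T -> 'cV[R]_n) v :
  (forall i, integrable_fun (fun t => X t i 0)) ->
  integrable_fun (fun t => dot (X t) v) /\
  \int[P]_t (dot (X t) v) = dot (mean_vector X) v.
Proof.
move=> intX; rewrite /dot.
pose S (s : seq 'I_n) t := \sum_(i <- s) X t i 0 * v i 0.
have H s : integrable_fun (S s) /\
    \int[P]_t S s t = \sum_(i <- s) mean_vector X i 0 * v i 0.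
  elim: s => [|i s [ints Es]].
    have -> : S [::] = fun=> 0 by apply/funext => t; rewrite /S big_nil.
    by rewrite big_nil Rintegral_prob_cst; split=> //; exact:
      integrable_fun_cst.
  have -> : S (i :: s) = fun t => v i 0 * X t i 0 + S s t.
    by apply/funext => t; rewrite /S big_cons mulrC.
  have i1 := integrable_funZ (v i 0) (intX i).
  rewrite big_cons; split; first exact: integrable_funD.
  by rewrite RintegralD// RintegralZl// Es mxE mulrC.
exact: H.
Qed.

Lemma variance_le n (X : T -> 'cV[R]_n) :
  (forall i, integrable_fun (fun t => X t i 0)) ->
  integrable_fun (fun t => enorm (X t) ^+ 2) ->
  integrable_fun (fun t => enorm (X t - mean_vector X) ^+ 2) /\
  \int[P]_t (enorm (X t - mean_vector X) ^+ 2) <= \int[P]_t (enorm (X t) ^+ 2).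
Proof.
move=> intX intX2; set m := mean_vector X.
have [intm Em] := integrable_dot m intX.
have E : (fun t => enorm (X t - m) ^+ 2) =
    (fun t => enorm (X t) ^+ 2 + ((-2) * dot (X t) m + dot m m)).
  by apply/funext => t; rewrite !enorm_sq !dotE (dotC m); lra.
have i1 := integrable_funZ (-2) intm.
have i2 := integrable_funD i1 (integrable_fun_cst (dot m m)).
rewrite E; split; first exact: integrable_funD.
rewrite RintegralD// RintegralD//; last exact: integrable_fun_cst.
rewrite RintegralZl// Rintegral_prob_cst Em -/m.
by have := dot_ge0 m; lra.
Qed.

End expectation.

(** * Feasibility of the solution *)

Section saddle_point_feasible.
Context {R : realType} {dX : measure_display} {Xi : measurableType dX}.
Context (law : probability Xi R) {d m : nat}.
Context (f : 'cV[R]_d -> Xi -> R) (h : 'cV[R]_d -> \bar R).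
Context (A : Xi -> 'M[R]_(m, d)) (b : Xi -> set 'cV[R]_m).
Context (xstar : 'cV[R]_d) (ystar : Xi -> 'cV[R]_m).
Hypothesis prh : proper_fun h.
Hypothesis mA : random_matrix A.
Hypotheses (rb : random_closed_set b) (cvb : forall xi, convex_set (b xi)).
Hypothesis b0 : forall xi, b xi !=set0.
Hypothesis saddle : saddle_point law f h A b xstar ystar.

(** If [h xstar] were infinite, so would be the Lagrangian at the saddle point, whatever value its
    integral takes. *)
Lemma saddle_point_fin : exists a, h xstar = a%:E.
Proof.
have [pN _] := prh; have [_ + _ _] := saddle.
rewrite /lagrangian /objective; have := pN xstar.
case: (h xstar) => [a||]//; first by exists a.
by rewrite addey//; case: (\int[law]_xi _)%E.
Qed.

Let z xi := A xi *m xstar.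
Let r xi := z xi - proj (b xi) (z xi).
Let de xi := set_dist (z xi) (b xi).
(** Dividing by [1 + de] makes up for the missing integrability of [de]: it bounds the norm of the
    test variable [y n] by [n]. *)
Let w xi := de xi ^+ 2 / (1 + de xi).

Let de0 xi : 0 <= de xi. Proof. by rewrite /de set_dist_ge0//; case: rb. Qed.

Let mz : random_vector z.
Proof. exact: random_vector_mulmx mA (random_vector_cst xstar). Qed.

Let mde : measurable_fun setT de.
Proof. exact: (measurable_set_dist (u := id) rb cvb b0 mz (@measurable_id _ _
  setT)). Qed.

Let mr : random_vector r.
Proof.
have [clb _] := rb.
have := @random_vector_grad R _ _ _ _ m
  (fun x xi => smoothed_dist 1 (b xi) x) z id.
have -> : (fun t => grad ((fun x xi => smoothed_dist 1 (b xi) x)^~ (id t)) (z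
  t)) = r.
  apply/funext => xi.
  have [_ ->] := grad_smoothed_dist (clb xi) (cvb (xi := xi)) (b0 xi) (z xi)
    ltr01.
  by rewrite invr1 scale1r.
apply => //.
  move=> xi x.
  by have [] := grad_smoothed_dist (clb xi) (cvb (xi := xi)) (b0 xi) x ltr01.
move=> x; apply: measurable_funM; first exact: measurable_cst.
apply: measurable_funX.
exact: (measurable_set_dist (u := id) rb cvb b0 (random_vector_cst x)
  (@measurable_id _ _ setT)).
Qed.

Let mden : measurable_fun setT (fun xi => (1 + de xi)^-1).
Proof.
(* The absolute value makes the outer function continuous on the whole line. *)
have -> : (fun xi => (1 + de xi)^-1) = (fun s => (1 + `|s|)^-1) \o de.
  by apply/funext => xi /=; rewrite ger0_norm.
apply: measurableT_comp mde; apply: continuous_measurable_fun => s.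
apply: cvgV; first by rewrite gt_eqF// ltr_wpDr.
by apply: cvgD; [exact: cvg_cst|exact: norm_continuous].
Qed.

Let mw : measurable_fun setT w.
Proof. by apply: measurable_funM => //; exact: measurable_funX. Qed.

Let w0 xi : 0 <= w xi.
Proof. by rewrite divr_ge0 ?sqr_ge0// addr_ge0. Qed.

(* Dual test variables: [lagrangian xstar (y n)] grows like [n * E w], so that
   optimality of [ystar] forces [w = 0] almost surely. *)
Let y (n : nat) xi := (n%:R / (1 + de xi)) *: r xi.

Let yL2 n : in_L2 law (y n).
Proof.
split.
  apply: random_vectorZ => //; apply: measurable_funM => //.
apply: (@le_lt_trans _ _ (\int[law]_xi (n%:R ^+ 2)%:E)%E); last first.
  by rewrite integral_prob_cst ltry.
apply: ge0_le_integral => //.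
- by move=> xi _; rewrite lee_fin sqr_ge0.
- apply/measurable_EFinP; apply: measurable_enorm_sq.
  by apply: random_vectorZ => //; apply: measurable_funM.
move=> xi _; rewrite lee_fin enormZ exprMn.
have -> : enorm (r xi) = de xi by rewrite /de set_distE//; case: rb.
have dp : 0 < 1 + de xi by rewrite ltr_wpDr.
have cn : 0 <= n%:R / (1 + de xi) by rewrite divr_ge0// ltW.
rewrite (ger0_norm cn) -exprMn ler_pXn2r ?nnegrE ?(mulr_ge0 cn (de0 xi))//.
by rewrite -mulrA ler_piMr// ler_pdivrMl// mulr1 lerDr.
Qed.

(** The residual is normal to [b xi] at the projection, so the support function in its direction is
    attained there. *)
Let lagrE n xi : ((dot (z xi) (y n xi))%:E - support_fun (b xi) (y n xi) =
  (n%:R * w xi)%:E)%E.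
Proof.
have [clb _] := rb; have bp := proj_in (clb xi) (cvb (xi := xi)) (b0 xi) (z xi).
have -> : support_fun (b xi) (y n xi) = (dot (y n xi) (proj (b xi) (z xi)))%:E.
  apply/eqP; rewrite eq_le; apply/andP; split; last first.
    by apply: ereal_sup_ubound; exists (proj (b xi) (z xi)).
  apply: ub_ereal_sup => _ [v bv <-]; rewrite lee_fin.
  have := proj_var_ineq (clb xi) (cvb (xi := xi)) (b0 xi) (z xi) bv.
  have dp : 0 < 1 + de xi by rewrite ltr_wpDr.
  have cn : 0 <= n%:R / (1 + de xi) by rewrite divr_ge0// ltW.
  rewrite /y !dotZl /r => hh; rewrite (ler_wpM2l cn)//.
  move: (z xi) (proj _ _) hh => u p; rewrite !dotE (dotC v) (dotC v) (dotC p
    u); lra.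
rewrite -EFinB; congr (_%:E); rewrite dotC -dotNr -dotDr /y dotZl -/(r xi).
by rewrite -enorm_sq /w /de set_distE// mulrAC mulrA.
Qed.

Lemma saddle_point_feasible : {ae law, forall xi, b xi (A xi *m xstar)}.
Proof.
have [a ha] := saddle_point_fin.
have [_ Lfin Lmax _] := saddle.
(* [C] is the integral at [ystar], finite since the Lagrangian is; the finite objective cancels from
   the saddle inequality. *)
have [C HC] : exists C : R, forall n : nat,
    ((n%:R)%:E * \int[law]_xi (w xi)%:E <= C%:E)%E.
  move: Lfin Lmax; rewrite {1}/lagrangian /objective ha -EFinD.
  case I : (\int[law]_xi _)%E => [C||]// _ Lmax.
  exists C => n; have := Lmax _ (yL2 n).
  rewrite /lagrangian /objective ha I -!EFinD.
  rewrite (eq_integral (fun xi => (n%:R)%:E * (w xi)%:E)%E); last first.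
    by move=> xi _; rewrite lagrE EFinM.
  rewrite ge0_integralZl//.
  - case: (_ * _)%E => [q||]; rewrite ?addey ?leNye//.
    by rewrite -EFinD !lee_fin; lra.
  - exact/measurable_EFinP.
  - by move=> xi _; rewrite lee_fin.
have I0 : (\int[law]_xi (w xi)%:E = 0)%E.
  have : (0 <= \int[law]_xi (w xi)%:E)%E.
    by apply: integral_ge0 => xi _; rewrite lee_fin.
  move: HC; case: (\int[law]_xi (w xi)%:E)%E => [c HC|/(_ 1%N)|]//; last first.
    by rewrite mul1e.
  - rewrite lee_fin => c0; congr (_%:E).
    apply/eqP; rewrite eq_le c0 andbT leNgt; apply/negP => cp.
    have := HC (Num.truncn (C / c)).+1; rewrite -EFinM lee_fin.
    apply/negP; rewrite -ltNge -ltr_pdivrMr//.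
    by rewrite truncnS_gt.
have [clb _] := rb.
have : ae_eq law setT (fun xi => (w xi)%:E) (cst 0%E).
  apply/ae_eq_integral_abs => //; first exact/measurable_EFinP.
  rewrite -I0; apply: eq_integral => xi _.
  by rewrite gee0_abs// lee_fin.
apply: filterS => xi /= /(_ I) [] /eqP.
have dp : 0 < 1 + de xi by rewrite ltr_wpDr.
rewrite mulf_eq0 expf_eq0/= invr_eq0 (gt_eqF dp) orbF => /eqP.
exact: set_dist_eq0.
Qed.

End saddle_point_feasible.

(** * One step of the algorithm *)

(* Here [p], [s], [q] are the new iterate, the solution and the step along the
   mean direction, all relative to the current iterate. *)
Lemma prox_step_bound {R : realType} n (p s q D g g' : 'cV[R]_n)
    (al L hp hs Fx Fp Gx Gp : R) :
  0 < al -> al * L <= 3 / 4 ->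
  al * hp <= al * hs + dot (s - p) (p + al *: D) ->
  Fp <= Fx + dot g p + L / 2 * enorm p ^+ 2 ->
  Gp <= Gx + dot g' p + (8 * al)^-1 * enorm p ^+ 2 ->
  enorm (p - q) <= enorm (al *: (g + g' - D)) ->
  Fp + Gp + hp + (2 * al)^-1 * enorm (p - s) ^+ 2 <=
  hs + Fx + Gx + (2 * al)^-1 * enorm s ^+ 2 + dot D (s - q) + dot (g + g') q
  + al * enorm (g + g' - D) ^+ 2.
Proof.
move=> al0 alL h1 h2 h3 h4.
have -> : (2 * al)^-1 = al^-1 / 2 by field; rewrite gt_eqF.
have e8 : (8 * al)^-1 = al^-1 / 8 by field; rewrite gt_eqF.
rewrite e8 in h3.
have ia0 : 0 < al^-1 by rewrite invr_gt0.
have La : L <= 3 / 4 * al^-1 by rewrite ler_pdivlMr// mulrC.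
have h1' : hp <= hs + al^-1 * dot (s - p) p + dot (s - p) D.
  rewrite -(ler_pM2l al0); apply: (le_trans h1); rewrite dotDr dotZr.
  rewrite le_eqVlt; apply/orP; left; apply/eqP; field; rewrite gt_eqF//.
(* The noise is paired with [p - q] only: [q] will be the same for all samples, and nonexpansiveness
   bounds [p - q] by [al] times the noise. *)
have h4' : dot (g + g' - D) (p - q) <= al * enorm (g + g' - D) ^+ 2.
  apply: (le_trans (dot_le_enorm _ _)); rewrite expr2 mulrCA.
  by rewrite ler_wpM2l ?enorm_ge0//; rewrite enormZ gtr0_norm in h4.
(* The curvature terms [3 / 8] and [1 / 8], in units of [al^-1], use up the [1 / 2] that the
   proximal inequality provides. *)
have h5 : L / 2 * enorm p ^+ 2 <= 3 / 8 * (al^-1 * enorm p ^+ 2).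
  have := ler_wpM2r (sqr_ge0 (enorm p)) La; move: (enorm p ^+ 2) => e; lra.
move: (al * _) h4' => V h4'; clear h1 h4 La alL.
move: al^-1 ia0 h1' h2 h3 h5 h4' => ia ia0.
rewrite !enorm_sq !dotE (dotC p s) (dotC s D) (dotC p D).
move: (dot g p) (dot g' p) (dot g q) (dot g' q) (dot D p) (dot D q) (dot D s).
move: (dot s s) (dot s p) (dot p p) => ss sp pp gp g'p gq g'q Dp Dq Ds; lra.
Qed.

(** The facts used by the analysis of the algorithm. Of the saddle point it retains the almost sure
    feasibility of [xstar] and the finite value [hstar]; [a] may be any positive bound on the
    operator norms. *)
Record sasc_setting {R : realType} {dX : measure_display}
    {Xi : measurableType dX} (law : probability Xi R) {d m : nat}
    (f : 'cV[R]_d -> Xi -> R) (h : 'cV[R]_d -> \bar R)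
    (A : Xi -> 'M[R]_(m, d)) (b : Xi -> set 'cV[R]_m)
    (xstar : 'cV[R]_d) (a L mu sigma hstar : R) : Prop := SascSetting {
  sample_differentiable : forall xi x, differentiable (f ^~ xi) x;
  sample_integrable : forall x, law.-integrable setT (fun xi => (f x xi)%:E);
  sample_grad_integrable : forall x i,
    law.-integrable setT (fun xi => (grad (f ^~ xi) x i 0)%:E);
  mean_sample_grad : forall x i,
    \int[law]_xi (grad (f ^~ xi) x i 0) = grad (mean_fun law f) x i 0;
  reg_proper : proper_fun h;
  reg_lsc : lower_semicontinuous h;
  reg_econvex : econvex h;
  random_operator : random_matrix A;
  operator_bound_gt0 : 0 < a;
  operator_bound : forall xi (x : 'cV[R]_d), enorm (A xi *m x) <= a * enorm x;
  constraint_closed : random_closed_set b;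
  constraint_convex : forall xi, convex_set (b xi);
  constraint_nonempty : forall xi, b xi !=set0;
  solution_feasible : {ae law, forall xi, b xi (A xi *m xstar)};
  reg_solution : h xstar = hstar%:E;
  mean_fun_convex : forall x y t, 0 < t < 1 ->
    mean_fun law f (x + t *: (y - x)) <=
    mean_fun law f x + t * (mean_fun law f y - mean_fun law f x);
  mean_fun_smooth : smooth L (mean_fun law f);
  growth_gt0 : 0 < mu;
  growth : forall x, ((mean_fun law f xstar + hstar)%:E
    + (mu / 2 * enorm (x - xstar) ^+ 2)%:E <= (mean_fun law f x)%:E + h x)%E;
  sample_variance : forall x,
    (\int[law]_xi (enorm (grad (f ^~ xi) x - grad (mean_fun law f) x) ^+ 2)%:E
     <= (sigma ^+ 2)%:E)%E
}.

Section stochastic_step.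
Context {R : realType} {dX : measure_display} {Xi : measurableType dX}.
Context (law : probability Xi R) {d m : nat}.
Context (f : 'cV[R]_d -> Xi -> R) (h : 'cV[R]_d -> \bar R).
Context (A : Xi -> 'M[R]_(m, d)) (b : Xi -> set 'cV[R]_m).
Context (xstar : 'cV[R]_d) (a L mu sigma hstar al : R).
Hypothesis setting : sasc_setting law f h A b xstar a L mu sigma hstar.
Local Notation F := (mean_fun law f).
Let df := sample_differentiable setting.
Let intf := sample_integrable setting.
Let intdf := sample_grad_integrable setting.
Let gradF := mean_sample_grad setting.
Let prh := reg_proper setting.
Let lsch := reg_lsc setting.
Let cvxh := reg_econvex setting.
Let mA := random_operator setting.
Let a0 := operator_bound_gt0 setting.
Let Aa := operator_bound setting.
Let rb := constraint_closed setting.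
Let cvb := constraint_convex setting.
Let b0 := constraint_nonempty setting.
Let feas := solution_feasible setting.
Let hxstar := reg_solution setting.
Let cvxF := mean_fun_convex setting.
Let smF := mean_fun_smooth setting.
Let var := sample_variance setting.
Hypotheses (al0 : 0 < al) (alL : al * L <= 3 / 4).

Let minF x : (((F xstar + hstar)%:E <= (F x)%:E + h x)%E).
Proof.
apply: le_trans (growth setting x); rewrite leeDl// lee_fin.
by rewrite mulr_ge0 ?sqr_ge0// divr_ge0// ltW// (growth_gt0 setting).
Qed.

Let be := 4 * al * a ^+ 2.
Let be0 : 0 < be. Proof. by rewrite !mulr_gt0// exprn_gt0. Qed.

Definition penalty x xi := smoothed_dist be (b xi) (A xi *m x).
Definition penalty_grad x xi :=
  (A xi)^T *m grad (smoothed_dist be (b xi)) (A xi *m x).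
Definition mean_penalty x := \int[law]_xi penalty x xi.
Definition sasc_step x xi :=
  prox (fun z => al%:E * h z)%E (x - al *: direction f A b be x xi).
(** The finite terms are collected in one real number, so that [h x] is the only summand that can be
    infinite. *)
Definition smoothed_gap x : \bar R :=
  ((F x + mean_penalty x - (F xstar + hstar))%:E + h x)%E.

Let psi z := (al%:E * h z)%E.

Lemma scaled_proper : proper_fun psi.
Proof.
have [pN [x0 x0oo]] := prh; split.
  move=> x; rewrite /psi; have := pN x; case: (h x) => [r||]// _.
  by rewrite gt0_muley// lte_fin.
exists x0; rewrite /psi; move: x0oo; case: (h x0) => [r||]// _.
  by rewrite -EFinM ltry.
by rewrite gt0_muleNy// lte_fin.
Qed.

Lemma scaled_lsc : lower_semicontinuous psi.
Proof.
move=> x c; rewrite /psi.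
have E y : ((c%:E < al%:E * h y) = ((al^-1 * c)%:E < h y))%E.
  case: (h y) => [r||].
  - by rewrite -EFinM !lte_fin ltr_pdivrMl.
  - by rewrite gt0_muley ?lte_fin// !ltry.
  - by rewrite gt0_muleNy ?lte_fin// !ltNge !leNye.
by rewrite E => /lsch [V Vx HV]; exists V => // y /HV; rewrite E.
Qed.

Lemma scaled_econvex : econvex psi.
Proof.
have [pN _] := prh.
move=> t x y t01; have := cvxh x y t01.
have [t0 t1] := andP t01.
have al0' : (0 < al%:E)%E by rewrite lte_fin.
have t0' : (0 < t%:E)%E by rewrite lte_fin.
have t1' : (0 < (1 - t)%:E)%E by rewrite lte_fin subr_gt0.
rewrite /psi => H.
have -> : (t%:E * (al%:E * h x) + (1 - t)%:E * (al%:E * h y) =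
           al%:E * (t%:E * h x + (1 - t)%:E * h y))%E.
  move: (pN x) (pN y); case: (h x) => [r||]//; case: (h y) => [s||]// _ _.
  - by rewrite -!EFinM -!EFinD; congr (_%:E); ring.
  - by rewrite !(gt0_muley, addey, addye)// -EFinM ?addey// gt0_muley.
  - by rewrite !(gt0_muley, addey, addye)// -EFinM ?addye// gt0_muley.
  - by rewrite !(gt0_muley, addey, addye).
by rewrite lee_pmul2l.
Qed.

(* No affine minorant of [h] is needed: the growth condition bounds [h] below
   by [- F] up to a constant, and [F] is at most a quadratic of curvature [L],
   which is smaller than [al^-1]. *)
Lemma scaled_prox_bounded : prox_bounded psi.
Proof.
move=> z; pose g := grad F xstar; pose v := xstar - z.
(* With [u = x - xstar], the proximal objective is at least [enorm u ^+ 2 / 8 + dot (v - al *: g) u]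
   plus constants, and this bound is minimal at [u = - 4 *: (v - al *: g)]. *)
exists (al * hstar - 2 * enorm (v - al *: g) ^+ 2 + 2^-1 * enorm v ^+ 2) => x.
have := minF x; rewrite /psi; case: (h x) => [r||]; last 2 first.
- by move=> _; rewrite gt0_muley ?lte_fin// addye// leey.
- by rewrite addeNy leeNy_eq.
rewrite -EFinM -!EFinD !lee_fin => H1.
have := smooth_upper xstar x smF; rewrite -/g.
have -> : x - z = (x - xstar) + v by rewrite /v; vector_ring.
move: (x - xstar) => u H2.
have H : hstar - dot g u - L / 2 * enorm u ^+ 2 <= r by lra.
have := ler_wpM2l (ltW al0) H.
have := dot_ge0 (u + 4 *: (v - al *: g)).
have : al * L * enorm u ^+ 2 <= 3 / 4 * enorm u ^+ 2.
  by rewrite ler_wpM2r// sqr_ge0.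
rewrite !enorm_sq; clearbody g v; clear H H1 H2.
rewrite !dotE (dotC g v) (dotC v u) (dotC g u); nra.
Qed.

Lemma sasc_step_fin x xi : exists hp, h (sasc_step x xi) = hp%:E.
Proof.
have [r + _] := prox_var_ineq (x - al *: direction f A b be x xi)
  scaled_proper scaled_lsc scaled_econvex scaled_prox_bounded.
rewrite -/(sasc_step x xi) /psi; case: (h _) => [s _||]; first by exists s.
  by rewrite gt0_muley ?lte_fin.
by rewrite gt0_muleNy ?lte_fin.
Qed.

Section measurability.
Context {dT : measure_display} {T : measurableType dT}.
Context (X : T -> 'cV[R]_d) (u : T -> Xi).
Hypotheses (mX : random_vector X) (mU : measurable_fun setT u).

Let mAX : random_vector (fun t => A (u t) *m X t).
Proof. exact: random_vector_mulmx (random_matrix_comp mU mA) mX. Qed.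

Lemma measurable_sqdist :
  measurable_fun setT (fun t => set_dist (A (u t) *m X t) (b (u t)) ^+ 2).
Proof. by apply: measurable_funX; exact: (measurable_set_dist rb cvb b0 mAX
  mU). Qed.

Lemma measurable_penalty : measurable_fun setT (fun t => penalty (X t) (u t)).
Proof.
by apply: measurable_funM; [exact: measurable_cst|exact: measurable_sqdist].
Qed.

Lemma random_vector_penalty_grad :
  random_vector (fun t => penalty_grad (X t) (u t)).
Proof.
have [clb _] := rb.
apply: random_vector_mulmx (random_matrix_tr (random_matrix_comp mU mA)) _.
apply: (@random_vector_grad R _ _ _ _ m
  (fun x xi => smoothed_dist be (b xi) x)) => //.
  by move=> xi x; have [] := grad_smoothed_dist (clb xi) (cvb (xi := xi)) (b0
    xi) x be0.
move=> x; apply: measurable_funM; first exact: measurable_cst.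
apply: measurable_funX.
exact: (measurable_set_dist (u := id) rb cvb b0 (random_vector_cst x)
  (@measurable_id _ _ setT)).
Qed.

Lemma random_vector_direction :
  random_vector (fun t => direction f A b be (X t) (u t)).
Proof.
apply: random_vectorD random_vector_penalty_grad.
apply: random_vector_grad => // x.
by apply/measurable_EFinP; case/integrableP : (intf x).
Qed.

(** The proximal map is nonexpansive, hence continuous, hence preserves measurability. *)
Lemma random_vector_sasc_step : random_vector (fun t => sasc_step (X t) (u t)).
Proof.
move=> i.
apply: (@measurable_continuous_comp R _ T d (fun z => prox psi z i 0)
  (fun t => X t - al *: direction f A b be (X t) (u t))).
  move=> z; apply: continuous_enormP => e e0; exists e => // y zy.
  apply: le_lt_trans zy; have := enorm_coord (prox psi z - prox psi y) i.
  rewrite !mxE => /le_trans; apply; apply: prox_nonexpansive.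
  - exact: scaled_proper.
  - exact: scaled_lsc.
  - exact: scaled_econvex.
  - exact: scaled_prox_bounded.
apply: random_vectorB => //.
exact: (random_vectorZ (a := fun=> al) (measurable_cst _)
  random_vector_direction).
Qed.

End measurability.

Let clb xi : closed (b xi). Proof. by case: rb. Qed.

Lemma integrable_penalty x :
  law.-integrable setT (EFin \o (fun xi => penalty x xi)).
Proof.
apply: (@ae_integrable_le _ _ _ law _ (fun=> (8 * al)^-1 * enorm (x - xstar) ^+
  2)).
- exact: (measurable_penalty (X := fun=> x) (u := id) (random_vector_cst x)
    (@measurable_id _ _ setT)).
- apply: filterS feas => xi bx; rewrite ger0_norm; last first.
    exact: (penalty_ge0 (A xi) (b xi) a0 al0).
  exact: (penalty_le_feasible (@clb xi) (cvb (xi := xi)) (b0 xi) a0 al0 (Aa xi)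
    x bx).
- exact: integrable_fun_cst.
Qed.

Lemma penalty_grad_sq_le x xi :
  enorm (penalty_grad x xi) ^+ 2 <= (2 * al)^-1 * penalty x xi.
Proof.
exact: (penalty_grad_sq (@clb xi) (cvb (xi := xi)) (b0 xi) a0 al0 (Aa xi) x).
Qed.

Lemma mpenalty_grad x : random_vector (fun xi => penalty_grad x xi).
Proof.
exact: (random_vector_penalty_grad (X := fun=> x) (u := id)
  (random_vector_cst x) (@measurable_id _ _ setT)).
Qed.

Lemma integrable_penalty_grad_sq x :
  law.-integrable setT (EFin \o (fun xi => enorm (penalty_grad x xi) ^+ 2)).
Proof.
apply: (@ae_integrable_le _ _ _ law _ (fun xi => (2 * al)^-1 * penalty x xi)).
- exact/measurable_enorm_sq/mpenalty_grad.
- apply: aeW => xi; rewrite ger0_norm ?sqr_ge0//.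
  exact: penalty_grad_sq_le.
- exact/integrable_funZ/integrable_penalty.
Qed.

Lemma integrable_penalty_grad x i :
  law.-integrable setT (EFin \o (fun xi => penalty_grad x xi i 0)).
Proof.
apply: (@ae_integrable_le _ _ _ law _
  (fun xi => enorm (penalty_grad x xi) ^+ 2 + 1)).
- exact: mpenalty_grad.
- apply: aeW => xi; apply: (le_trans (enorm_coord _ i)).
  by move: (enorm _) => c; have := sqr_ge0 (c - 1); nra.
- exact: integrable_funD (integrable_penalty_grad_sq x) (integrable_fun_cst _
  _).
Qed.

Definition mean_penalty_grad x := mean_vector law (penalty_grad x).

Lemma mean_penalty_ge0 x : 0 <= mean_penalty x.
Proof.
by apply: Rintegral_ge0 => xi _; exact: (penalty_ge0 (A xi) (b xi) a0 al0).
Qed.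

Lemma mean_penalty_lower x y :
  mean_penalty x + dot (mean_penalty_grad x) (y - x) <= mean_penalty y.
Proof.
have [i1 <-] := integrable_dot (y - x) (integrable_penalty_grad x).
have i2 := integrable_penalty x.
rewrite -RintegralD//; apply: le_Rintegral => //.
- exact: integrable_funD.
- exact: integrable_penalty.
move=> xi _.
exact: (penalty_lower (A xi) (@clb xi) (cvb (xi := xi)) (b0 xi) a0 al0 x y).
Qed.

Lemma mean_penalty_upper x y : mean_penalty y <=
  mean_penalty x + dot (mean_penalty_grad x) (y - x)
  + (8 * al)^-1 * enorm (y - x) ^+ 2.
Proof.
have [i1 <-] := integrable_dot (y - x) (integrable_penalty_grad x).
have i2 := integrable_penalty x.
have i3 := integrable_funD i2 i1.
have i4 := integrable_fun_cst law ((8 * al)^-1 * enorm (y - x) ^+ 2).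
rewrite -[X in _ + X](Rintegral_prob_cst law) -!RintegralD//.
apply: le_Rintegral => //.
- exact: integrable_penalty.
- exact: integrable_funD.
move=> xi _.
exact: (penalty_upper (@clb xi) (cvb (xi := xi)) (b0 xi) a0 al0 (Aa xi) x y).
Qed.

Lemma mean_penalty_feasible x :
  dot (mean_penalty_grad x) (xstar - x) <= - (2 * mean_penalty x).
Proof.
have [i1 <-] := integrable_dot (xstar - x) (integrable_penalty_grad x).
have i2 := integrable_penalty x.
rewrite -mulNr -RintegralZl//; apply: ae_le_Rintegral => //.
  exact: integrable_funZ.
apply: filterS feas => xi bx; rewrite mulNr.
exact: (penalty_feasible (@clb xi) (cvb (xi := xi)) (b0 xi) a0 al0 x bx).
Qed.

Lemma mean_penalty_grad_sq x :
  \int[law]_xi (enorm (penalty_grad x xi) ^+ 2) <= (2 * al)^-1 * mean_penalty x.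
Proof.
have i2 := integrable_penalty x.
rewrite -RintegralZl//; apply: le_Rintegral => //.
- exact: integrable_penalty_grad_sq.
- exact: integrable_funZ.
by move=> xi _; exact: penalty_grad_sq_le.
Qed.

Lemma mean_penalty_continuous : continuous mean_penalty.
Proof.
move=> x; apply: differentiable_continuous.
have [] // := @is_diff_quadratic _ _ mean_penalty x (mean_penalty_grad x) (8 *
  al)^-1.
move=> y; have := mean_penalty_lower x y; have := mean_penalty_upper x y.
move: (mean_penalty x) (mean_penalty y) (dot _ _) => s t r h1 h2.
have c0 : 0 <= (8 * al)^-1 * enorm (y - x) ^+ 2.
  by rewrite mulr_ge0 ?sqr_ge0// invr_ge0 mulr_ge0// ltW.
by rewrite ler_norml; apply/andP; split; lra.
Qed.

Lemma F_continuous : continuous F.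
Proof. by move=> x; apply: differentiable_continuous; case: smF. Qed.

Lemma smoothed_gap_ge0 x : (0 <= smoothed_gap x)%E.
Proof.
have := minF x; have := mean_penalty_ge0 x; rewrite /smoothed_gap.
case: (h x) => [r||].
- by rewrite -!EFinD !lee_fin; lra.
- by move=> _ _; rewrite addey// leey.
- by move=> _; rewrite addeNy leeNy_eq.
Qed.

Lemma measurable_smoothed_gap dT (T : measurableType dT) (X : T -> 'cV[R]_d) :
  random_vector X -> measurable_fun setT (fun t => smoothed_gap (X t)).
Proof.
move=> mX; apply: emeasurable_funD; last exact: measurable_lsc_comp.
apply/measurable_EFinP; apply: measurable_funB; last exact: measurable_cst.
apply: measurable_funD; apply: measurable_continuous_comp => //.
- exact: F_continuous.
- exact: mean_penalty_continuous.
Qed.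

Lemma sasc_step_bound x :
  (\int[law]_xi (smoothed_gap (sasc_step x xi)
     + ((2 * al)^-1 * enorm (sasc_step x xi - xstar) ^+ 2)%:E)
   <= ((2 * al)^-1 * enorm (x - xstar) ^+ 2 + 2 * al * sigma ^+ 2)%:E)%E.
Proof.
pose g := grad F x; pose g' := mean_penalty_grad x.
(* [q] does not depend on the sample, so pairing it with the direction only sees the mean direction
   after integration. *)
pose q := prox psi (x - al *: (g + g')).
pose D xi := direction f A b be x xi.
pose noise xi := enorm (grad (f ^~ xi) x - g) ^+ 2.
pose noise' xi := enorm (penalty_grad x xi - g') ^+ 2.
pose C := F x + mean_penalty x - F xstar + (2 * al)^-1 * enorm (x - xstar) ^+ 2
   + dot (g + g') (q - x).
have pointwise xi : (smoothed_gap (sasc_step x xi)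
     + ((2 * al)^-1 * enorm (sasc_step x xi - xstar) ^+ 2)%:E
   <= (dot (D xi) (xstar - q) + (2 * al * noise xi + (2 * al * noise' xi +
     C)))%:E)%E.
  have [hp hpE] := sasc_step_fin x xi.
  rewrite /smoothed_gap hpE -!EFinD lee_fin.
  have [r rE Hr] := prox_var_ineq (x - al *: D xi)
    scaled_proper scaled_lsc scaled_econvex scaled_prox_bounded.
  have h1 := Hr xstar (al * hstar).
  rewrite -/(sasc_step x xi) /psi hxstar hpE in rE h1.
  move: rE h1 => [<-] /(_ erefl) h1.
  have h2 := smooth_upper x (sasc_step x xi) smF.
  have h3 := mean_penalty_upper x (sasc_step x xi).
  have h4 := prox_nonexpansive (x - al *: D xi) (x - al *: (g + g'))
    scaled_proper scaled_lsc scaled_econvex scaled_prox_bounded.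
  rewrite -/(sasc_step x xi) -/q in h4.
  rewrite -/g in h2; rewrite -/g' in h3.
  have hD : enorm (g + g' - D xi) ^+ 2 <= 2 * noise xi + 2 * noise' xi.
    rewrite /noise /noise' [enorm (_ - g)]enormBC [enorm (_ - g')]enormBC.
    rewrite /D /direction -/(penalty_grad x xi) opprD addrACA.
    exact: enorm_sqD_le.
  have := @prox_step_bound R d (sasc_step x xi - x) (xstar - x) (q - x) (D xi)
    g g' al L hp hstar (F x) (F (sasc_step x xi)) (mean_penalty x)
    (mean_penalty (sasc_step x xi)) al0 alL.
  move: (sasc_step x xi) h1 h2 h3 h4 => p h1 h2 h3 h4.
  have subBB (u v w : 'cV[R]_d) : u - w - (v - w) = u - v by vector_ring.
  have subBD (u v w : 'cV[R]_d) : u - v + w = u - (v - w) by vector_ring.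
  have scaleBB (u v w : 'cV[R]_d) :
    al *: (v - w) = u - al *: w - (u - al *: v) by vector_ring.
  rewrite !subBB subBD (scaleBB x).
  move=> /(_ h1 h2 h3 h4); rewrite /C [enorm (xstar - x)]enormBC.
  have := ler_wpM2l (ltW al0) hD.
  clear h1 h2 h3 h4 Hr hpE.
  move: (enorm (g + g' - D xi) ^+ 2) => e3; move: (noise xi) (noise' xi) => n1
    n2.
  move: (dot (D xi) _) (dot (g + g') _) => d1 d2; clear g g' q D noise noise' C
    hD.
  move: (F x) (F p) (F xstar) (mean_penalty x) (mean_penalty p) => Fx Fp Fs Gx
    Gp.
  move: (enorm (p - xstar) ^+ 2) (enorm (x - xstar) ^+ 2) => e1 e2.
  move: (2 * al)^-1 => ia; lra.
have int1 := integrable_dot (xstar - q) (X := D).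
have intD i : law.-integrable setT (EFin \o (fun xi => D xi i 0)).
  have -> : (fun xi => D xi i 0) = fun xi => grad (f ^~ xi) x i 0 +
    penalty_grad x xi i 0.
    by apply/funext => xi; rewrite /D /direction mxE.
  exact: integrable_funD (intdf x i) (integrable_penalty_grad x i).
have [iD ED] := int1 _ intD.
have mD : mean_vector law D = g + g'.
  apply/matrixP => i j; rewrite (ord1 j) [LHS]mxE [RHS]mxE.
  rewrite -[g i 0]/(grad F x i 0) -(gradF x i) [g' i 0]mxE.
  have -> : (fun xi => D xi i 0) = fun xi => grad (f ^~ xi) x i 0 +
    penalty_grad x xi i 0.
    by apply/funext => xi; rewrite /D /direction mxE.
  by rewrite RintegralD//; [exact: intdf|exact: integrable_penalty_grad].
have mdf : random_vector (fun xi => grad (f ^~ xi) x - g).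
  apply: random_vectorB; last exact: random_vector_cst.
  by move=> i; apply/measurable_EFinP; case/integrableP : (intdf x i).
have iN : law.-integrable setT (EFin \o noise).
  apply: (integrable_fun_ge0 (C := sigma ^+ 2)); last exact: var.
    exact: measurable_enorm_sq.
  by move=> xi; rewrite sqr_ge0.
have EN : \int[law]_xi noise xi <= sigma ^+ 2.
  by rewrite -lee_fin EFin_Rintegral//; exact: var.
have [iN' EN'] := variance_le (integrable_penalty_grad x)
  (integrable_penalty_grad_sq x).
have i1 := integrable_funZ (2 * al) iN.
have i2 := integrable_funZ (2 * al) iN'.
have i3 := integrable_funD i2 (integrable_fun_cst law C).
have i4 := integrable_funD i1 i3.
have i5 := integrable_funD iD i4.
apply: (@le_trans _ _ (\int[law]_xi (dot (D xi) (xstar - q) +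
   (2 * al * noise xi + (2 * al * noise' xi + C)))%:E)%E).
  apply: ge0_le_integral => //.
  - move=> xi _; apply: adde_ge0; first exact: smoothed_gap_ge0.
    by rewrite lee_fin mulr_ge0 ?sqr_ge0// invr_ge0 mulr_ge0// ltW.
  - apply: emeasurable_funD.
      apply: measurable_smoothed_gap.
      exact: (random_vector_sasc_step (X := fun=> x) (u := id)
        (random_vector_cst x) (@measurable_id _ _ setT)).
    apply/measurable_EFinP; apply: measurable_funM; first exact: measurable_cst.
    apply/measurable_enorm_sq/random_vectorB; last exact: random_vector_cst.
    exact: (random_vector_sasc_step (X := fun=> x) (u := id)
        (random_vector_cst x) (@measurable_id _ _ setT)).
  - by case/integrableP : i5.
rewrite -EFin_Rintegral// lee_fin RintegralD// ED mD.
have -> : \int[law]_xi (2 * al * noise xi + (2 * al * noise' xi + C)) =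
    2 * al * \int[law]_xi noise xi + (2 * al * \int[law]_xi noise' xi + C).
  rewrite RintegralD// RintegralZl//; congr (_ + _).
  rewrite RintegralD//; last exact: integrable_fun_cst.
  by rewrite RintegralZl// Rintegral_prob_cst.
have al2 : 0 < 2 * al by rewrite mulr_gt0.
have := ler_wpM2l (ltW al2) (le_trans EN' (mean_penalty_grad_sq x)).
rewrite mulVKf ?gt_eqF// -/g' => hG.
have hS := ler_wpM2l (ltW al2) EN.
have hF : F x + dot g (xstar - x) <= F xstar.
  by apply: convex_grad_le; [case: smF|move=> t; exact: cvxF].
(* The mean penalty occurs once in [C] and once through its variance; the factor 2 here removes
   both. *)
have hP := mean_penalty_feasible x; rewrite -/g' in hP.
(* The direction has been replaced by its mean, so that [q] drops out. *)
have hq : dot (g + g') (xstar - q) + dot (g + g') (q - x) =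
    dot g (xstar - x) + dot g' (xstar - x).
  by rewrite -dotDl -dotDr addrA subrK.
rewrite /C; move: hq hP hF hS hG.
move: (\int[law]_xi noise xi) (\int[law]_xi noise' xi).
move: (dot (g + g') (xstar - q)) (dot (g + g') (q - x)).
move: (dot g (xstar - x)) (dot g' (xstar - x)).
move: (F x) (F xstar) (mean_penalty x) ((2 * al)^-1 * _) (sigma ^+ 2).
clear EN EN' ED; move=> *; lra.
Qed.

End stochastic_step.

(** * Jensen's inequality for the averaged iterates *)

Section averages.
Context {R : realType} {d : nat}.
Implicit Types (x : nat -> 'cV[R]_d) (phi : 'cV[R]_d -> R).

Definition average n x : 'cV[R]_d := n%:R^-1 *: \sum_(1 <= k < n.+1) x k.

(** One supporting affine function at the average suffices, since its linear parts sum to zero over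
    the points. It serves for [F], the mean penalty and the squared distance. *)
Lemma subgradient_average phi g n x : (0 < n)%N ->
  (forall y, phi (average n x) + dot g (y - average n x) <= phi y) ->
  phi (average n x) <= n%:R^-1 * \sum_(1 <= k < n.+1) phi (x k).
Proof.
move=> n0 H; have np : 0 < n%:R :> R by rewrite ltr0n.
rewrite -(ler_pM2l np) mulVKf ?gt_eqF//.
have -> : n%:R * phi (average n x) =
    \sum_(1 <= k < n.+1) (phi (average n x) + dot g (x k - average n x)).
  have sx : \sum_(1 <= k < n.+1) x k = n%:R *: average n x.
    by rewrite /average scalerA mulfV ?gt_eqF// scale1r.
  rewrite big_split/= -dot_sumr sumrB !sumr_const_nat subn1/= sx.
  by rewrite -(scaler_nat n (average n x)) subrr dot0r addr0 mulr_natl.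
by apply: ler_sum => k _; exact: H.
Qed.

Lemma sqdist_average n x z : (0 < n)%N ->
  2^-1 * enorm (average n x - z) ^+ 2 <=
  n%:R^-1 * \sum_(1 <= k < n.+1) (2^-1 * enorm (x k - z) ^+ 2).
Proof.
move=> n0.
apply: (subgradient_average (phi := fun y => 2^-1 * enorm (y - z) ^+ 2)
  (g := average n x - z)) => // y.
have -> : y - z = (average n x - z) + (y - average n x) by vector_ring.
move: (average n x - z) (y - average n x) => u v.
by have := dot_ge0 v; rewrite !enorm_sq !dotE (dotC v u); lra.
Qed.

(** For [h] there is no subgradient at hand, so Jensen's inequality is proved by induction, the last
    of [n + 2] points entering with weight [1 - t = 1 / (n + 2)]. *)
Lemma econvex_average (h : 'cV[R]_d -> \bar R) n x (r : nat -> R) :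
  econvex h -> (0 < n)%N ->
  (forall k, (1 <= k <= n)%N -> h (x k) = (r k)%:E) ->
  (h (average n x) <= (n%:R^-1 * \sum_(1 <= k < n.+1) r k)%:E)%E.
Proof.
move=> cvx; elim: n => // -[|n] IH _ H.
  by rewrite /average !big_nat1 invr1 scale1r mul1r H.
have {}IH : (h (average n.+1 x) <= (n.+1%:R^-1 * \sum_(1 <= k < n.+2) r
  k)%:E)%E.
  by apply: IH => // k /andP[k1 kn]; apply: H; rewrite k1 leqW.
have np : 0 < n.+1%:R :> R by rewrite ltr0n.
have n2 : 0 < n.+2%:R :> R by rewrite ltr0n.
pose t : R := n.+1%:R / n.+2%:R.
have t01 : 0 < t < 1.
  by rewrite divr_gt0//= ltr_pdivrMr// mul1r ltr_nat.
have t1 : 1 - t = n.+2%:R^-1.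
  rewrite /t -{1}(divff (lt0r_neq0 n2)) -mulrBl -natrB//.
  by rewrite subSnn mul1r.
have -> : average n.+2 x = t *: average n.+1 x + (1 - t) *: x n.+2.
  rewrite t1 /average big_nat_recr//= scalerDr scalerA; congr (_ *: _ + _).
  by rewrite /t mulrAC mulfV ?gt_eqF// mul1r.
apply: (le_trans (cvx _ _ _ t01)); rewrite (H n.+2) ?leqnn//.
apply: (@le_trans _ _ (t%:E * (n.+1%:R^-1 * \sum_(1 <= k < n.+2) r k)%:E
  + (1 - t)%:E * (r n.+2)%:E)%E).
  by rewrite leeD2r// lee_pmul2l ?lte_fin//; case/andP: t01.
rewrite -!EFinM -EFinD lee_fin [in leRHS]big_nat_recr//= t1 mulrDr /t.
by rewrite mulrA [_ / _ / _]mulrAC mulfV ?gt_eqF// mul1r.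
Qed.

End averages.

(** * One epoch in expectation *)

Section epoch.
Context {R : realType} {dX : measure_display} {Xi : measurableType dX}.
Context (law : probability Xi R) {d m : nat}.
Context (f : 'cV[R]_d -> Xi -> R) (h : 'cV[R]_d -> \bar R).
Context (A : Xi -> 'M[R]_(m, d)) (b : Xi -> set 'cV[R]_m).
Context (xstar : 'cV[R]_d) (a L mu sigma hstar al : R).
Hypothesis setting : sasc_setting law f h A b xstar a L mu sigma hstar.
Hypotheses (al0 : 0 < al) (alL : al * L <= 3 / 4).
Local Notation F := (mean_fun law f).
Local Notation be := (4 * al * a ^+ 2).
Local Notation G := (mean_penalty law A b a al).
Local Notation gap := (smoothed_gap law f h A b xstar a hstar al).
Local Notation step := (sasc_step f h A b a al).

Lemma gap_average n (x : nat -> 'cV[R]_d) : (0 < n)%N ->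
  (forall k, (1 <= k <= n)%N -> exists r, h (x k) = r%:E) ->
  (gap (average n x) <= (n%:R^-1)%:E * \sum_(1 <= k < n.+1) gap (x k))%E.
Proof.
move=> n0 hfin; pose r k := fine (h (x k)).
have hr k : (1 <= k <= n)%N -> h (x k) = (r k)%:E.
  by move=> /hfin [s hs]; rewrite /r hs.
have hh := econvex_average (reg_econvex setting) n0 hr.
have np : 0 < n%:R :> R by rewrite ltr0n.
have hF : F (average n x) <= n%:R^-1 * \sum_(1 <= k < n.+1) F (x k).
  apply: (subgradient_average (g := grad F (average n x))) => // y.
  apply: convex_grad_le; first by case: (mean_fun_smooth setting).
  by move=> t; exact: (mean_fun_convex setting).
have hG : G (average n x) <= n%:R^-1 * \sum_(1 <= k < n.+1) G (x k).
  apply: (subgradient_average (g := mean_penalty_grad law A b a al (average n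
    x))) => // y.
  exact: (mean_penalty_lower setting al0).
have -> : (\sum_(1 <= k < n.+1) gap (x k) =
    (\sum_(1 <= k < n.+1) (F (x k) + G (x k) - (F xstar + hstar) + r k))%:E)%E.
  rewrite -sumEFin; apply: eq_big_nat => k kn.
  by rewrite /smoothed_gap hr.
rewrite /smoothed_gap; apply: (le_trans (leeD2l _ hh)).
rewrite -EFinM -EFinD lee_fin big_split/= sumrB big_split/= sumr_const_nat
  subn1/=.
rewrite !mulrDr mulrN -(mulr_natl (F xstar + hstar)) mulKf ?gt_eqF//.
by move: (F _) (G _) hF hG => Fx Gx hF hG; lra.
Qed.

(** The integrand of [sasc_step_bound], kept as a single nonnegative function of iterate and sample
    because this is what independence is applied to. *)
Definition step_value x xi : \bar R := (gap (step x xi)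
  + ((2 * al)^-1 * enorm (step x xi - xstar) ^+ 2)%:E)%E.

Lemma step_value_ge0 x xi : (0 <= step_value x xi)%E.
Proof.
apply: adde_ge0; first exact: (smoothed_gap_ge0 setting al0).
by rewrite lee_fin mulr_ge0 ?sqr_ge0// invr_ge0 mulr_ge0// ltW.
Qed.

Lemma measurable_step_value dT (T : measurableType dT) (X : T -> 'cV[R]_d)
    (v : T -> Xi) : random_vector X -> measurable_fun setT v ->
  measurable_fun setT (fun t => step_value (X t) (v t)).
Proof.
move=> mX mv; have mS := random_vector_sasc_step setting al0 alL mX mv.
apply: emeasurable_funD; first exact: (measurable_smoothed_gap setting al0).
apply/measurable_EFinP; apply: measurable_funM; first exact: measurable_cst.
by apply/measurable_enorm_sq/random_vectorB => //; exact: random_vector_cst.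
Qed.

Context {dO : measure_display} {Omega : measurableType dO}.
Context (Pr : probability Omega R).
Context (u : nat -> Omega -> Xi) (x0 : Omega -> 'cV[R]_d) (n : nat).
Hypothesis n0 : (0 < n)%N.
Let it k w := inner_iterate f h A b al be (fun j => u j w) (x0 w) k.
Hypothesis mit : forall k, (k <= n)%N -> random_vector (it k).

(** Independence in integrated form: the fresh sample may be integrated separately. It is discharged
    by [integral_fresh_draw]. *)
Hypothesis indep : forall k, (k < n)%N ->
  (\int[Pr]_w step_value (it k w) (u k.+1 w) =
   \int[Pr]_w \int[law]_xi step_value (it k w) xi)%E.

Let p k := (\int[Pr]_w gap (it k w))%E.
Let e k := (\int[Pr]_w (2^-1 * enorm (it k w - xstar) ^+ 2)%:E)%E.

Let gap0 x : (0 <= gap x)%E.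
Proof. exact: (smoothed_gap_ge0 setting al0). Qed.

Let mgap k : (k <= n)%N -> measurable_fun setT (fun w => gap (it k w)).
Proof. by move=> kn; apply: (measurable_smoothed_gap setting al0); exact: mit.
  Qed.

Let mdist k : (k <= n)%N ->
  measurable_fun setT (fun w => (2^-1 * enorm (it k w - xstar) ^+ 2)%:E).
Proof.
move=> kn; apply/measurable_EFinP; apply: measurable_funM => //.
by apply: measurable_enorm_sq; apply: random_vectorB; [exact: mit|exact:
  random_vector_cst].
Qed.

Let e_ge0 k : (0 <= e k)%E.
Proof. by apply: integral_ge0 => w _; rewrite lee_fin mulr_ge0 ?sqr_ge0. Qed.

Let p_ge0 k : (0 <= p k)%E.
Proof. by apply: integral_ge0 => w _. Qed.

Lemma inner_recursion k : (k < n)%N ->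
  (p k.+1 + al^-1%:E * e k.+1 <= al^-1%:E * e k + (2 * al * sigma ^+ 2)%:E)%E.
Proof.
move=> kn; have ia0 : (0 <= al^-1%:E)%E by rewrite lee_fin invr_ge0 ltW.
have aE x : ((2 * al)^-1 * enorm x ^+ 2)%:E =
    (al^-1%:E * (2^-1 * enorm (x : 'cV[R]_d) ^+ 2)%:E)%E.
  rewrite -EFinM; congr (_%:E); move: (enorm x ^+ 2) => c.
  by field; rewrite gt_eqF.
rewrite /p /e -!ge0_integralZl//; last 4 first.
- by apply: mdist; exact: ltnW.
- by move=> w _; rewrite lee_fin mulr_ge0 ?sqr_ge0.
- exact: mdist.
- by move=> w _; rewrite lee_fin mulr_ge0 ?sqr_ge0.
rewrite -ge0_integralD//; last 3 first.
- exact: mgap.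
- by move=> w _; rewrite mule_ge0// lee_fin mulr_ge0 ?sqr_ge0.
- by apply: measurable_funeM; exact: mdist.
have -> : (\int[Pr]_w (gap (it k.+1 w) +
    al^-1%:E * (2^-1 * enorm (it k.+1 w - xstar) ^+ 2)%:E) =
    \int[Pr]_w step_value (it k w) (u k.+1 w))%E.
  by apply: eq_integral => w _; rewrite -aE.
rewrite indep// -(integral_prob_cst Pr (2 * al * sigma ^+ 2)%:E).
rewrite -ge0_integralD//; last 3 first.
- by move=> w _; rewrite mule_ge0// lee_fin mulr_ge0 ?sqr_ge0.
- by apply: measurable_funeM; apply: mdist; exact: ltnW.
- by move=> w _; rewrite lee_fin mulr_ge0 ?sqr_ge0// mulr_ge0// ltW.
apply: ge0_le_integral => //.
- move=> w _; apply: integral_ge0 => xi _; rewrite adde_ge0//.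
  by rewrite lee_fin mulr_ge0 ?sqr_ge0// invr_ge0 mulr_ge0// ltW.
- apply: (measurable_fun_fubini_tonelli_F
    (fun z : Omega * Xi => step_value (it k z.1) z.2)) => [|z].
    apply: measurable_step_value => //.
    by apply: random_vector_comp => //; apply: mit; exact: ltnW.
  exact: step_value_ge0.
- apply: emeasurable_funD; last exact: measurable_cst.
  by apply: measurable_funeM; apply: mdist; exact: ltnW.
move=> w _; rewrite -aE -EFinD.
exact: (sasc_step_bound setting al0 alL).
Qed.

Lemma inner_growth k : (k <= n)%N -> (mu%:E * e k <= p k)%E.
Proof.
move=> kn; have mu0 := growth_gt0 setting.
rewrite /e -ge0_integralZl//; last 3 first.
- exact: mdist.
- by move=> w _; rewrite lee_fin mulr_ge0 ?sqr_ge0.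
- by rewrite lee_fin ltW.
apply: ge0_le_integral => //.
- by move=> w _; rewrite mule_ge0 ?lee_fin ?(ltW mu0)// mulr_ge0 ?sqr_ge0.
- by apply: measurable_funeM; exact: mdist.
- exact: mgap.
move=> w _; have := growth setting (it k w).
have := mean_penalty_ge0 setting al0 (it k w).
rewrite /smoothed_gap; move: (enorm _) => c.
case: (h _) => [r||].
- by rewrite -EFinM -!EFinD !lee_fin; lra.
- by move=> _ _; rewrite addey// leey.
- by move=> _; rewrite addeNy leeNy_eq.
Qed.

(** Passes from extended to real numbers: the recursion carries finiteness along the epoch. [K]
    starts at the bound [E0] instead of the true value, so that bounds can be chained over epochs;
    the gap of the starting point may be infinite, whence [1 <= k] for growth. *)
Lemma epoch_sequences (E0 : R) : (e 0%N <= E0%:E)%E ->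
  exists P K : nat -> R, [/\ K 0%N = E0,
    forall k, 0 <= K k,
    forall k, (k < n)%N -> al * P k.+1 + K k.+1 <= K k + 2 * al ^+ 2 * sigma ^+
      2,
    forall k, (1 <= k <= n)%N -> mu * K k <= P k &
    (\int[Pr]_w gap (epoch_average f h A b al be n (fun j => u j w) (x0 w))
       <= (n%:R^-1 * \sum_(1 <= k < n.+1) P k)%:E)%E /\
    (\int[Pr]_w (2^-1 * enorm (epoch_average f h A b al be n (fun j => u j w)
      (x0 w)
       - xstar) ^+ 2)%:E <= (n%:R^-1 * \sum_(1 <= k < n.+1) K k)%:E)%E].
Proof.
move=> eE0.
have fin k : (k < n)%N -> e k \is a fin_num ->
    e k.+1 \is a fin_num /\ p k.+1 \is a fin_num.
  move=> kn ek; have := inner_recursion kn; rewrite -(fineK ek) -EFinM -EFinD.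
  move: (e_ge0 k.+1) (p_ge0 k.+1); move: (p k.+1) (e k.+1) => q r.
  case: q => [s||]//; case: r => [r||]// _ _.
  - by rewrite gt0_muley ?lte_fin ?invr_gt0// addey.
  - by rewrite gt0_muley ?lte_fin ?invr_gt0.
have efin k : (k <= n)%N -> e k \is a fin_num.
  elim: k => [_|k IH kn]; last by have [] := fin k kn (IH (ltnW kn)).
  rewrite ge0_fin_numE//; exact: le_lt_trans eE0 (ltry _).
have pfin k : (1 <= k <= n)%N -> p k \is a fin_num.
  by case: k => // k /= kn; have [] := fin k kn (efin k (ltnW kn)).
pose K k := if k == 0%N then E0 else fine (e k).
exists (fine \o p), K; split => //.
- move=> k; rewrite /K; case: eqP => // _; last exact: fine_ge0.
  by have := le_trans (e_ge0 0) eE0; rewrite lee_fin.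
- move=> k kn; have := inner_recursion kn.
  have eK : (e k <= (K k)%:E)%E.
    by rewrite /K; case: eqP => [->//|_]; rewrite fineK// efin// ltnW.
  have -> : K k.+1 = fine (e k.+1) by [].
  have ia0 : (0 <= al^-1%:E)%E by rewrite lee_fin invr_ge0 ltW.
  move=> /le_trans /(_ (leeD2r _ (lee_wpmul2l ia0 eK))).
  rewrite -(fineK (efin _ kn)) -(fineK (pfin k.+1 kn)) -!EFinM -!EFinD lee_fin.
  move=> /(ler_wpM2l (ltW al0)); rewrite /= !mulrDr !mulVKf ?gt_eqF//.
  by move: (fine _) (fine _) (K k) => *; lra.
- move=> k kn; have k0 : k != 0%N by rewrite -lt0n; case/andP: kn.
  have kn' : (k <= n)%N by case/andP: kn.
  rewrite /K (negbTE k0) -lee_fin EFinM fineK ?efin// fineK ?pfin//.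
  exact: inner_growth.
have ninv : (0 <= n%:R^-1%:E :> \bar R)%E by rewrite lee_fin invr_ge0.
(* Truncating the index makes every term measurable, as the lemmas on sums demand, without changing
   those that are averaged. *)
pose it' k w := it (minn k n) w.
have mit' k : random_vector (it' k) by exact: mit (geq_minr k n).
have itE k w : (1 <= k < n.+1)%N -> it' k w = it k w.
  by move=> /andP[_ kn]; rewrite /it' (minn_idPl _).
have avgE w : epoch_average f h A b al be n (fun j => u j w) (x0 w) =
    average n (fun k => it' k w).
  by congr (_ *: _); apply: eq_big_nat => k kn; rewrite itE.
have mavg : random_vector (fun w => average n (fun k => it' k w)).
  apply: (random_vectorZ (a := fun=> n%:R^-1)); first exact: measurable_cst.
  exact: random_vector_sum.
split.
  apply: (@le_trans _ _ (\int[Pr]_w (n%:R^-1%:E *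
      \sum_(1 <= k < n.+1) gap (it' k w)))%E).
    apply: ge0_le_integral => //.
    - under eq_fun do rewrite avgE.
      exact: (measurable_smoothed_gap setting al0).
    - apply: measurable_funeM; apply: emeasurable_sum => k.
      by apply: (measurable_smoothed_gap setting al0); exact: mit'.
    move=> w _; rewrite avgE; apply: gap_average => // -[//|k] kn.
    exists (fine (h (it' k.+1 w))); rewrite itE//.
    have [r hr] := sasc_step_fin setting al0 alL (it k w) (u k.+1 w).
    by rewrite -[it k.+1 w]/(step (it k w) (u k.+1 w)) hr.
  rewrite ge0_integralZl//; last 2 first.
  - apply: emeasurable_sum => k.
    by apply: (measurable_smoothed_gap setting al0); exact: mit'.
  - by move=> w _; apply: sume_ge0 => k _.
  rewrite ge0_integral_sum//; last first.
    by move=> k; apply: (measurable_smoothed_gap setting al0); exact: mit'.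
  rewrite EFinM -sumEFin lee_wpmul2l// le_eqVlt; apply/orP; left; apply/eqP.
  apply: eq_big_nat => k kn.
  have -> : ((fine \o p) k)%:E = p k := fineK (pfin k kn).
  by apply: eq_integral => w _; rewrite (itE k w kn).
have mdist' k : measurable_fun setT
    (fun w => (2^-1 * enorm (it' k w - xstar) ^+ 2)%:E).
  apply/measurable_EFinP; apply: measurable_funM => //.
  by apply/measurable_enorm_sq/random_vectorB; [exact: mit'|exact:
    random_vector_cst].
apply: (@le_trans _ _ (\int[Pr]_w (n%:R^-1%:E *
    \sum_(1 <= k < n.+1) (2^-1 * enorm (it' k w - xstar) ^+ 2)%:E))%E).
  apply: ge0_le_integral => //.
  - by move=> w _; rewrite lee_fin mulr_ge0 ?sqr_ge0.
  - under eq_fun do rewrite avgE.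
    apply/measurable_EFinP; apply: measurable_funM => //.
    by apply/measurable_enorm_sq/random_vectorB => //; exact: random_vector_cst.
  - by apply: measurable_funeM; apply: emeasurable_sum.
  move=> w _; rewrite avgE sumEFin -EFinM lee_fin.
  exact: (@sqdist_average R d n (fun k => it' k w)).
rewrite ge0_integralZl//; last 2 first.
- exact: emeasurable_sum.
- by move=> w _; apply: sume_ge0 => k _; rewrite lee_fin mulr_ge0 ?sqr_ge0.
rewrite ge0_integral_sum//; last first.
  by move=> k w _; rewrite lee_fin mulr_ge0 ?sqr_ge0.
rewrite EFinM -sumEFin lee_wpmul2l// le_eqVlt; apply/orP; left; apply/eqP.
apply: eq_big_nat => k kn; have [k0 kn'] := andP kn.
have -> : (K k)%:E = e k by rewrite /K gtn_eqF//; exact: fineK (efin k kn').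
by apply: eq_integral => w _; rewrite (itE k w kn).
Qed.

End epoch.

(** * Recursion over the epochs *)

Section rate.
Context {R : realType}.

Lemma bernoulli_ge (y : R) k : 0 <= y -> 1 + k%:R * y <= (1 + y) ^+ k.
Proof.
move=> y0; elim: k => [|k IH]; first by rewrite mul0r addr0 expr0.
rewrite exprS -natr1; apply: le_trans (ler_wpM2l _ IH); last by rewrite
  addr_ge0.
have k0 : 0 <= k%:R :> R by [].
by move: k%:R k0 => q q0; nra.
Qed.

(** This is [geometric_average] in its worst case [w = 2], [x = k + 1], where it reduces to
    [(1 + 2 / (k + 1)) ^ k <= k + 1]. The induction starts at [25 <= 27]. *)
Lemma expr_add3_le k : (2 <= k)%N ->
  (k%:R + 3) ^+ k <= (k%:R + 1) ^+ k.+1 :> R.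
Proof.
elim: k => // k IH; rewrite leq_eqVlt => /predU1P[<-/=|k2].
  by lra.
have {}IH := IH k2; have k1 : 1 <= k%:R :> R by rewrite ler1n ltnW.
rewrite -natr1.
have kE : k%:R = (k%:R + 1) - 1 :> R by rewrite addrK.
have E3 : k%:R + 3 = (k%:R + 1) + 2 :> R by rewrite -addrA; congr (_ + _); lra.
rewrite E3 in IH; have q1 : 2 <= k%:R + 1 :> R by lra.
move: (k%:R + 1 : R) q1 kE IH => q q1 kE IH.
have q0 : 0 < q by lra.
have qk : 0 < q ^+ k.+1 by rewrite exprn_gt0.
rewrite -(ler_pM2r qk) -exprMn.
have p0 : 0 < (q + 3) * q by rewrite mulr_gt0// addr_gt0.
apply: (@le_trans _ _ ((q + 1) ^+ k.+2 * (q + 2) ^+ k)); last first.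
  by rewrite ler_wpM2l// exprn_ge0// addr_ge0// ltW.
have -> : (q + 1) ^+ k.+2 * (q + 2) ^+ k = (q + 1) ^+ 2 * ((q + 1) * (q + 2))
  ^+ k.
  by rewrite exprMn mulrA -exprD add2n.
have y0 : 0 <= 2 / ((q + 3) * q) by rewrite divr_ge0// ltW.
(* The product [(q + 1) * (q + 2)] exceeds [(q + 3) * q] by 2; Bernoulli's inequality bounds the
   [k]-th power of this gain from below by a linear term. *)
have -> : (q + 1) * (q + 2) = (q + 3) * q * (1 + 2 / ((q + 3) * q)).
  by field; rewrite !gt_eqF ?addr_gt0.
rewrite exprSr [in leRHS]exprMn [leRHS]mulrCA ler_wpM2l ?exprn_ge0 ?(ltW p0)//.
apply: le_trans (ler_wpM2l (sqr_ge0 (q + 1)) (bernoulli_ge k y0)).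
rewrite kE -(ler_pM2r p0) -[leRHS]mulrA [(_ + _ * _) * _]mulrDl mul1r.
rewrite -[(_ - 1) * _ * _]mulrA divfK ?gt_eqF//.
nra.
Qed.

Lemma geometric_sum (t : R) n : 0 < t ->
  t * \sum_(1 <= k < n.+1) (1 + t)^-1 ^+ k = 1 - (1 + t)^-1 ^+ n.
Proof.
move=> t0; have t1 : 1 + t != 0 by rewrite gt_eqF// addr_gt0.
elim: n => [|n IH]; first by rewrite big_nil mulr0 expr0 subrr.
rewrite big_nat_recr//= mulrDr IH exprS.
by move: (_ ^+ n) => z; field.
Qed.

(* For [w <= 2] the geometric decay inside an epoch gains more than what is lost
   by rounding [x] down to [n]. *)
Lemma geometric_average (x w : R) n : (2 <= n)%N -> 0 < x -> x <= n.+1%:R ->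
  1 < w <= 2 ->
  \sum_(1 <= k < n.+1) (1 + w / x)^-1 ^+ k <= n%:R / w.
Proof.
move=> n2 x0 xn /andP[w1 w2]; have w0 : 0 < w by lra.
have n0 : 0 < n.+1%:R :> R by [].
pose t := w / n.+1%:R; have t0 : 0 < t by rewrite divr_gt0.
have tx : t <= w / x by rewrite ler_wpM2l ?(ltW w0)// lef_pV2.
apply: (@le_trans _ _ (\sum_(1 <= k < n.+1) (1 + t)^-1 ^+ k)).
  apply: ler_sum => k _; rewrite lerXn2r ?nnegrE ?invr_ge0//; try lra.
  by rewrite lef_pV2 ?posrE; lra.
rewrite -(ler_pM2l t0) geometric_sum//.
have -> : t * (n%:R / w) = n%:R / n.+1%:R.
  by rewrite /t mulrC mulrA divfK ?gt_eqF.
have -> : n%:R / n.+1%:R = 1 - n.+1%:R^-1 :> R.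
  apply: (mulIf (lt0r_neq0 n0)).
  by rewrite mulrBl mulVf ?lt0r_neq0// divfK ?lt0r_neq0// mul1r -natr1 addrK.
rewrite lerD2l lerN2.
have e3 := expr_add3_le n2.
have n3 : 0 < n%:R + 3 :> R by rewrite ltr_wpDl.
have n1 : 0 < n%:R + 1 :> R by rewrite ltr_wpDl.
apply: (@le_trans _ _ (((n%:R + 1) / (n%:R + 3)) ^+ n)).
  rewrite -natr1 expr_div_n ler_pdivlMr ?exprn_gt0//.
  by rewrite ler_pdivrMl// -exprS.
rewrite lerXn2r ?nnegrE ?invr_ge0 ?divr_ge0 ?(ltW n1) ?(ltW n3)//; first lra.
have t1 : 0 < 1 + t by lra.
rewrite -[leRHS]mul1r ler_pdivlMr//.
rewrite mulrAC ler_pdivrMr// mul1r /t -natr1.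
rewrite mulrDr mulr1 mulrCA divff ?gt_eqF//; lra.
Qed.

Lemma epoch_gap_average (n : nat) (al c : R) (P K : nat -> R) : 0 < al ->
  (0 < n)%N -> (forall k, 0 <= K k) ->
  (forall k, (k < n)%N -> al * P k.+1 + K k.+1 <= K k + c) ->
  n%:R^-1 * \sum_(1 <= k < n.+1) P k <= K 0%N / (al * n%:R) + c / al.
Proof.
move=> al0 n0 K0 H; have np : 0 < n%:R :> R by rewrite ltr0n.
have S j : (j <= n)%N ->
    al * \sum_(1 <= k < j.+1) P k + K j <= K 0%N + j%:R * c.
  elim: j => [_|j IH jn]; first by rewrite big_nil mulr0 mul0r; lra.
  rewrite big_nat_recr//= -natr1.
  by have := IH (ltnW jn); have := H _ jn; lra.
have := S n (leqnn n); have := K0 n; move=> h1 h2.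
rewrite -(ler_pM2l np) mulVKf ?gt_eqF// -(ler_pM2l al0).
have -> : al * (n%:R * (K 0%N / (al * n%:R) + c / al)) = K 0%N + n%:R * c.
  by field; rewrite !gt_eqF.
lra.
Qed.

(** For [2 < w] the recursion is telescoped, at the price of [x / n]. For [w <= 2] it is unrolled:
    the bound on [K j] decays geometrically towards [c * x / w], the fixed point of the recursion,
    and [geometric_average] sums the powers. *)
Lemma epoch_dist_average (n : nat) (x w c : R) (K : nat -> R) :
  1 < w -> (2 <= n)%N -> n%:R <= x -> x <= n.+1%:R -> 0 <= c ->
  (forall k, 0 <= K k) ->
  (forall k, (k < n)%N -> (1 + w / x) * K k.+1 <= K k + c) ->
  n%:R^-1 * \sum_(1 <= k < n.+1) K k <=
  (if w <= 2 then 1 else x / n%:R) * K 0%N / w + c * x / w.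
Proof.
move=> w1 n2 nx xn c0 K0 H; have w0 : 0 < w by lra.
have np : 0 < n%:R :> R by rewrite ltr0n ltnW.
have x0 : 0 < x by exact: lt_le_trans nx.
have t0 : 0 < w / x by rewrite divr_gt0.
case: ifP => w2; last first.
  have {}H k : (k < n)%N -> (w / x) * K k.+1 + K k.+1 <= K k + c.
    by move/H; rewrite mulrDl mul1r addrC.
  apply: le_trans (epoch_gap_average t0 (ltnW n2) K0 H) _.
  rewrite le_eqVlt; apply/orP; left; apply/eqP.
  by field; rewrite !gt_eqF.
pose q := (1 + w / x)^-1.
have q0 : 0 < q by rewrite invr_gt0 addr_gt0.
have qE : q * (1 + w / x) = 1 by rewrite mulVf// gt_eqF// addr_gt0.
have D j : (j <= n)%N -> K j <= q ^+ j * K 0%N + c * x / w.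
  elim: j => [_|j IH jn].
    by rewrite expr0 mul1r lerDl divr_ge0 ?mulr_ge0// ltW.
  have h1 := IH (ltnW jn).
  have h2 := ler_wpM2l (ltW q0) (le_trans (H _ jn) (lerD h1 (lexx c))).
  rewrite mulrA qE mul1r in h2; apply: (le_trans h2).
  have cE : c = w / x * (c * x / w) by field; rewrite !gt_eqF.
  move: (c * x / w) cE => Y ->.
  have -> : q * (q ^+ j * K 0%N + Y + w / x * Y) =
      q * q ^+ j * K 0%N + q * (1 + w / x) * Y by ring.
  by rewrite qE mul1r -exprS.
rewrite mul1r -(ler_pM2l np) mulVKf ?gt_eqF//.
apply: (@le_trans _ _ (\sum_(1 <= k < n.+1) (q ^+ k * K 0%N + c * x / w))).
  by rewrite !big_nat; apply: ler_sum => k /andP[_ kn]; exact: D.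
rewrite big_split/= -mulr_suml sumr_const_nat subn1/=.
rewrite -(mulr_natl (c * x / w)) mulrDr lerD2r.
rewrite [leRHS]mulrCA [leRHS]mulrC ler_wpM2r// geometric_average// w1.
exact: w2.
Qed.

Section restarts.
Context (w al0 s2 : R) (m0 : nat) (v : nat -> R).
Hypotheses (w1 : 1 < w) (al00 : 0 < al0) (m02 : (2 <= m0)%N) (s20 : 0 <= s2).

Let x l : R := m0%:R * w ^+ l.
Let n l := Num.truncn (x l).

Hypothesis v0 : forall l, 0 <= v l.
Hypothesis vS : forall l, v l.+1 <=
  (if w <= 2 then 1 else x l / (n l)%:R) * v l / w
  + 2 * (al0 * w ^- l) ^+ 2 * s2 * x l / w.

Let w0 : 0 < w. Proof. exact: lt_trans ltr01 w1. Qed.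
Let m0p : 0 < m0%:R :> R. Proof. by rewrite ltr0n ltnW. Qed.
Let m0m1 : 0 < m0%:R - 1 :> R. Proof. by rewrite subr_gt0 ltr1n. Qed.
Let x0 l : 0 < x l. Proof. by rewrite mulr_gt0// exprn_gt0. Qed.

Lemma epoch_length_ge l : (m0 <= n l)%N.
Proof.
have : 1 <= w ^+ l by rewrite exprn_ege1// ltW.
rewrite /n -[leqLHS](@natrK R m0) => w1l; apply: le_truncn.
by rewrite /x ler_peMr// ltW.
Qed.

Lemma epoch_length_le l : (n l)%:R <= x l.
Proof. by rewrite truncn_le// ltW. Qed.

Lemma epoch_length_gt l : x l < (n l).+1%:R.
Proof. exact: truncnS_gt. Qed.

Let np l : 0 < (n l)%:R :> R.
Proof. by rewrite ltr0n (leq_trans _ (epoch_length_ge l))// ltnW. Qed.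

Let ratio_le l : x l / (n l)%:R <= m0%:R / (m0%:R - 1).
Proof.
rewrite ler_pdivrMr// mulrAC ler_pdivlMr//.
have := epoch_length_gt l; rewrite -natr1 => h.
have h2 : m0%:R <= (n l)%:R :> R by rewrite ler_nat epoch_length_ge.
by move: (x l) ((n l)%:R : R) (m0%:R : R) h h2 m0p m0m1 => X N M *; nra.
Qed.

(** The noise of one epoch after the rescaling that defines [y]. Squared step sizes shrink like
    [w ^ (- 2 * l)] while epochs lengthen like [w ^ l], so that it no longer depends on [l]. *)
Let N := 2 * al0 ^+ 2 * m0%:R * s2.

Let N0 : 0 <= N. Proof. by rewrite !mulr_ge0// ?sqr_ge0// ltW. Qed.

Let y l := w ^+ l * v l.

Let yS l : y l.+1 <= (if w <= 2 then 1 else x l / (n l)%:R) * y l + N.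
Proof.
rewrite /y; have wl : 0 < w ^+ l.+1 by rewrite exprn_gt0.
have := ler_wpM2l (ltW wl) (vS l); move/le_trans; apply.
rewrite le_eqVlt; apply/orP; left; apply/eqP; rewrite mulrDr; congr (_ + _).
  rewrite exprS; move: (if _ then _ else _) (w ^+ l) (v l) => r z t.
  by field; rewrite gt_eqF.
rewrite /N /x exprS; have := exprn_gt0 l w0; move: (w ^+ l) => z z0.
by field; rewrite !gt_eqF.
Qed.

Let y_bound s :
  x s / (n s)%:R * y s <= m0%:R / (m0%:R - 1) * (v 0%N + s%:R * N).
Proof.
have y0 l : 0 <= y l by rewrite mulr_ge0// exprn_ge0// ltW.
have [w2|w2] := leP w 2.
  have H l : y l <= v 0%N + l%:R * N.
    elim: l => [|l IH]; first by rewrite /y expr0; lra.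
    by have := yS l; rewrite w2 -natr1; lra.
  apply: ler_pM => //; first by rewrite divr_ge0// ltW.
(* For [2 < w] the rounding losses [x l / n l] are telescoped through [u]. *)
pose u l : R := 1 - (1 - 2^-1 ^+ l) / m0%:R.
have iw l : 0 < 2^-1 ^+ l :> R by rewrite exprn_gt0// invr_gt0.
have iw1 l : 2^-1 ^+ l <= 1 :> R by rewrite exprn_ile1// ?invr_ge0//; lra.
have im : 0 < m0%:R^-1 :> R by rewrite invr_gt0.
have u1 l : u l <= 1.
  by rewrite /u lerBlDr lerDl divr_ge0 ?subr_ge0// ltW.
have ul l : 1 - m0%:R^-1 <= u l.
  by rewrite /u lerD2l lerN2 -[leRHS]mul1r ler_wpM2r// ?(ltW im)//.
have u0 l : 0 <= u l.
  apply: le_trans (ul l); rewrite subr_ge0 invf_le1//.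
  by rewrite ler1n ltnW.
(* Rounding removes less than 1 from [x l.+1], while the drop from [u l] to [u l.+1], times
   [x l.+1], is [(w / 2) ^+ l.+1], at least 1 because [2 < w]. *)
have cu l : x l.+1 / (n l.+1)%:R * u l.+1 <= u l.
  rewrite mulrAC ler_pdivrMr// [leRHS]mulrC.
  have h1 : x l.+1 - 1 <= (n l.+1)%:R.
    by have := epoch_length_gt l.+1; rewrite -natr1; lra.
  apply: le_trans (ler_wpM2r (u0 l) h1); rewrite mulrBl mul1r.
  have ud : u l - u l.+1 = 2^-1 ^+ l.+1 / m0%:R.
    by rewrite /u exprS; move: (_ ^+ l) => z; field; rewrite gt_eqF.
  suff : 1 <= x l.+1 * (u l - u l.+1) by have := u1 l; lra.
  have -> : x l.+1 * (u l - u l.+1) = (w / 2) ^+ l.+1.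
    rewrite ud /x expr_div_n exprVn.
    have := exprn_gt0 l.+1 (ltr0Sn R 1).
    move: (w ^+ l.+1) (2 ^+ l.+1) (m0%:R : R) m0p => p q M M0 q0.
    by field; rewrite !gt_eqF.
  by rewrite exprn_ege1//; lra.
have I l : x l / (n l)%:R * u l * y l <= v 0%N + l%:R * N.
  elim: l => [|l IH].
    rewrite /u /y /n /x !expr0 subrr mul0r subr0 !mulr1 natrK.
    by rewrite divff ?gt_eqF// !mul1r mul0r addr0.
  have hS := yS l; rewrite (lt_geF w2) in hS.
  apply: le_trans (ler_wpM2r (y0 l.+1) (cu l)) _.
  apply: le_trans (ler_wpM2l (u0 l) hS) _.
  have h2 : u l * N <= N by rewrite ler_piMl.
  have h3 : u l * (x l / (n l)%:R * y l) <= v 0%N + l%:R * N.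
    by apply: le_trans IH; rewrite mulrA [u l * _]mulrC.
  by rewrite mulrDr -natr1; lra.
have um : 0 < 1 - m0%:R^-1 :> R.
  by rewrite subr_gt0 invf_lt1// ltr1n.
have -> : m0%:R / (m0%:R - 1) = (1 - m0%:R^-1)^-1 :> R.
  by field; rewrite !gt_eqF.
rewrite ler_pdivlMl//; apply: le_trans (I s).
have r0 : 0 <= x s / (n s)%:R * y s by rewrite mulr_ge0// divr_ge0// ltW.
by rewrite [leRHS]mulrAC [leRHS]mulrC ler_wpM2r.
Qed.

Lemma total_epoch_length_le s :
  \sum_(0 <= l < s.+1) (n l)%:R <= x s * (w / (w - 1)) :> R.
Proof.
have w10 : 0 < w - 1 by rewrite subr_gt0.
apply: (@le_trans _ _ (\sum_(0 <= l < s.+1) x l)).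
  by apply: ler_sum => l _; exact: epoch_length_le.
have wE j : (w - 1) * \sum_(0 <= l < j) x l = x j - m0%:R.
  elim: j => [|j IH]; first by rewrite big_nil /x expr0; lra.
  by rewrite big_nat_recr//= mulrDr IH /x exprS; ring.
rewrite -(ler_pM2l w10) wE /x exprS.
have -> : (w - 1) * (m0%:R * w ^+ s * (w / (w - 1))) = m0%:R * (w * w ^+ s).
  by field; rewrite gt_eqF.
by rewrite gerBl.
Qed.

(** The total length is at most [w / (w - 1)] times [x s], and step size times [x s] is the constant
    [al0 * m0]; what remains is the rounding ratio times [y s], controlled by [y_bound]. The part
    linear in [s] later becomes the logarithm. *)
Lemma rate_bound s :
  (\sum_(0 <= l < s.+1) (n l)%:R) * (v s / (al0 * w ^- s * (n s)%:R)
    + 2 * (al0 * w ^- s) * s2) <=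
  w / (w - 1) * (m0%:R / (al0 * (m0%:R - 1))) * v 0%N
  + 2 * al0 * m0%:R * (w / (w - 1)) * s2
  + s%:R * (2 * m0%:R ^+ 2 * al0 * w / ((m0%:R - 1) * (w - 1)) * s2).
Proof.
have w10 : 0 < w - 1 by rewrite subr_gt0.
have M := total_epoch_length_le s.
have zs : 0 < w ^+ s by rewrite exprn_gt0.
have V0 : 0 <= v s / (al0 * w ^- s * (n s)%:R) + 2 * (al0 * w ^- s) * s2.
  by rewrite addr_ge0 ?divr_ge0 ?mulr_ge0// ?invr_ge0 ?ltW.
apply: (le_trans (ler_wpM2r V0 M)).
have -> : x s * (w / (w - 1)) * (v s / (al0 * w ^- s * (n s)%:R)
    + 2 * (al0 * w ^- s) * s2) =
    w / (w - 1) / al0 * (x s / (n s)%:R * y s)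
    + 2 * al0 * m0%:R * (w / (w - 1)) * s2.
  rewrite /y /x; move: (w ^+ s) zs ((n s)%:R : R) (np s) => z z0 q q0.
  by field; rewrite !gt_eqF.
have c0 : 0 <= w / (w - 1) / al0 by rewrite !divr_ge0// ltW.
apply: (le_trans (lerD (ler_wpM2l c0 (y_bound s)) (lexx _))).
rewrite le_eqVlt; apply/orP; left; apply/eqP; rewrite /N.
by field; rewrite !gt_eqF.
Qed.

End restarts.

End rate.

(** * Restarts *)

Section restarted.
Context {R : realType} {dX dO : measure_display}.
Context {Xi : measurableType dX} {Omega : measurableType dO}.
Context (law : probability Xi R) (Pr : probability Omega R) {d m : nat}.
Context (f : 'cV[R]_d -> Xi -> R) (h : 'cV[R]_d -> \bar R).
Context (A : Xi -> 'M[R]_(m, d)) (b : Xi -> set 'cV[R]_m).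
Context (xstar : 'cV[R]_d) (a L mu sigma hstar : R).
Hypothesis setting : sasc_setting law f h A b xstar a L mu sigma hstar.
Context (alpha : nat -> R) (len : nat -> nat) (x00 : 'cV[R]_d).
Hypothesis alpha0 : forall s, 0 < alpha s.
Hypothesis alphaL : forall s, alpha s * L <= 3 / 4.
Let beta s := 4 * alpha s * a ^+ 2.
Local Notation iterate s := (inner_iterate f h A b (alpha s) (beta s)).
Local Notation start v t :=
  (epoch_start f h A b alpha beta len (fun l k => v l k t) x00).

Section measurability.
Context {dT : measure_display} {T : measurableType dT}.

(** Only the draws up to step [k] are assumed measurable, so that [T] can also be [Omega] with the
    sigma-algebra of the past, for which later draws need not be. *)
Lemma random_vector_inner_iterate s (v : nat -> T -> Xi) (x0 : T -> 'cV[R]_d) k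
  :
  (forall j, (1 <= j <= k)%N -> measurable_fun setT (v j)) ->
  random_vector x0 ->
  random_vector (fun t => iterate s (fun j => v j t) (x0 t) k).
Proof.
move=> mv mx0; elim: k mv => // k IH mv.
apply: (random_vector_sasc_step setting (alpha0 s) (alphaL s)).
  by apply: IH => j /andP[j1 jk]; apply: mv; rewrite j1 leqW.
by apply: mv; rewrite /= leqnn.
Qed.

Lemma random_vector_epoch_average s (v : nat -> T -> Xi) (x0 : T -> 'cV[R]_d) n
  :
  (forall j, (1 <= j <= n)%N -> measurable_fun setT (v j)) ->
  random_vector x0 ->
  random_vector (fun t => epoch_average f h A b (alpha s) (beta s) n
    (fun j => v j t) (x0 t)).
Proof.
move=> mv mx0; apply: (random_vectorZ (a := fun=> n%:R^-1)).
  exact: measurable_cst.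
have mit k : random_vector (fun t => iterate s (fun j => v j t) (x0 t) (minn k
  n)).
  apply: random_vector_inner_iterate => // j /andP[j1 jk]; apply: mv.
  by rewrite j1 (leq_trans jk)// geq_minr.
have := random_vector_sum (index_iota 1 n.+1) mit; congr random_vector.
apply/funext => t; apply: eq_big_nat => k /andP[_ kn].
by rewrite (minn_idPl _).
Qed.

Lemma random_vector_epoch_start s (v : nat -> nat -> T -> Xi) :
  (forall l j, (l < s)%N -> (1 <= j <= len l)%N -> measurable_fun setT (v l j))
    ->
  random_vector (fun t => start v t s).
Proof.
elim: s => [_|s IH mv]; first exact: random_vector_cst.
apply: random_vector_epoch_average; first by move=> j jn; exact: mv.
by apply: IH => l j ls; apply: mv; exact: leqW.
Qed.

End measurability.

Context (draw : nat -> nat -> Omega -> Xi).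
Hypothesis mdraw : forall s k, measurable_fun setT (draw s k).
Hypothesis law_draw : forall s k, (1 <= k <= len s)%N ->
  forall B, measurable B -> Pr (draw s k @^-1` B) = law B.
Hypothesis indep : independent_on Pr
  [set sk : nat * nat | (1 <= sk.2 <= len sk.1)%N] (fun sk => draw sk.1 sk.2).
Hypothesis len0 : forall s, (0 < len s)%N.

Local Notation average s w :=
  (sasc_average f h A b alpha beta len (fun l k => draw l k w) x00 s).

Lemma random_vector_sasc_average s : random_vector (fun w => average s w).
Proof.
by apply: random_vector_epoch_average => //; exact: random_vector_epoch_start.
Qed.

(** The iterate is a function of the draws of earlier epochs and of the first [k] draws of the
    current one, indexed by [E], hence measurable for the past that they generate; the index
    [(s, k.+1)] lies outside [E]. *)
Lemma integral_fresh_draw s k : (k < len s)%N ->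
  let it w := iterate s (fun j => draw s j w) (start draw w s) k in
  (\int[Pr]_w step_value law f h A b xstar a hstar (alpha s) (it w) (draw s
    k.+1 w) =
   \int[Pr]_w \int[law]_xi step_value law f h A b xstar a hstar (alpha s) (it
     w) xi)%E.
Proof.
move=> ks it.
pose E := [set lj : nat * nat | (1 <= lj.2 <= len lj.1)%N /\
  ((lj.1 < s)%N \/ lj.1 = s /\ (lj.2 <= k)%N)].
pose O' := g_sigma_algebraType (past (fun sk : nat * nat => draw sk.1 sk.2) E).
have mE l j : E (l, j) -> measurable_fun [set: O'] (draw l j : O' -> Xi).
  exact: (@measurable_draw_past _ _ _ _ _ (fun sk : nat * nat => draw sk.1
    sk.2) E (l, j)).
have mit : random_vector (it : O' -> 'cV[R]_d).
  apply: (@random_vector_inner_iterate _ O').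
    move=> j /andP[j1 jk]; apply: mE; split => /=; last by right.
    by rewrite j1 (leq_trans jk)// ltnW.
  apply: (@random_vector_epoch_start _ O') => l j ls jl.
  by apply: mE; split => //; left.
apply: (@integral_draw _ _ _ _ _ Pr law _ _ (fun sk : nat * nat => draw sk.1
  sk.2)
  _ indep E (s, k.+1) (fun z => step_value law f h A b xstar a hstar (alpha s)
    (it z.1) z.2)) => //.
- by move=> [l j] [].
- move=> [_ /= []]; first by rewrite ltnn.
  by move=> [_]; rewrite ltnn.
- by move=> B mB; exact: law_draw.
- by move=> z; exact: (step_value_ge0 setting).
apply: (measurable_step_value setting) => //.
exact: (random_vector_comp _ mit).
Qed.

Lemma sasc_average_bound s (E0 : R) :
  (\int[Pr]_w (2^-1 * enorm (start draw w s - xstar) ^+ 2)%:E <= E0%:E)%E ->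
  exists P K : nat -> R, [/\ K 0%N = E0,
    forall k, 0 <= K k,
    forall k, (k < len s)%N ->
      alpha s * P k.+1 + K k.+1 <= K k + 2 * alpha s ^+ 2 * sigma ^+ 2,
    forall k, (1 <= k <= len s)%N -> mu * K k <= P k &
    (\int[Pr]_w smoothed_gap law f h A b xstar a hstar (alpha s) (average s w)
       <= ((len s)%:R^-1 * \sum_(1 <= k < (len s).+1) P k)%:E)%E /\
    (\int[Pr]_w (2^-1 * enorm (average s w - xstar) ^+ 2)%:E
       <= ((len s)%:R^-1 * \sum_(1 <= k < (len s).+1) K k)%:E)%E].
Proof.
apply: (epoch_sequences setting (alpha0 s) (alphaL s) (len0 s)).
- move=> k ks; apply: random_vector_inner_iterate => //.
  exact: random_vector_epoch_start.
- by move=> k ks; exact: integral_fresh_draw.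
Qed.

End restarted.

(** * Rates for the prescribed step sizes and epoch lengths *)

Section convergence_rate.
Context {R : realType} {dX dO : measure_display}.
Context {Xi : measurableType dX} {Omega : measurableType dO}.
Context (law : probability Xi R) (Pr : probability Omega R) {d m : nat}.
Context (f : 'cV[R]_d -> Xi -> R) (h : 'cV[R]_d -> \bar R).
Context (A : Xi -> 'M[R]_(m, d)) (b : Xi -> set 'cV[R]_m).
Context (xstar : 'cV[R]_d) (a L mu sigma hstar : R).
Hypothesis setting : sasc_setting law f h A b xstar a L mu sigma hstar.
Context (omega alpha0 : R) (m0 : nat) (x00 : 'cV[R]_d).
Context (draw : nat -> nat -> Omega -> Xi).
Hypotheses (omega1 : 1 < omega) (alpha00 : 0 < alpha0).
Hypotheses (alpha0L : alpha0 * L <= 3 / 4) (m02 : (2 <= m0)%N).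
Hypothesis m0_ge : omega / (mu * alpha0) <= m0%:R.
Hypothesis L0 : 0 < L.

Let len s := Num.truncn (m0%:R * omega ^+ s).
Let alpha s := alpha0 * omega ^- s.
Let beta s := 4 * alpha s * a ^+ 2.
Let M s : R := \sum_(0 <= l < s.+1) (len l)%:R.
Let xbar s w :=
  sasc_average f h A b alpha beta len (fun l k => draw l k w) x00 s.

Hypothesis mdraw : forall s k, measurable_fun setT (draw s k).
Hypothesis law_draw : forall s k, (1 <= k <= len s)%N ->
  forall B, measurable B -> Pr (draw s k @^-1` B) = law B.
Hypothesis indep : independent_on Pr
  [set sk : nat * nat | (1 <= sk.2 <= len sk.1)%N] (fun sk => draw sk.1 sk.2).

Let w0 : 0 < omega. Proof. exact: lt_trans ltr01 omega1. Qed.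
Let mu0 : 0 < mu. Proof. exact: growth_gt0 setting. Qed.
Let m0p : 0 < m0%:R :> R. Proof. by rewrite ltr0n ltnW. Qed.

Lemma step_size_gt0 s : 0 < alpha s.
Proof. by rewrite mulr_gt0// invr_gt0 exprn_gt0. Qed.

Lemma step_size_le s : alpha s * L <= 3 / 4.
Proof.
apply: le_trans alpha0L; rewrite ler_wpM2r ?(ltW L0)// /alpha.
by rewrite ler_piMr ?(ltW alpha00)// invf_le1 ?exprn_gt0// exprn_ege1// ltW.
Qed.

Let len0 s : (0 < len s)%N.
Proof. exact: leq_trans (ltnW m02) (epoch_length_ge m0 omega1 s). Qed.

Lemma random_vector_xbar s : random_vector (xbar s).
Proof.
exact: (random_vector_sasc_average setting len x00 step_size_gt0 step_size_le
  mdraw).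
Qed.

(** Unrolls [epoch_dist_average] over the epochs, with [x = m0 * omega ^ l] and the noise of one
    inner step as [c]. *)
Fixpoint dist_bound s : R := if s is l.+1 then
    (if omega <= 2 then 1 else m0%:R * omega ^+ l / (len l)%:R) * dist_bound l
      / omega
    + 2 * alpha l ^+ 2 * sigma ^+ 2 * (m0%:R * omega ^+ l) / omega
  else 2^-1 * enorm (x00 - xstar) ^+ 2.

Let dist_bound_ge0 s : 0 <= dist_bound s.
Proof.
elim: s => [|s IH] /=; first by rewrite mulr_ge0 ?sqr_ge0.
rewrite addr_ge0// divr_ge0 ?(ltW w0)// mulr_ge0//.
- by case: ifP => // _; rewrite divr_ge0// mulr_ge0// exprn_ge0// ltW.
- by rewrite mulr_ge0 ?sqr_ge0// mulr_ge0// sqr_ge0.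
- by rewrite mulr_ge0// exprn_ge0// ltW.
Qed.

(** The hypothesis on [m0] enters here: [alpha s * mu] is at least [omega / (m0 * omega ^ s)], so
    growth converts the gap into extra contraction. *)
Let decay s (P K : nat -> R) :
  (forall k, (k < len s)%N ->
     alpha s * P k.+1 + K k.+1 <= K k + 2 * alpha s ^+ 2 * sigma ^+ 2) ->
  (forall k, (1 <= k <= len s)%N -> mu * K k <= P k) ->
  (forall k, 0 <= K k) ->
  forall k, (k < len s)%N -> (1 + omega / (m0%:R * omega ^+ s)) * K k.+1 <=
    K k + 2 * alpha s ^+ 2 * sigma ^+ 2.
Proof.
move=> H HP K0 k ks; apply: le_trans (H k ks); rewrite mulrDl mul1r addrC.
rewrite lerD2r; apply: le_trans (ler_wpM2l (ltW (step_size_gt0 s)) (HP k.+1 _));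
  last by rewrite ks.
rewrite mulrA ler_wpM2r//.
have zs : 0 < omega ^+ s by rewrite exprn_gt0.
rewrite ler_pdivrMr ?mulr_gt0//.
have -> : alpha s * mu * (m0%:R * omega ^+ s) = m0%:R * (mu * alpha0).
  by rewrite /alpha; move: (omega ^+ s) zs => z z0; field; rewrite gt_eqF.
by rewrite -ler_pdivrMr// mulr_gt0.
Qed.

Lemma start_dist_bound s :
  (\int[Pr]_w (2^-1 * enorm (epoch_start f h A b alpha beta len
     (fun l k => draw l k w) x00 s - xstar) ^+ 2)%:E <= (dist_bound s)%:E)%E.
Proof.
elim: s => [|s IH]; first by rewrite /= integral_prob_cst.
have [P [K [K0 Kge0 H HP [_ HK]]]] := sasc_average_bound setting step_size_gt0
  step_size_le mdraw law_draw indep len0 IH.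
apply: le_trans HK _; rewrite lee_fin.
have c0 : 0 <= 2 * alpha s ^+ 2 * sigma ^+ 2.
  by rewrite mulr_ge0 ?sqr_ge0// mulr_ge0// sqr_ge0.
apply: le_trans (epoch_dist_average omega1 _ _ _ c0 Kge0 (decay H HP Kge0)) _.
- exact: leq_trans m02 (epoch_length_ge m0 omega1 s).
- exact: epoch_length_le.
- exact/ltW/epoch_length_gt.
by rewrite K0.
Qed.

Lemma gap_bound s :
  (\int[Pr]_w smoothed_gap law f h A b xstar a hstar (alpha s) (xbar s w)
   <= (dist_bound s / (alpha s * (len s)%:R) + 2 * alpha s * sigma ^+ 2)%:E)%E.
Proof.
have [P [K [K0 Kge0 H HP [HG _]]]] := sasc_average_bound setting step_size_gt0
  step_size_le mdraw law_draw indep len0 (start_dist_bound s).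
apply: le_trans HG _; rewrite lee_fin.
apply: le_trans (epoch_gap_average (step_size_gt0 s) (len0 s) Kge0 H) _.
rewrite K0 lerD2l le_eqVlt; apply/orP; left; apply/eqP.
by field; rewrite gt_eqF// step_size_gt0.
Qed.

(** Rounding the last epoch loses less than 1, which the first epoch repays. Hence
    [omega ^ s <= M s / m0], and [s] is at most the logarithm in the claim. *)
Lemma total_length_ge s : m0%:R * omega ^+ s <= M s.
Proof.
rewrite /M; case: s => [|s].
  by rewrite big_nat1 expr0 mulr1 /len expr0 mulr1 natrK.
rewrite big_nat_recr//= big_nat_recl//=.
have := epoch_length_gt omega m0 s.+1.
rewrite -natr1 -/(len _) => h1.
have h2 : 1 <= (len 0)%:R :> R by rewrite ler1n.
have h3 : 0 <= \sum_(0 <= i < s) (len i.+1)%:R :> R by apply: sumr_ge0.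
lra.
Qed.

Lemma total_length_gt0 s : 0 < M s.
Proof. by apply: lt_le_trans (total_length_ge s); rewrite mulr_gt0// exprn_gt0.
  Qed.

Lemma epochs_le_log s : s%:R <= ln (M s / m0%:R) / ln omega.
Proof.
rewrite ler_pdivlMr ?ln_gt0// mulr_natl -lnXn//.
rewrite ler_ln ?posrE ?exprn_gt0 ?divr_gt0 ?total_length_gt0//.
by rewrite ler_pdivlMr// mulrC total_length_ge.
Qed.

(** [y] is any nonnegative supplement to [sigma ^ 2]; the theorem takes for it the term in the norm
    of the dual solution. *)
Lemma smoothed_gap_rate s (y : R) : 0 <= y ->
  (\int[Pr]_w smoothed_gap law f h A b xstar a hstar (alpha s) (xbar s w)
   <= ((M s)^-1 * (omega / (omega - 1) * (m0%:R / (alpha0 * (m0%:R - 1)))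
              * (2^-1 * enorm (x00 - xstar) ^+ 2)
            + 2 * alpha0 * m0%:R * (omega / (omega - 1)) * sigma ^+ 2
     + ln (M s / m0%:R) / ln omega *
       (2 * m0%:R ^+ 2 * alpha0 * omega / ((m0%:R - 1) * (omega - 1))
            * (y + sigma ^+ 2))))%:E)%E.
Proof.
move=> y0; apply: le_trans (gap_bound s) _; rewrite lee_fin.
rewrite -(ler_pM2l (total_length_gt0 s)) mulVKf ?gt_eqF ?total_length_gt0//.
have vS l : dist_bound l.+1 <=
    (if omega <= 2 then 1 else m0%:R * omega ^+ l / (len l)%:R) * dist_bound l
      / omega
    + 2 * (alpha0 * omega ^- l) ^+ 2 * sigma ^+ 2 * (m0%:R * omega ^+ l) /
      omega.
  by [].
apply: le_trans (rate_bound omega1 alpha00 m02 (sqr_ge0 sigma) dist_bound_ge0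
  vS s) _.
rewrite lerD2l.
have C0 : 0 <= 2 * m0%:R ^+ 2 * alpha0 * omega / ((m0%:R - 1) * (omega - 1)).
  rewrite divr_ge0//.
    by rewrite !mulr_ge0// ltW.
  by rewrite mulr_ge0 ?subr_ge0 ?ler1n ?(ltnW m02) ?(ltW omega1).
apply: ler_pM => //.
- by rewrite mulr_ge0// sqr_ge0.
- exact: epochs_le_log.
by rewrite ler_wpM2l// lerDr.
Qed.

Lemma total_length_le s : M s <= m0%:R * omega ^+ s * (omega / (omega - 1)).
Proof. exact: total_epoch_length_le. Qed.

End convergence_rate.

(** * From the gap to the three claims *)

Lemma sqrte_le {R : realType} (x : \bar R) (c e : R) :
  (x <= c%:E)%E -> Num.sqrt c <= e -> (sqrte x <= e%:E)%E.
Proof.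
move=> xc ce; have e0 : 0 <= e by apply: le_trans ce; exact: sqrtr_ge0.
case: x xc => [r|/=|_].
- by rewrite /= !lee_fin => rc; apply: le_trans ce; exact: ler_wsqrtr.
- by rewrite leye_eq.
- by rewrite /= lee_fin.
Qed.

Lemma convex_function_line {R : realType} n (F : 'cV[R]_n -> R) x y t :
  convex_function setT F -> 0 < t < 1 ->
  F (x + t *: (y - x)) <= F x + t * (F y - F x).
Proof.
move=> cvxF /andP[t0 t1].
have := cvxF (Itv01 (ltW t0) (ltW t1)) y x (in_setT _) (in_setT _).
have -> : x + t *: (y - x) = t *: y + (1 - t) *: x by vector_ring.
move=> /le_trans; apply.
have -> : F x + t * (F y - F x) = t * F y + (1 - t) * F x by ring.
by [].
Qed.

Theorem theorem3p3 (R : realType) (dX dO : measure_display)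
  (Xi : measurableType dX) (law : probability Xi R)
  (Omega : measurableType dO) (Pr : probability Omega R)
  (d m : nat)
  (f : 'cV[R]_d -> Xi -> R) (h : 'cV[R]_d -> \bar R)
  (A : Xi -> 'M[R]_(m, d)) (b : Xi -> set 'cV[R]_m)
  (xstar : 'cV[R]_d) (ystar : Xi -> 'cV[R]_m)
  (L mu sigma omega alpha0 : R) (m0 : nat) (x00 : 'cV[R]_d)
  (draw : nat -> nat -> {RV Pr >-> Xi}) :
  let F := mean_fun law f in
  let P := objective law f h in
  let a := normA A in
  (* integer part of a nonnegative real *)
  let len s := Num.truncn (m0%:R * omega ^+ s) in
  let alpha s := alpha0 * omega ^- s in
  let beta s := 4 * alpha s * a ^+ 2 in
  let M s : R := \sum_(0 <= l < s.+1) (len l)%:R in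
  let xbar s w :=
    sasc_average f h A b alpha beta len (fun l k => draw l k w) x00 s in
  let y2 := L2norm law ystar in
  let D1 := omega / (omega - 1) * (m0%:R / (alpha0 * (m0%:R - 1)))
              * (2^-1 * enorm (x00 - xstar) ^+ 2)
            + 2 * alpha0 * m0%:R * (omega / (omega - 1)) * sigma ^+ 2 in
  let D2 := 2 * m0%:R ^+ 2 * alpha0 * omega / ((m0%:R - 1) * (omega - 1))
            * (a ^+ 2 * y2 ^+ 2 + sigma ^+ 2) in
  let D3 := 4 * alpha0 * m0%:R * a ^+ 2 * (omega / (omega - 1)) in
  let D s := D1 + ln (M s / m0%:R) / ln omega * D2 in
  (* standing assumptions on the problem *)
  (forall xi, convex_function setT (f ^~ xi)) ->
  (forall xi x, differentiable (f ^~ xi) x) ->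
  (forall x, law.-integrable setT (fun xi => (f x xi)%:E)) ->
  (forall x i, law.-integrable setT (fun xi => (grad (f ^~ xi) x i 0)%:E)) ->
  (forall x i, \int[law]_xi (grad (f ^~ xi) x i 0) = grad F x i 0) ->
  proper_fun h -> lower_semicontinuous h -> econvex h ->
  random_matrix A ->
  has_ubound (range (fun xi => opnorm (A xi))) -> 0 < a ->
  random_closed_set b ->
  (forall xi, convex_set (b xi)) -> (forall xi, b xi !=set0) ->
  saddle_point law f h A b xstar ystar ->
  (* the samples used by the algorithm are i.i.d. with law [law] *)
  (forall s k, (1 <= k <= len s)%N ->
     forall B, measurable B -> distribution Pr (draw s k) B = law B) ->
  independent_on Pr [set sk : nat * nat | (1 <= sk.2 <= len sk.1)%N]
    (fun sk => draw sk.1 sk.2) ->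
  (* assumptions of the theorem *)
  convex_function setT F ->
  0 < L -> smooth L F ->
  0 < mu ->
  (forall x, (P xstar + (mu / 2 * enorm (x - xstar) ^+ 2)%:E <= P x)%E) ->
  (forall x, (\int[law]_xi (enorm (grad (f ^~ xi) x - grad F x) ^+ 2)%:E
              <= (sigma ^+ 2)%:E)%E) ->
  1 < omega ->
  0 < alpha0 -> alpha0 <= 3 / (4 * L) ->
  (2 <= m0)%N -> omega / (mu * alpha0) <= m0%:R ->
  forall s,
    [/\ (\int[Pr]_w (P (xbar s w) - P xstar) <= ((M s)^-1 * D s)%:E)%E,
        ((- (2 * D3 / M s * y2 ^+ 2) - (M s)^-1 * D s)%:E
           <= \int[Pr]_w (P (xbar s w) - P xstar))%E
      & (sqrte (\int[(Pr \x law)%E]_z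
                  (set_dist (A z.2 *m xbar s z.1) (b z.2) ^+ 2)%:E)
         <= ((M s)^-1 * (2 * D3 * y2
                         + 2 * Num.sqrt D3 * Num.sqrt (D s)))%:E)%E].
Proof.
move=> F P a len alpha beta M xbar y2 D1 D2 D3 D.
move=> _ df intf intdf gradF prh lsch cvxh mA ubA a0 rb cvb b0 saddle lawd
  indep.
move=> cvxF L0 smF mu0 rsc var w1 al00 al0L m02 m0ge s.
have [hstar hxs] := saddle_point_fin prh saddle.
have setting : sasc_setting law f h A b xstar a L mu sigma hstar.
  split => //.
  - move=> xi x; apply: (le_trans (enorm_mulmx _ _)).
    rewrite ler_wpM2r ?enorm_ge0//.
    by apply: ub_le_sup => //; exists xi.
  - exact: (saddle_point_feasible prh mA rb cvb b0 saddle).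
  - by move=> x y t; exact: convex_function_line.
  - by move=> x; have := rsc x; rewrite /P /objective hxs -EFinD.
have aL : alpha0 * L <= 3 / 4.
  by rewrite -ler_pdivlMr// -mulrA -invfM.
have mdraw l k : measurable_fun setT (draw l k) by [].
have lawd' l k : (1 <= k <= len l)%N ->
    forall B, measurable B -> Pr (draw l k @^-1` B) = law B := lawd l k.
have y0 : 0 <= a ^+ 2 * y2 ^+ 2 by rewrite mulr_ge0 ?sqr_ge0.
have HG := smoothed_gap_rate setting x00 w1 al00 aL m02 m0ge L0 mdraw lawd'
  indep s y0.
rewrite -/(D s) in HG.
have M0 : 0 < M s := total_length_gt0 w1 m02 s.
have al_s : 0 < alpha s := step_size_gt0 w1 al00 s.
pose gap x := smoothed_gap law f h A b xstar a hstar (alpha s) x.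
have gap0 x : (0 <= gap x)%E := smoothed_gap_ge0 setting al_s x.
have mx : random_vector (xbar s).
  exact: (random_vector_xbar setting m0 x00 w1 al00 aL L0 mdraw).
have gapE x : gap x =
    ((mean_fun law f x + mean_penalty law A b a (alpha s) x
      - (mean_fun law f xstar + hstar))%:E + h x)%E by [].
have G0 x : 0 <= mean_penalty law A b a (alpha s) x :=
  mean_penalty_ge0 setting al_s x.
have PE x : (P x - P xstar =
    (mean_fun law f x - (mean_fun law f xstar + hstar))%:E + h x)%E.
  rewrite /P /objective hxs; case: (h x) => [r||]//.
  by rewrite -!EFinD; congr (_%:E); ring.
have Pgap x : (P x - P xstar <= gap x)%E.
  rewrite PE gapE leeD2r// lee_fin; have := G0 x; lra.
have P0 x : (0 <= P x - P xstar)%E.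
  have := rsc x; rewrite /P /objective hxs -EFinD.
  have e0 : 0 <= mu / 2 * enorm (x - xstar) ^+ 2.
    by rewrite mulr_ge0 ?sqr_ge0// divr_ge0// ltW.
  move: e0; move: (mu / 2 * _) => e0 e00.
  case: (h x) => [r||].
  - by rewrite -!EFinD !lee_fin; lra.
  - by rewrite addey// addye// leey.
  - by rewrite addeNy leeNy_eq.
have Ggap x : ((mean_penalty law A b a (alpha s) x)%:E <= gap x)%E.
  have := P0 x; rewrite PE gapE; case: (h x) => [r||]//.
  - by rewrite -!EFinD !lee_fin; lra.
  - by move=> _; rewrite addey// leey.
have mgap : measurable_fun setT (fun w => gap (xbar s w)).
  exact: (measurable_smoothed_gap setting al_s mx).
have claim1 : (\int[Pr]_w (P (xbar s w) - P xstar) <= ((M s)^-1 * D s)%:E)%E.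
  apply: le_trans HG; apply: ge0_le_integral => //.
  under eq_fun do rewrite PE.
  apply: emeasurable_funD; last exact: (measurable_lsc_comp lsch mx).
  apply/measurable_EFinP; apply: measurable_funB; last exact: measurable_cst.
  exact: (measurable_continuous_comp (F_continuous setting) mx).
(* The sign follows from the bound just proved, which dominates the integral of a nonnegative
   function. *)
have D0 : 0 <= (M s)^-1 * D s.
  rewrite -lee_fin; apply: le_trans claim1.
  by apply: integral_ge0 => w _; exact: P0.
have Ds0 : 0 <= D s by rewrite -(pmulr_rge0 _ (x := (M s)^-1)) ?invr_gt0.
have D30 : 0 <= D3.
  have w0 : 0 < omega := lt_trans ltr01 w1.
  rewrite /D3 mulr_ge0// ?divr_ge0 ?subr_ge0 ?(ltW w0) ?(ltW w1)//.
  by rewrite mulr_ge0 ?sqr_ge0// mulr_ge0// mulr_ge0// ltW.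
have y20 : 0 <= y2 := sqrtr_ge0 _.
split=> //.
  apply: (@le_trans _ _ 0%E); last by apply: integral_ge0 => w _; exact: P0.
  rewrite lee_fin subr_le0; apply: le_trans D0; rewrite oppr_le0.
  rewrite mulr_ge0 ?sqr_ge0// divr_ge0 ?(ltW M0)//.
  exact: mulr_ge0.
have be0 : 0 < beta s.
  by apply: mulr_gt0; [exact: mulr_gt0|rewrite exprn_gt0].
have distE x xi : set_dist (A xi *m x) (b xi) ^+ 2 =
    2 * beta s * penalty A b a (alpha s) x xi.
  by rewrite /penalty /smoothed_dist -/(beta s) mulVKf// gt_eqF// mulr_gt0.
(* [beta s] shrinks as fast as the epochs lengthen: [beta s * m0 * omega ^ s] is constant, and the
   total length is at most [omega / (omega - 1)] times [m0 * omega ^ s]. *)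
have bD3 : beta s * M s <= D3.
  have := ler_wpM2l (ltW be0) (total_length_le w1 m02 s).
  move/le_trans; apply; rewrite le_eqVlt; apply/orP; left; apply/eqP.
  have zs : 0 < omega ^+ s by rewrite exprn_gt0// (lt_trans ltr01).
  rewrite /beta /alpha /D3; move: (omega ^+ s) zs (a ^+ 2) => z z0 a2.
  by field; rewrite ?subr_eq0 ?gt_eqF.
have mdist : measurable_fun setT
    (fun z : Omega * Xi => (set_dist (A z.2 *m xbar s z.1) (b z.2) ^+ 2)%:E).
  apply/measurable_EFinP.
  apply: (measurable_sqdist setting (X := fun z : Omega * Xi => xbar s z.1)
    (u := snd)) => //.
  exact: (random_vector_comp _ mx).
have dist0 (z : Omega * Xi) :
    (0 <= (set_dist (A z.2 *m xbar s z.1) (b z.2) ^+ 2)%:E)%E.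
  by rewrite lee_fin sqr_ge0.
apply: (@sqrte_le _ _ (2 * beta s * ((M s)^-1 * D s))).
  rewrite (fubini_tonelli1 (m1 := Pr) (m2 := law))//.
  rewrite EFinM; apply: le_trans (lee_wpmul2l _ HG); last first.
    by rewrite lee_fin mulr_ge0// ltW.
  rewrite -ge0_integralZl//; last by rewrite lee_fin mulr_ge0// ltW.
  apply: ge0_le_integral => //.
  - by move=> w _; apply: integral_ge0 => xi _; exact: (dist0 (w, xi)).
  - exact: measurable_fun_fubini_tonelli_F.
  - exact: measurable_funeM.
  move=> w _; rewrite /fubini_F/=.
  have ip := integrable_penalty setting al_s (xbar s w).
  under eq_integral do rewrite distE.
  rewrite -EFin_Rintegral; last exact: integrable_funZ.
  rewrite RintegralZl// EFinM lee_wpmul2l//; last exact: Ggap.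
  by rewrite lee_fin mulr_ge0// ltW.
have e0 : 0 <= (M s)^-1 * (2 * D3 * y2 + 2 * Num.sqrt D3 * Num.sqrt (D s)).
  apply: mulr_ge0; first by rewrite invr_ge0 ltW.
  apply: addr_ge0; first by apply: mulr_ge0 => //; exact: mulr_ge0.
  by rewrite mulr_ge0 ?sqrtr_ge0// mulr_ge0 ?sqrtr_ge0.
rewrite -[leRHS]ger0_norm// -sqrtr_sqr; apply: ler_wsqrtr.
have sD3 := sqr_sqrtr D30; have sD := sqr_sqrtr Ds0.
have iM : 0 < (M s)^-1 by rewrite invr_gt0.
have h1 : beta s <= D3 * (M s)^-1 by rewrite ler_pdivlMr.
apply: (@le_trans _ _ (2 * (D3 * (M s)^-1) * ((M s)^-1 * D s))).
  by rewrite ler_wpM2r// ler_wpM2l.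
(* The quantity under the root is at most [2 * D3 * D s / M s ^ 2], half the square of the second
   term of the claim; the first term is nonnegative. *)
apply: (@le_trans _ _ (((M s)^-1 * (2 * Num.sqrt D3 * Num.sqrt (D s))) ^+ 2)).
  rewrite !exprMn sD3 sD.
  have hh (i u v : R) : 0 <= v * i * (i * u) ->
      2 * (v * i) * (i * u) <= i ^+ 2 * (2 ^+ 2 * v * u) by lra.
  apply: hh; apply: mulr_ge0 => //; apply: mulr_ge0 => //; exact: ltW.
have p0 : 0 <= 2 * Num.sqrt D3 * Num.sqrt (D s).
  by rewrite mulr_ge0 ?sqrtr_ge0// mulr_ge0 ?sqrtr_ge0.
rewrite ler_pXn2r ?nnegrE ?(mulr_ge0 (ltW iM) p0)//.
rewrite ler_wpM2l ?(ltW iM)// lerDr.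
by rewrite mulr_ge0// mulr_ge0.
Qed.
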